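(* Let $\{\Phi_t\}_{t\ge 0}$ be a continuous semigroup of analytic functions in the unit disc $\mathbb{D}$. Then there exists $C>0$ such that $$|\Phi_t(z)-z|\leq C\sqrt{t}$$ for all $z\in\mathbb{D}$ and for all $t>0$.
   Context: $\mathbb{D}=\{z\in\mathbb{C}:|z|<1\}$. A continuous semigroup in a domain $\Omega\subset\mathbb{C}$ is a family $\{\Phi_t\}_{t\geq 0}$ of holomorphic functions $\Phi_t:\Omega\to\Omega$ such that: (i) $\Phi_0(z)=z$ for all $z\in\Omega$; (ii) $\Phi_t\circ\Phi_u=\Phi_{t+u}$ for all $t,u\geq 0$; (iii) $\Phi_t\to\Phi_0$ uniformly on compact subsets of $\Omega$ as $t\to 0^+$. *)

(* Defs.v *)
From Stdlib Require Import Reals List.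
From Coquelicot Require Import Coquelicot.
Open Scope R_scope.

Definition unit_disc (z : C) : Prop := Cmod z < 1.

(* [ex_derive] over [C_AbsRing] is complex differentiability. For open [Omega]
   it only depends on the values of [f] on [Omega]. *)
Definition holomorphic_on (Omega : C -> Prop) (f : C -> C) : Prop :=
  forall z : C, Omega z ->
    ex_derive (K := C_AbsRing) (V := C_NormedModule) f z.

Definition is_compact {T : UniformSpace} (K : T -> Prop) : Prop :=
  forall (I : Type) (U : I -> T -> Prop),
    (forall i, open (U i)) ->
    (forall x, K x -> exists i, U i x) ->
    exists l : list I, forall x, K x -> exists i, In i l /\ U i x.

Definition converges_locally_uniformly_at_0 (Omega : C -> Prop)
    (Phi : R -> C -> C) : Prop :=
  forall K : C -> Prop,
    is_compact (T := C_UniformSpace) K ->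
    (forall z, K z -> Omega z) ->
    forall eps : posreal,
      at_right 0 (fun t => forall z, K z -> Cmod (Phi t z - Phi 0 z)%C < eps).

(* [Phi t z] is constrained only for [0 <= t] and [z] in [Omega]; its other
   values are irrelevant. [Omega] is meant to be a domain. *)
Record continuous_semigroup (Omega : C -> Prop) (Phi : R -> C -> C) : Prop := {
  semigroup_holo : forall t, 0 <= t -> holomorphic_on Omega (Phi t);
  semigroup_self : forall t z, 0 <= t -> Omega z -> Omega (Phi t z);
  semigroup_0 : forall z, Omega z -> Phi 0 z = z;
  semigroup_comp : forall t u z, 0 <= t -> 0 <= u -> Omega z ->
    Phi t (Phi u z) = Phi (t + u) z;
  semigroup_cont : converges_locally_uniformly_at_0 Omega Phi
}.

(* Main.v *)
Require Import Defs.
From Stdlib Require Import Reals Lra Lia Psatz List.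
From Stdlib Require Import IndefiniteDescription.
From Coquelicot Require Import Coquelicot.
Open Scope R_scope.

(** The square root comes from one convexity argument in a half-plane. Let [tau] be
    the Denjoy-Wolff point of the semigroup. In the coordinate
    [w = (1 + conj tau z) / (1 - conj tau z)] if [tau] is on the unit circle, or
    [z = exp (-w)] if [tau] has been moved to 0, the semigroup is a flow [w' = U w] in
    the right half-plane with [Re U >= 0]. Let [K] be a primitive of [1 / U], so that
    [K] increases by exactly [t] along an orbit in time [t]. The half-plane is convex:
    if the orbit goes from [a] to [b], then [t / (b - a)] is the mean of [1 / U] over
    the segment from [a] to [b]. Its real part is
    [t (Re b - Re a) / |b - a|^2]. By the Harnack inequality, [Re (1 / U)] is at least
    of the order of the distance to the imaginary axis (with a weight at infinity), so
    that the real part of the mean is at least of the order of [Re a + Re b]. Hence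
    [|b - a|^2 <= C t]; this is [herglotz_primitive_increment]. If [Re U] vanishes at a
    point, then [U] is constant and the displacement is linear in [t].

    The infinitesimal generator does not appear. Instead of [U] there is, for each
    small [s], the difference quotient of the semigroup over the time [s], and orbits
    are sampled with step [s = t / n]. The increment of [K] over one step is [s] up to
    [O(s^2)], and for fixed [a] and [t] the total error vanishes as [n] grows
    ([chain_displacement], [fine_chain_displacement]). The constants must not depend on
    [s]: upper and lower bounds on [U] at the base point 1 come from the orbit of that
    point, which near 1 is almost an arithmetic progression ([base_point_bounds]).

    That the flow moves points to the right is the lemma of Julia and Wolff
    ([Denjoy_Wolff]): [tau] is a limit of fixed points of [(1 - s^2) Phi_s].

    The function theory is developed from complex differentiability: the theorem of
    Goursat gives primitives in the half-plane, and with the coordinate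
    [z = exp (-w)] a primitive gives the bound of the value at the centre of a circle
    by the supremum on it. From this follow a Phragmen-Lindelof principle, the Schwarz
    lemma, and the inequalities of Schwarz-Pick and Harnack. *)

(** * The complex plane *)

Lemma Cmod_sqr (z : C) : Cmod z * Cmod z = fst z * fst z + snd z * snd z.
Proof.
  unfold Cmod. rewrite sqrt_sqrt; [ring|]. nra.
Qed.

Lemma Cmod_le_sqr (z : C) (b : R) :
  0 <= b -> fst z * fst z + snd z * snd z <= b * b -> Cmod z <= b.
Proof.
  intros Hb H. rewrite <- Cmod_sqr in H. pose proof (Cmod_ge_0 z). nra.
Qed.

Lemma Rabs_fst_le_Cmod (z : C) : Rabs (fst z) <= Cmod z.
Proof. eapply Rle_trans; [|apply Rmax_Cmod]. apply Rmax_l. Qed.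

Lemma Rabs_snd_le_Cmod (z : C) : Rabs (snd z) <= Cmod z.
Proof. eapply Rle_trans; [|apply Rmax_Cmod]. apply Rmax_r. Qed.

Lemma fst_le_Cmod (z : C) : fst z <= Cmod z.
Proof. eapply Rle_trans; [apply Rle_abs|apply Rabs_fst_le_Cmod]. Qed.

Lemma Cmod_le_abs_fst_snd (z : C) : Cmod z <= Rabs (fst z) + Rabs (snd z).
Proof.
  pose proof (Rabs_pos (fst z)). pose proof (Rabs_pos (snd z)).
  apply Cmod_le_sqr; [lra|].
  assert (E : forall x, x * x = Rabs x * Rabs x).
  { intro x. rewrite <- Rabs_mult. symmetry. apply Rabs_right. nra. }
  rewrite (E (fst z)), (E (snd z)). nra.
Qed.

Lemma Cmod_triangle_sub (a b : C) : Cmod (a - b) <= Cmod a + Cmod b.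
Proof. unfold Cminus. rewrite <- (Cmod_opp b). apply Cmod_triangle. Qed.

Lemma Cmod_triangle_inv (a b : C) : Cmod a - Cmod b <= Cmod (a - b).
Proof.
  pose proof (Cmod_triangle (a - b) b).
  replace (a - b + b)%C with a in H by ring. lra.
Qed.

Lemma Cmod_sub_sym (a b : C) : Cmod (a - b) = Cmod (b - a).
Proof. rewrite <- Cmod_opp. f_equal. ring. Qed.

Lemma Cmod_sub_trans (a b c : C) : Cmod (a - c) <= Cmod (a - b) + Cmod (b - c).
Proof.
  replace (a - c)%C with ((a - b) + (b - c))%C by ring. apply Cmod_triangle.
Qed.

Lemma Cmod_real_nonneg (r : R) : 0 <= r -> Cmod (RtoC r) = r.
Proof. intro H. rewrite Cmod_R. apply Rabs_pos_eq, H. Qed.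

Lemma Cmod_le_eps_0 (z : C) : (forall eps, 0 < eps -> Cmod z <= eps) -> z = 0.
Proof.
  intro H. apply Cmod_eq_0. apply Rle_antisym; [|apply Cmod_ge_0].
  apply le_epsilon. intros e He. specialize (H e He). lra.
Qed.

Lemma fst_Cdiv (a b : C) :
  b <> 0 -> fst (a / b)%C = fst (a * Cconj b)%C / (Cmod b * Cmod b).
Proof.
  intro Hb. pose proof (proj1 (Cmod_gt_0 b) Hb) as P. rewrite Cmod_sqr.
  pose proof (Cmod_sqr b) as S. destruct a, b. simpl in *. field. nra.
Qed.

(** * Complex derivatives *)

(** With moduli on both sides, the rules of differentiation are inequalities between
    real numbers. *)
Definition has_cderive (f : C -> C) (z l : C) : Prop :=
  forall eps, 0 < eps -> exists delta, 0 < delta /\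
    forall w, Cmod (w - z) < delta ->
      Cmod (f w - f z - l * (w - z)) <= eps * Cmod (w - z).

Definition cdiff (f : C -> C) (z : C) : Prop := exists l, has_cderive f z l.

Lemma has_cderive_eq (f : C -> C) (z l m : C) :
  has_cderive f z l -> l = m -> has_cderive f z m.
Proof. intros H <-. exact H. Qed.

Lemma ex_derive_cdiff (f : C -> C) (z : C) :
  ex_derive (K := C_AbsRing) (V := C_NormedModule) f z -> cdiff f z.
Proof.
  intros [l [_ H]]. exists l. intros eps Heps.
  destruct (H z (fun P HP => HP) (mkposreal eps Heps)) as [d Hd].
  exists d. split; [apply cond_pos|]. intros w Hw.
  specialize (Hd w Hw). simpl in Hd.
  replace (f w - f z - l * (w - z))%C
    with (f w - f z - (w - z) * l)%C by ring.
  exact Hd.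
Qed.

Definition ccont (f : C -> C) (z : C) : Prop :=
  forall eps, 0 < eps -> exists delta, 0 < delta /\
    forall w, Cmod (w - z) < delta -> Cmod (f w - f z) < eps.

Lemma has_cderive_lipschitz (f : C -> C) (z l : C) :
  has_cderive f z l -> exists delta, 0 < delta /\
    forall w, Cmod (w - z) < delta -> Cmod (f w - f z) <= (Cmod l + 1) * Cmod (w - z).
Proof.
  intro H. destruct (H 1 Rlt_0_1) as [d [Hd Hw]]. exists d. split; [exact Hd|].
  intros w Hwd. specialize (Hw w Hwd).
  replace (f w - f z)%C with ((f w - f z - l * (w - z)) + l * (w - z))%C by ring.
  eapply Rle_trans; [apply Cmod_triangle|]. rewrite Cmod_mult. lra.
Qed.

Lemma cdiff_ccont (f : C -> C) (z : C) : cdiff f z -> ccont f z.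
Proof.
  intros [l H] eps Heps.
  destruct (has_cderive_lipschitz f z l H) as [d [Hd Hw]].
  pose proof (Cmod_ge_0 l).
  exists (Rmin d (eps / (Cmod l + 1))). split.
  { apply Rmin_glb_lt; [exact Hd|]. apply Rdiv_lt_0_compat; lra. }
  intros w Hwd. eapply Rle_lt_trans; [apply Hw|].
  { eapply Rlt_le_trans; [exact Hwd|apply Rmin_l]. }
  assert (Cmod (w - z) < eps / (Cmod l + 1)).
  { eapply Rlt_le_trans; [exact Hwd|apply Rmin_r]. }
  apply (Rmult_lt_compat_l (Cmod l + 1)) in H1; [|lra].
  replace ((Cmod l + 1) * (eps / (Cmod l + 1))) with eps in H1 by (field; lra).
  exact H1.
Qed.

Lemma has_cderive_const (c z : C) : has_cderive (fun _ => c) z 0.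
Proof.
  intros eps Heps. exists 1. split; [lra|]. intros w _.
  replace (c - c - 0 * (w - z))%C with (RtoC 0) by ring. rewrite Cmod_0.
  pose proof (Cmod_ge_0 (w - z)). nra.
Qed.

Lemma has_cderive_id (z : C) : has_cderive (fun w => w) z 1.
Proof.
  intros eps Heps. exists 1. split; [lra|]. intros w _.
  replace (w - z - 1 * (w - z))%C with (RtoC 0) by ring. rewrite Cmod_0.
  pose proof (Cmod_ge_0 (w - z)). nra.
Qed.

Lemma cdiff_const (c z : C) : cdiff (fun _ => c) z.
Proof. eexists. apply has_cderive_const. Qed.

Lemma cdiff_id (z : C) : cdiff (fun w => w) z.
Proof. eexists. apply has_cderive_id. Qed.

Lemma has_cderive_plus (f g : C -> C) (z l m : C) :
  has_cderive f z l -> has_cderive g z m ->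
  has_cderive (fun w => f w + g w)%C z (l + m)%C.
Proof.
  intros Hf Hg eps Heps.
  destruct (Hf (eps / 2)) as [d1 [Hd1 H1]]; [lra|].
  destruct (Hg (eps / 2)) as [d2 [Hd2 H2]]; [lra|].
  exists (Rmin d1 d2). split; [apply Rmin_glb_lt; assumption|]. intros w Hw.
  specialize (H1 w (Rlt_le_trans _ _ _ Hw (Rmin_l _ _))).
  specialize (H2 w (Rlt_le_trans _ _ _ Hw (Rmin_r _ _))).
  replace (f w + g w - (f z + g z) - (l + m) * (w - z))%C
    with ((f w - f z - l * (w - z)) + (g w - g z - m * (w - z)))%C by ring.
  eapply Rle_trans; [apply Cmod_triangle|]. lra.
Qed.

Lemma cdiff_plus (f g : C -> C) (z : C) :
  cdiff f z -> cdiff g z -> cdiff (fun w => f w + g w)%C z.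
Proof. intros [l Hl] [m Hm]. exists (l + m)%C. apply has_cderive_plus; assumption. Qed.

Lemma has_cderive_comp (f g : C -> C) (z l m : C) :
  has_cderive g z m -> has_cderive f (g z) l ->
  has_cderive (fun w => f (g w)) z (l * m)%C.
Proof.
  intros Hg Hf eps Heps.
  pose proof (Cmod_ge_0 l) as Pl. pose proof (Cmod_ge_0 m) as Pm.
  destruct (has_cderive_lipschitz g z m Hg) as [d0 [Hd0 H0]].
  set (e1 := eps / 2 / (Cmod m + 1)).
  assert (He1 : 0 < e1) by (unfold e1; apply Rdiv_lt_0_compat; lra).
  set (e2 := eps / 2 / (Cmod l + 1)).
  assert (He2 : 0 < e2) by (unfold e2; apply Rdiv_lt_0_compat; lra).
  destruct (Hf e1 He1) as [d1 [Hd1 H1]].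
  destruct (Hg e2 He2) as [d2 [Hd2 H2]].
  exists (Rmin (Rmin d0 d2) (d1 / (Cmod m + 1))). split.
  { repeat apply Rmin_glb_lt; try assumption. apply Rdiv_lt_0_compat; lra. }
  intros w Hw.
  apply Rmin_Rgt_l in Hw as [[Hw0 Hw2]%Rmin_Rgt_l Hw1].
  specialize (H0 w Hw0). specialize (H2 w Hw2).
  assert (Hg1 : Cmod (g w - g z) < d1).
  { eapply Rle_lt_trans; [exact H0|].
    apply (Rmult_lt_compat_l (Cmod m + 1)) in Hw1; [|lra].
    replace ((Cmod m + 1) * (d1 / (Cmod m + 1))) with d1 in Hw1 by (field; lra).
    exact Hw1. }
  specialize (H1 (g w) Hg1).
  replace (f (g w) - f (g z) - l * m * (w - z))%C
    with ((f (g w) - f (g z) - l * (g w - g z)) + l * (g w - g z - m * (w - z)))%C by ring.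
  eapply Rle_trans; [apply Cmod_triangle|]. rewrite Cmod_mult.
  pose proof (Cmod_ge_0 (w - z)) as Pw.
  assert (A1 : e1 * Cmod (g w - g z) <= eps / 2 * Cmod (w - z)).
  { eapply Rle_trans; [apply Rmult_le_compat_l; [lra|exact H0]|].
    apply Req_le. unfold e1. field. lra. }
  assert (A2 : Cmod l * Cmod (g w - g z - m * (w - z)) <= eps / 2 * Cmod (w - z)).
  { eapply Rle_trans; [apply Rmult_le_compat_l; [lra|exact H2]|].
    rewrite <- Rmult_assoc. apply Rmult_le_compat_r; [exact Pw|].
    replace (eps / 2) with ((Cmod l + 1) * e2) by (unfold e2; field; lra).
    apply Rmult_le_compat_r; lra. }
  lra.
Qed.

Lemma cdiff_comp (f g : C -> C) (z : C) :
  cdiff g z -> cdiff f (g z) -> cdiff (fun w => f (g w)) z.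
Proof. intros [m Hm] [l Hl]. exists (l * m)%C. apply has_cderive_comp; assumption. Qed.

Lemma has_cderive_mult (f g : C -> C) (z l m : C) :
  has_cderive f z l -> has_cderive g z m ->
  has_cderive (fun w => f w * g w)%C z (l * g z + f z * m)%C.
Proof.
  intros Hf Hg eps Heps.
  pose proof (Cmod_ge_0 l) as Pl. pose proof (Cmod_ge_0 m) as Pm.
  pose proof (Cmod_ge_0 (f z)) as Pf. pose proof (Cmod_ge_0 (g z)) as Pg.
  destruct (has_cderive_lipschitz f z l Hf) as [a [Ha La]].
  destruct (has_cderive_lipschitz g z m Hg) as [b [Hb Lb]].
  set (N := 1 + Cmod (g z) + Cmod (f z)).
  assert (HN : 0 < N) by (unfold N; lra).
  destruct (Hf (eps / 3 / N)) as [d1 [Hd1 H1]].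
  { apply Rdiv_lt_0_compat; lra. }
  destruct (Hg (eps / 3 / N)) as [d2 [Hd2 H2]].
  { apply Rdiv_lt_0_compat; lra. }
  set (L := (Cmod l + 1) * (Cmod m + 1)).
  assert (HL : 0 < L) by (unfold L; nra).
  exists (Rmin (Rmin a b) (Rmin (Rmin d1 d2) (eps / 3 / L))). split.
  { repeat apply Rmin_glb_lt; try assumption. apply Rdiv_lt_0_compat; lra. }
  intros w Hw.
  apply Rmin_Rgt_l in Hw as [[Hwa Hwb]%Rmin_Rgt_l [[Hw1 Hw2]%Rmin_Rgt_l Hw3]%Rmin_Rgt_l].
  specialize (La w Hwa). specialize (Lb w Hwb).
  specialize (H1 w Hw1). specialize (H2 w Hw2).
  pose proof (Cmod_ge_0 (w - z)) as Pw. set (h := Cmod (w - z)) in *.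
  replace (f w * g w - f z * g z - (l * g z + f z * m) * (w - z))%C
    with ((f w - f z - l * (w - z)) * g z + f z * (g w - g z - m * (w - z))
          + (f w - f z) * (g w - g z))%C by ring.
  eapply Rle_trans; [apply Cmod_triangle|].
  eapply Rle_trans; [apply Rplus_le_compat_r, Cmod_triangle|]. rewrite !Cmod_mult.
  assert (B : forall x, 0 <= x <= N -> eps / 3 / N * h * x <= eps / 3 * h).
  { intros x Hx. replace (eps / 3 * h) with (eps / 3 / N * h * N) by (field; lra).
    apply Rmult_le_compat_l; [|lra]. apply Rmult_le_pos; [|exact Pw].
    apply Rlt_le, Rdiv_lt_0_compat; lra. }
  assert (A1 : Cmod (f w - f z - l * (w - z)) * Cmod (g z) <= eps / 3 * h).
  { eapply Rle_trans; [apply Rmult_le_compat_r; [exact Pg|exact H1]|].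
    apply B. unfold N. lra. }
  assert (A2 : Cmod (f z) * Cmod (g w - g z - m * (w - z)) <= eps / 3 * h).
  { eapply Rle_trans; [apply Rmult_le_compat_l; [exact Pf|exact H2]|].
    rewrite Rmult_comm. apply B. unfold N. lra. }
  assert (A3 : Cmod (f w - f z) * Cmod (g w - g z) <= eps / 3 * h).
  { eapply Rle_trans; [apply Rmult_le_compat; [apply Cmod_ge_0|apply Cmod_ge_0|exact La|exact Lb]|].
    replace ((Cmod l + 1) * h * ((Cmod m + 1) * h)) with (L * h * h) by (unfold L; ring).
    apply Rmult_le_compat_r; [exact Pw|].
    apply Rlt_le in Hw3. apply (Rmult_le_compat_l L) in Hw3; [|lra].
    replace (L * (eps / 3 / L)) with (eps / 3) in Hw3 by (field; lra). exact Hw3. }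
  lra.
Qed.

Lemma cdiff_mult (f g : C -> C) (z : C) :
  cdiff f z -> cdiff g z -> cdiff (fun w => f w * g w)%C z.
Proof. intros [l Hl] [m Hm]. eexists. apply has_cderive_mult; eassumption. Qed.

Lemma has_cderive_opp (f : C -> C) (z l : C) :
  has_cderive f z l -> has_cderive (fun w => - f w)%C z (- l)%C.
Proof.
  intros H eps Heps. destruct (H eps Heps) as [d [Hd Hw]]. exists d. split; [exact Hd|].
  intros w Hwz. rewrite <- Cmod_opp.
  replace (- (- f w - - f z - - l * (w - z)))%C with (f w - f z - l * (w - z))%C by ring. auto.
Qed.

Lemma cdiff_opp (f : C -> C) (z : C) : cdiff f z -> cdiff (fun w => - f w)%C z.
Proof. intros [l H]. exists (- l)%C. apply has_cderive_opp, H. Qed.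

Lemma cdiff_minus (f g : C -> C) (z : C) :
  cdiff f z -> cdiff g z -> cdiff (fun w => f w - g w)%C z.
Proof. intros Hf Hg. apply cdiff_plus; [exact Hf|apply cdiff_opp, Hg]. Qed.

Lemma Cmod_pos_neq_0 (z : C) : 0 < Cmod z -> z <> 0.
Proof. intros H E. rewrite E, Cmod_0 in H. lra. Qed.

Lemma cdiff_Cinv (z : C) : z <> 0 -> cdiff Cinv z.
Proof.
  intro Hz. pose proof (proj1 (Cmod_gt_0 z) Hz) as Pz. set (r := Cmod z) in *.
  exists (- / (z * z))%C. intros eps Heps.
  exists (Rmin (r / 2) (eps * r * r * r / 2)). split.
  { apply Rmin_glb_lt; [lra|]. assert (0 < r * r * r) by (repeat apply Rmult_lt_0_compat; lra). nra. }
  intros w Hw.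
  assert (H1 : Cmod (w - z) < r / 2) by (eapply Rlt_le_trans; [exact Hw|apply Rmin_l]).
  assert (H2 : Cmod (w - z) < eps * r * r * r / 2) by (eapply Rlt_le_trans; [exact Hw|apply Rmin_r]).
  assert (H3 : r / 2 <= Cmod w).
  { pose proof (Cmod_triangle_inv z w). rewrite Cmod_sub_sym in H. fold r in H. lra. }
  assert (Hw0 : w <> 0) by (apply Cmod_pos_neq_0; lra).
  replace (/ w - / z - - / (z * z) * (w - z))%C
    with ((w - z) * ((w - z) / (z * z * w)))%C by (field; split; assumption).
  rewrite Cmod_mult, Rmult_comm. apply Rmult_le_compat_r; [apply Cmod_ge_0|].
  rewrite Cmod_div by (repeat apply Cmult_neq_0; assumption). rewrite !Cmod_mult. fold r.
  apply Rle_div_l.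
  { apply Rmult_lt_0_compat; [nra|lra]. }
  eapply Rle_trans; [apply Rlt_le, H2|].
  replace (eps * r * r * r / 2) with (eps * (r * r * (r / 2))) by field.
  apply Rmult_le_compat_l; [lra|]. apply Rmult_le_compat_l; [nra|exact H3].
Qed.

Lemma cdiff_inv (f : C -> C) (z : C) :
  cdiff f z -> f z <> 0 -> cdiff (fun w => / f w)%C z.
Proof. intros H H0. apply (cdiff_comp Cinv f); [exact H|apply cdiff_Cinv, H0]. Qed.

Lemma cdiff_div (f g : C -> C) (z : C) :
  cdiff f z -> cdiff g z -> g z <> 0 -> cdiff (fun w => f w / g w)%C z.
Proof. intros Hf Hg H0. apply cdiff_mult; [exact Hf|apply cdiff_inv; assumption]. Qed.

(** The mean value theorem for the real part of [K * c] along a segment. As [c]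
    varies, these are all the real linear functionals of the increment. *)
Lemma cderive_segment_MVT (K k : C -> C) (a v c : C) (r0 r1 : R) :
  r0 < r1 ->
  (forall r, r0 <= r <= r1 -> has_cderive K (a + r * v) (k (a + r * v)%C)) ->
  exists r, r0 <= r <= r1 /\
    fst ((K (a + r1 * v) - K (a + r0 * v)) * c)%C
    = fst (k (a + r * v) * v * c)%C * (r1 - r0).
Proof.
  intros Hr H.
  set (phi := fun r : R => fst (K (a + r * v) * c)%C).
  assert (D : forall r, r0 <= r <= r1 ->
             is_derive phi r (fst (k (a + r * v) * v * c)%C)).
  { intros r Hr0. apply is_derive_Reals. intros eps Heps.
    pose proof (Cmod_ge_0 v) as Pv. pose proof (Cmod_ge_0 c) as Pc.
    set (N := Cmod v * Cmod c + 1).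
    assert (HN : 0 < N) by (unfold N; nra).
    destruct (H r Hr0 (eps / 2 / N)) as [d [Hd Hw]].
    { apply Rdiv_lt_0_compat; lra. }
    assert (Hd' : 0 < d / (Cmod v + 1)) by (apply Rdiv_lt_0_compat; lra).
    exists (mkposreal _ Hd'). intros h Hh0 Hh. simpl in Hh.
    assert (Hah : 0 < Rabs h) by (apply Rabs_pos_lt, Hh0).
    specialize (Hw (a + (r + h) * v)%C).
    assert (Eh : (a + RtoC (r + h) * v - (a + r * v))%C = (RtoC h * v)%C).
    { rewrite RtoC_plus. ring. }
    rewrite <- RtoC_plus in Hw. rewrite Eh in Hw. rewrite Cmod_mult, Cmod_R in Hw.
    assert (Hlt : Rabs h * Cmod v < d).
    { apply (Rmult_lt_compat_r (Cmod v + 1)) in Hh; [|lra].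
      replace (d / (Cmod v + 1) * (Cmod v + 1)) with d in Hh by (field; lra). nra. }
    specialize (Hw Hlt).
    replace ((phi (r + h) - phi r) / h - fst (k (a + r * v) * v * c)%C)
      with (fst ((K (a + (r + h)%R * v) - K (a + r * v) - k (a + r * v) * (h * v)) * c)%C / h).
    2:{ unfold phi. simpl. field. exact Hh0. }
    unfold Rdiv at 1. rewrite Rabs_mult, Rabs_inv.
    eapply Rle_lt_trans.
    { apply Rmult_le_compat_r; [left; apply Rinv_0_lt_compat, Hah|].
      eapply Rle_trans; [apply Rabs_fst_le_Cmod|]. rewrite Cmod_mult.
      apply Rmult_le_compat_r; [exact Pc|exact Hw]. }
    replace (eps / 2 / N * (Rabs h * Cmod v) * Cmod c * / Rabs h)
      with (eps / 2 / N * (Cmod v * Cmod c)) by (field; split; lra).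
    assert (eps / 2 / N * (Cmod v * Cmod c) <= eps / 2 / N * N).
    { apply Rmult_le_compat_l; [apply Rlt_le, Rdiv_lt_0_compat; lra|unfold N; lra]. }
    replace (eps / 2 / N * N) with (eps / 2) in H0 by (field; lra). lra. }
  destruct (MVT_gen phi r0 r1 (fun r => fst (k (a + r * v) * v * c)%C)) as [r [Hr1 E]].
  - intros x Hx. rewrite Rmin_left, Rmax_right in Hx by lra. apply D. lra.
  - intros x Hx. rewrite Rmin_left, Rmax_right in Hx by lra.
    apply continuity_pt_filterlim, (ex_derive_continuous phi). eexists. apply D. lra.
  - rewrite Rmin_left, Rmax_right in Hr1 by lra. exists r. split; [lra|].
    rewrite <- E. unfold phi. simpl. ring.
Qed.

(** The multiplier [c] of the mean value theorem is the conjugate of the increment,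
    which makes the real part the squared modulus of the increment. *)
Lemma cderive_segment_bound (K k : C -> C) (a b : C) (M : R) :
  (forall r, 0 <= r <= 1 -> has_cderive K (a + r * (b - a)) (k (a + r * (b - a))%C)) ->
  (forall r, 0 <= r <= 1 -> Cmod (k (a + r * (b - a))%C) <= M) ->
  Cmod (K b - K a) <= M * Cmod (b - a).
Proof.
  intros D B.
  destruct (cderive_segment_MVT K k a (b - a) (Cconj (K b - K a)) 0 1 Rlt_0_1 D) as [r [Hr E]].
  replace (a + 1 * (b - a))%C with b in E by ring.
  replace (a + 0 * (b - a))%C with a in E by ring.
  assert (E1 : fst ((K b - K a) * Cconj (K b - K a))%C = Cmod (K b - K a) * Cmod (K b - K a)).
  { rewrite Cmod_sqr. simpl. ring. }
  rewrite E1 in E. clear E1.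
  pose proof (Cmod_ge_0 (K b - K a)) as P. pose proof (Cmod_ge_0 (b - a)) as Q.
  specialize (B r Hr). pose proof (Cmod_ge_0 (k (a + r * (b - a))%C)) as Pk.
  assert (F : fst (k (a + r * (b - a)) * (b - a) * Cconj (K b - K a))%C
              <= M * Cmod (b - a) * Cmod (K b - K a)).
  { eapply Rle_trans; [apply fst_le_Cmod|]. rewrite !Cmod_mult, Cmod_conj.
    apply Rmult_le_compat_r; [exact P|]. apply Rmult_le_compat_r; [exact Q|exact B]. }
  destruct (Req_dec (Cmod (K b - K a)) 0) as [Z|NZ].
  - rewrite Z. apply Rmult_le_pos; [lra|exact Q].
  - apply Rmult_le_reg_r with (Cmod (K b - K a)); lra.
Qed.

(** * Primitives in the right half-plane *)

(** Restores the carrier [C] in an equation stated in a normed module over it, where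
    [ring] and [field] do not recognize it. *)
Ltac C_eq := match goal with |- @eq _ ?x ?y => change (@eq C x y) end.

Definition rhp (z : C) : Prop := 0 < fst z.

Lemma rhp_segment (a b : C) (r : R) :
  rhp a -> rhp b -> 0 <= r <= 1 -> rhp (a + r * (b - a)).
Proof. unfold rhp. intros Ha Hb Hr. simpl. nra. Qed.

Lemma norm_C_R (z : C) : norm (V := C_R_NormedModule) z = Cmod z.
Proof. rewrite Cmod_norm. reflexivity. Qed.

Lemma continuous_ccont_path (f : C -> C) (a b : C) (r : R) :
  ccont f (a + r * (b - a)) ->
  continuous (T := R_UniformSpace) (U := C_R_NormedModule) (fun r : R => f (a + r * (b - a))%C) r.
Proof.
  intro H. apply filterlim_locally. intro eps.
  destruct (H eps (cond_pos eps)) as [d [Hd Hw]].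
  pose proof (Cmod_ge_0 (b - a)) as P.
  assert (Hd' : 0 < d / (Cmod (b - a) + 1)) by (apply Rdiv_lt_0_compat; lra).
  exists (mkposreal _ Hd'). intros s Hs. change R in s.
  unfold ball in Hs. simpl in Hs. unfold AbsRing_ball, abs, minus, plus, opp in Hs. simpl in Hs.
  assert (Hc : Cmod (f (a + s * (b - a)) - f (a + r * (b - a)))%C < eps).
  { apply Hw.
    replace (a + s * (b - a) - (a + r * (b - a)))%C with (RtoC (s - r) * (b - a))%C
      by (rewrite RtoC_minus; ring).
    rewrite Cmod_mult, Cmod_R.
    apply (Rmult_lt_compat_r (Cmod (b - a) + 1)) in Hs; [|lra].
    replace (d / (Cmod (b - a) + 1) * (Cmod (b - a) + 1)) with d in Hs by (field; lra).
    pose proof (Rabs_pos (s + - r)). unfold Rminus. nra. }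
  split; unfold ball; simpl; unfold AbsRing_ball, abs, minus, plus, opp; simpl.
  - eapply Rle_lt_trans; [|exact Hc]. apply (Rabs_fst_le_Cmod (f (a + s * (b - a)) - f (a + r * (b - a)))%C).
  - eapply Rle_lt_trans; [|exact Hc]. apply (Rabs_snd_le_Cmod (f (a + s * (b - a)) - f (a + r * (b - a)))%C).
Qed.

(** The mean rather than the integral: it does not change under reversal. *)
Definition seg_mean (f : C -> C) (a b : C) : C :=
  RInt (V := C_R_CompleteNormedModule) (fun r : R => f (a + r * (b - a))%C) 0 1.

Definition seg_int (f : C -> C) (a b : C) : C := ((b - a) * seg_mean f a b)%C.

Section SegmentIntegrals.

Variable f : C -> C.
Hypothesis f_cont : forall z, rhp z -> ccont f z.

Lemma ex_RInt_segment (a b : C) (x y : R) :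
  rhp a -> rhp b -> 0 <= x <= 1 -> 0 <= y <= 1 ->
  ex_RInt (V := C_R_CompleteNormedModule) (fun r : R => f (a + r * (b - a))%C) x y.
Proof.
  intros Ha Hb Hx Hy. apply (ex_RInt_continuous (V := C_R_CompleteNormedModule)).
  intros r Hr. apply continuous_ccont_path, f_cont, rhp_segment; try assumption.
  revert Hr. unfold Rmin, Rmax. destruct (Rle_dec x y); lra.
Qed.

Lemma seg_mean_rev (a b : C) : rhp a -> rhp b -> seg_mean f b a = seg_mean f a b.
Proof.
  intros Ha Hb. unfold seg_mean.
  rewrite <- (opp_RInt_swap (V := C_R_CompleteNormedModule) (fun r : R => f (a + r * (b - a))%C) 1 0).
  2: apply (ex_RInt_segment a b); auto; lra.
  assert (E := RInt_comp_lin (V := C_R_CompleteNormedModule)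
                 (fun r : R => f (a + r * (b - a))%C) (-1) 1 0 1).
  replace (-1 * 0 + 1) with 1 in E by ring. replace (-1 * 1 + 1) with 0 in E by ring.
  specialize (E (ex_RInt_segment a b 1 0 Ha Hb ltac:(lra) ltac:(lra))).
  rewrite <- E.
  rewrite <- (RInt_opp (V := C_R_CompleteNormedModule)).
  - apply (RInt_ext (V := C_R_CompleteNormedModule)). intros r Hr.
    rewrite RtoC_plus, RtoC_mult.
    replace (b + r * (a - b))%C with (a + (RtoC (-1) * r + 1) * (b - a))%C by ring.
    rewrite scal_R_Cmult. change (opp ?x) with (- x)%C. C_eq. ring.
  - apply (ex_RInt_comp_lin (V := C_R_CompleteNormedModule) (fun r : R => f (a + r * (b - a))%C) (-1) 1 0 1).
    replace (-1 * 0 + 1) with 1 by ring. replace (-1 * 1 + 1) with 0 by ring.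
    apply ex_RInt_segment; auto; lra.
Qed.

Lemma seg_int_rev (a b : C) : rhp a -> rhp b -> seg_int f b a = (- seg_int f a b)%C.
Proof.
  intros Ha Hb. unfold seg_int. rewrite seg_mean_rev by assumption. ring.
Qed.

Lemma seg_mean_split (a b m : C) :
  rhp a -> rhp b -> m = ((a + b) / 2)%C ->
  seg_mean f a b = ((seg_mean f a m + seg_mean f m b) / 2)%C.
Proof.
  intros Ha Hb ->. unfold seg_mean.
  rewrite <- (RInt_Chasles (V := C_R_CompleteNormedModule) _ 0 (1/2) 1);
    try (apply ex_RInt_segment; auto; lra).
  assert (E1 := RInt_comp_lin (V := C_R_CompleteNormedModule)
                 (fun r : R => f (a + r * (b - a))%C) (1/2) 0 0 1).
  replace (1/2 * 0 + 0) with 0 in E1 by field. replace (1/2 * 1 + 0) with (1/2) in E1 by field.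
  assert (E2 := RInt_comp_lin (V := C_R_CompleteNormedModule)
                 (fun r : R => f (a + r * (b - a))%C) (1/2) (1/2) 0 1).
  replace (1/2 * 0 + 1/2) with (1/2) in E2 by field. replace (1/2 * 1 + 1/2) with 1 in E2 by field.
  assert (Hm : rhp ((a + b) / 2)%C).
  { unfold rhp in *. replace ((a + b) / 2)%C with (RtoC (/2) * (a + b))%C.
    - simpl. lra.
    - rewrite RtoC_inv by lra. unfold Cdiv. ring. }
  set (m := ((a + b) / 2)%C) in *.
  assert (F1 : RInt (V := C_R_CompleteNormedModule) (fun r : R => f (a + r * (b - a))%C) 0 (1/2)
     = scal (1/2) (RInt (V := C_R_CompleteNormedModule) (fun r : R => f (a + r * (m - a))%C) 0 1)).
  { rewrite <- E1 by (apply ex_RInt_segment; auto; lra).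
    etransitivity; [|apply (RInt_scal (V := C_R_CompleteNormedModule)); apply ex_RInt_segment; auto; lra].
    apply (RInt_ext (V := C_R_CompleteNormedModule)). intros r _. do 2 f_equal.
    unfold m. rewrite !RtoC_plus, !RtoC_mult, RtoC_div by lra. field. }
  assert (F2 : RInt (V := C_R_CompleteNormedModule) (fun r : R => f (a + r * (b - a))%C) (1/2) 1
     = scal (1/2) (RInt (V := C_R_CompleteNormedModule) (fun r : R => f (m + r * (b - m))%C) 0 1)).
  { rewrite <- E2 by (apply ex_RInt_segment; auto; lra).
    etransitivity; [|apply (RInt_scal (V := C_R_CompleteNormedModule)); apply ex_RInt_segment; auto; lra].
    apply (RInt_ext (V := C_R_CompleteNormedModule)). intros r _. do 2 f_equal.
    unfold m. rewrite !RtoC_plus, !RtoC_mult, RtoC_div by lra. field. }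
  rewrite F1, F2, !scal_R_Cmult. change (plus ?x ?y) with (x + y)%C. C_eq.
  rewrite RtoC_div by lra. field.
Qed.

Lemma seg_int_split (a b m : C) :
  rhp a -> rhp b -> m = ((a + b) / 2)%C ->
  seg_int f a b = (seg_int f a m + seg_int f m b)%C.
Proof.
  intros Ha Hb Hm. unfold seg_int. rewrite (seg_mean_split a b m) by assumption. subst m. field.
Qed.

(** The mean of an affine function over a segment is its value at the midpoint. *)
Lemma seg_int_near_affine (a b p q : C) (M : R) :
  rhp a -> rhp b ->
  (forall r, 0 <= r <= 1 ->
     Cmod (f (a + r * (b - a)) - (p + q * (a + r * (b - a))))%C <= M) ->
  Cmod (seg_int f a b - (b - a) * (p + q * ((a + b) / 2)))%C <= M * Cmod (b - a).
Proof.
  intros Ha Hb H.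
  assert (A : is_RInt (V := C_R_CompleteNormedModule)
                (fun r : R => (p + q * (a + r * (b - a)))%C) 0 1 (p + q * ((a + b) / 2))%C).
  { replace (p + q * ((a + b) / 2))%C
      with (minus (G := C_R_CompleteNormedModule)
             ((fun r : R => (RtoC r * (p + q * a) + RtoC (r * r / 2) * (q * (b - a)))%C) 1)
             ((fun r : R => (RtoC r * (p + q * a) + RtoC (r * r / 2) * (q * (b - a)))%C) 0)).
    - apply (is_RInt_derive (V := C_R_CompleteNormedModule)
               (fun r : R => (RtoC r * (p + q * a) + RtoC (r * r / 2) * (q * (b - a)))%C)).
      + intros x _.
        apply (is_derive_ext (fun r : R => plus (G := C_R_NormedModule) (scal r (p + q * a)%C) (scal (r * r / 2) (q * (b - a))%C))).
        { intro t. rewrite !scal_R_Cmult. reflexivity. }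
        replace (p + q * (a + x * (b - a)))%C
          with (plus (G := C_R_NormedModule) (scal 1 (p + q * a)%C) (scal x (q * (b - a))%C)).
        2:{ rewrite !scal_R_Cmult. change (plus ?x ?y) with (x + y)%C. C_eq. ring. }
        apply (is_derive_plus (V := C_R_NormedModule)).
        * apply (is_derive_scal_l (V := C_R_NormedModule) (fun r => r) x 1 (p + q * a)%C).
          apply (is_derive_id (K := R_AbsRing)).
        * apply (is_derive_scal_l (V := C_R_NormedModule) (fun r => r * r / 2) x x (q * (b - a))%C).
          auto_derive; [exact I|field].
      + intros x _.
        apply (continuous_ccont_path (fun z => p + q * z)%C).
        apply cdiff_ccont, cdiff_plus; [apply cdiff_const|].
        apply cdiff_mult; [apply cdiff_const|apply cdiff_id].
    - unfold minus, plus, opp; simpl. unfold prod_plus, prod_opp. simpl.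
      change (prod_plus ?x ?y) with (x + y)%C.
      apply injective_projections; simpl; unfold plus, opp; simpl; field. }
  assert (B := RInt_correct (V := C_R_CompleteNormedModule) _ _ _ (ex_RInt_segment a b 0 1 Ha Hb ltac:(lra) ltac:(lra))).
  assert (D := is_RInt_minus (V := C_R_NormedModule) _ _ _ _ _ _ B A).
  apply norm_RInt_le_const with (M := M) in D; [|lra|].
  2:{ intros r Hr. rewrite norm_C_R. apply (H r Hr). }
  rewrite norm_C_R in D. unfold seg_int.
  replace ((b - a) * seg_mean f a b - (b - a) * (p + q * ((a + b) / 2)))%C
    with ((b - a) * (seg_mean f a b - (p + q * ((a + b) / 2))))%C by ring.
  rewrite Cmod_mult, Rmult_comm. apply Rmult_le_compat_r; [apply Cmod_ge_0|].
  eapply Rle_trans; [exact D|]. lra.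
Qed.

End SegmentIntegrals.

Lemma R_bounded_cluster (u : nat -> R) (M : R) :
  (forall n, Rabs (u n) <= M) ->
  exists l, forall eps N, 0 < eps -> exists n, (N <= n)%nat /\ Rabs (u n - l) < eps.
Proof.
  intro H. destruct (Bolzano_Weierstrass u (fun x => -M <= x <= M)) as [l Hl].
  - apply compact_P3.
  - intro n. apply Rabs_le_between, H.
  - exists l. intros eps N Heps.
    destruct (Hl (disc l (mkposreal eps Heps)) N) as [n [Hn Hd]].
    + exists (mkposreal eps Heps). intros x Hx. exact Hx.
    + exists n. split; [exact Hn|exact Hd].
Qed.

Lemma C_bounded_cluster (u : nat -> C) (M : R) :
  (forall n, Cmod (u n) <= M) ->
  exists p, forall eps N, 0 < eps -> exists n, (N <= n)%nat /\ Cmod (u n - p) < eps.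
Proof.
  intro H.
  destruct (R_bounded_cluster (fun n => fst (u n)) M) as [x Hx].
  { intro n. eapply Rle_trans; [apply Rabs_fst_le_Cmod|apply H]. }
  assert (Pos : forall n, 0 < / (INR n + 1)).
  { intro n. apply Rinv_0_lt_compat. pose proof (pos_INR n). lra. }
  destruct (functional_choice (fun n k => (n <= k)%nat /\ Rabs (fst (u k) - x) < / (INR n + 1)))
    as [phi Hphi].
  { intro n. apply Hx, Pos. }
  destruct (R_bounded_cluster (fun n => snd (u (phi n))) M) as [y Hy].
  { intro n. eapply Rle_trans; [apply Rabs_snd_le_Cmod|apply H]. }
  exists (x, y). intros eps N Heps.
  destruct (archimed_cor1 (eps / 2)) as [K [HK HK0]]; [lra|].
  destruct (Hy (eps / 2) (max N K)) as [n [Hn Hyn]]; [lra|].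
  destruct (Hphi n) as [Hn1 Hxn]. exists (phi n). split; [lia|].
  eapply Rle_lt_trans; [apply Cmod_le_abs_fst_snd|]. simpl. fold (fst (u (phi n)) - x).
  fold (snd (u (phi n)) - y).
  assert (/ (INR n + 1) <= / INR K).
  { apply Rinv_le_contravar; [apply lt_0_INR; lia|].
    assert (INR K <= INR n) by (apply le_INR; lia). lra. }
  lra.
Qed.

Section Goursat.

Variable f : C -> C.
Hypothesis f_cont : forall z, rhp z -> ccont f z.

Definition triangle : Type := (C * C * C)%type.

Definition tri_int (t : triangle) : C :=
  let '(a, b, c) := t in (seg_int f a b + seg_int f b c + seg_int f c a)%C.

Definition perimeter (t : triangle) : R :=
  let '(a, b, c) := t in Cmod (b - a) + Cmod (c - b) + Cmod (a - c).

Definition apex (t : triangle) : C := fst (fst t).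

Definition vertices_in (P : C -> Prop) (t : triangle) : Prop :=
  let '(a, b, c) := t in P a /\ P b /\ P c.

Definition mid (a b : C) : C := ((a + b) / 2)%C.

Definition largest_quarter (t : triangle) : triangle :=
  let '(a, b, c) := t in
  let t1 := (a, mid a b, mid c a) in
  let t2 := (mid a b, b, mid b c) in
  let t3 := (mid c a, mid b c, c) in
  let t4 := (mid b c, mid c a, mid a b) in
  if Rle_dec (Cmod (tri_int t) / 4) (Cmod (tri_int t1)) then t1 else
  if Rle_dec (Cmod (tri_int t) / 4) (Cmod (tri_int t2)) then t2 else
  if Rle_dec (Cmod (tri_int t) / 4) (Cmod (tri_int t3)) then t3 else t4.

Lemma fst_mid (a b : C) : fst (mid a b) = (fst a + fst b) / 2.
Proof.
  unfold mid. replace ((a + b) / 2)%C with (RtoC (/2) * (a + b))%C.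
  - simpl. field.
  - rewrite RtoC_inv by lra. unfold Cdiv. ring.
Qed.

Lemma Cmod_half (a : C) : Cmod (a / 2) = Cmod a / 2.
Proof. rewrite Cmod_div; [rewrite Cmod_real_nonneg by lra; reflexivity|].
  intro E. apply RtoC_inj in E. lra. Qed.

Lemma Cmod_mid (a b : C) : Cmod (mid a b) <= (Cmod a + Cmod b) / 2.
Proof. unfold mid. rewrite Cmod_half. pose proof (Cmod_triangle a b). lra. Qed.

Lemma perimeter_largest_quarter (t : triangle) :
  perimeter (largest_quarter t) = perimeter t / 2.
Proof.
  destruct t as [[a b] c]. unfold largest_quarter.
  assert (E : forall x y, x = (y / 2)%C -> Cmod x = Cmod y / 2).
  { intros x y ->. apply Cmod_half. }
  repeat match goal with |- context [if ?d then _ else _] => destruct d end; simpl; unfold mid.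
  - rewrite (E (_ - a) (b - a))%C, (E (_ - (a + b) / 2) (c - b))%C, (E (a - _) (a - c))%C; [field| | |]; field.
  - rewrite (E (b - _) (b - a))%C, (E (_ - b) (c - b))%C, (E ((a + b) / 2 - _) (a - c))%C; [field| | |]; field.
  - rewrite (E (_ - (c + a) / 2) (b - a))%C, (E (c - _) (c - b))%C, (E (_ - c) (a - c))%C; [field| | |]; field.
  - rewrite (E (_ - (b + c) / 2) (a - b))%C, (E (_ - (c + a) / 2) (b - c))%C, (E (_ - (a + b) / 2) (c - a))%C; [|field|field|field].
    rewrite (Cmod_sub_sym a b), (Cmod_sub_sym b c), (Cmod_sub_sym c a). field.
Qed.

Lemma vertices_in_largest_quarter (P : C -> Prop) (t : triangle) :
  (forall a b, P a -> P b -> P (mid a b)) ->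
  vertices_in P t -> vertices_in P (largest_quarter t).
Proof.
  intros HP. destruct t as [[a b] c]. intros [Ha [Hb Hc]]. unfold largest_quarter.
  repeat match goal with |- context [if ?d then _ else _] => destruct d end; simpl; auto.
Qed.

Lemma rhp_mid (a b : C) : rhp a -> rhp b -> rhp (mid a b).
Proof. unfold rhp. rewrite fst_mid. lra. Qed.

(** The integrals over the four quarters add up to that over the triangle, because the
    sides of the middle one are traversed in both directions. If the first three are
    too small, the fourth is not. *)
Lemma Cmod_tri_int_largest_quarter (t : triangle) :
  vertices_in rhp t -> Cmod (tri_int t) / 4 <= Cmod (tri_int (largest_quarter t)).
Proof.
  destruct t as [[a b] c]. intros [Ha [Hb Hc]]. unfold largest_quarter.
  destruct (Rle_dec _ _) as [H1|H1]; [exact H1|].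
  destruct (Rle_dec _ _) as [H2|H2]; [exact H2|].
  destruct (Rle_dec _ _) as [H3|H3]; [exact H3|].
  set (t1 := (a, mid a b, mid c a)) in *. set (t2 := (mid a b, b, mid b c)) in *.
  set (t3 := (mid c a, mid b c, c)) in *. set (t4 := (mid b c, mid c a, mid a b)).
  assert (E : tri_int (a, b, c) = (tri_int t1 + tri_int t2 + tri_int t3 + tri_int t4)%C).
  { unfold t1, t2, t3, t4, tri_int.
    rewrite (seg_int_split f f_cont a b (mid a b)), (seg_int_split f f_cont b c (mid b c)),
      (seg_int_split f f_cont c a (mid c a)) by auto.
    rewrite (seg_int_rev f f_cont (mid c a) (mid a b)), (seg_int_rev f f_cont (mid a b) (mid b c)),
      (seg_int_rev f f_cont (mid b c) (mid c a)) by (apply rhp_mid; auto).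
    ring. }
  set (T := tri_int (a, b, c)) in *.
  assert (Cmod T <= Cmod (tri_int t1) + Cmod (tri_int t2) + Cmod (tri_int t3) + Cmod (tri_int t4)).
  { rewrite E. repeat (eapply Rle_trans; [apply Cmod_triangle|]; apply Rplus_le_compat_r).
    apply Rle_refl. }
  lra.
Qed.

Lemma apex_largest_quarter (t : triangle) :
  Cmod (apex (largest_quarter t) - apex t) <= perimeter t.
Proof.
  destruct t as [[a b] c]. unfold largest_quarter.
  pose proof (Cmod_ge_0 (b - a)). pose proof (Cmod_ge_0 (c - b)). pose proof (Cmod_ge_0 (a - c)).
  assert (E : forall x y, x = (y / 2)%C -> Cmod x = Cmod y / 2).
  { intros x y ->. apply Cmod_half. }
  repeat match goal with |- context [if ?d then _ else _] => destruct d end;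
    unfold apex; simpl; unfold mid.
  - replace (a - a)%C with (RtoC 0) by ring. rewrite Cmod_0. lra.
  - rewrite (E _ (b - a)%C) by field. lra.
  - rewrite (E _ (c - a)%C) by field. rewrite (Cmod_sub_sym c a). lra.
  - replace ((b + c) / 2 - a)%C with ((b - a) / 2 + (c - a) / 2)%C by field.
    eapply Rle_trans; [apply Cmod_triangle|]. rewrite !Cmod_half, (Cmod_sub_sym c a). lra.
Qed.

Fixpoint nested (t : triangle) (n : nat) : triangle :=
  match n with O => t | S n => largest_quarter (nested t n) end.

Lemma perimeter_nested (t : triangle) (n : nat) : perimeter (nested t n) = perimeter t / 2 ^ n.
Proof.
  induction n; simpl; [field|]. rewrite perimeter_largest_quarter, IHn.
  field. apply pow_nonzero. lra.
Qed.

Lemma vertices_in_nested (P : C -> Prop) (t : triangle) (n : nat) :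
  (forall a b, P a -> P b -> P (mid a b)) ->
  vertices_in P t -> vertices_in P (nested t n).
Proof.
  intros HP H. induction n; simpl; [exact H|]. apply vertices_in_largest_quarter; assumption.
Qed.

Lemma Cmod_tri_int_nested (t : triangle) (n : nat) :
  vertices_in rhp t -> Cmod (tri_int t) / 4 ^ n <= Cmod (tri_int (nested t n)).
Proof.
  intro H. induction n; simpl; [lra|].
  eapply Rle_trans; [|apply Cmod_tri_int_largest_quarter].
  - apply Rle_trans with (Cmod (tri_int t) / 4 ^ n / 4); [|lra].
    apply Req_le. field. apply pow_nonzero. lra.
  - apply vertices_in_nested; [apply rhp_mid|exact H].
Qed.

Lemma perimeter_ge_0 (t : triangle) : 0 <= perimeter t.
Proof.
  destruct t as [[a b] c]. simpl.
  pose proof (Cmod_ge_0 (b - a)). pose proof (Cmod_ge_0 (c - b)). pose proof (Cmod_ge_0 (a - c)). lra.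
Qed.

(** The perimeters are halved at each step, so the bound telescopes. *)
Lemma apex_nested (t : triangle) (n k : nat) :
  Cmod (apex (nested t (n + k)) - apex (nested t n))
  <= 2 * (perimeter (nested t n) - perimeter (nested t (n + k))).
Proof.
  induction k.
  - rewrite Nat.add_0_r. replace (apex (nested t n) - apex (nested t n))%C with (RtoC 0) by ring.
    rewrite Cmod_0. lra.
  - rewrite Nat.add_succ_r. simpl.
    eapply Rle_trans; [apply (Cmod_sub_trans _ (apex (nested t (n + k))))|].
    pose proof (apex_largest_quarter (nested t (n + k))).
    rewrite perimeter_largest_quarter. lra.
Qed.

Lemma tri_int_near_linear (t : triangle) (p l : C) (e delta : R) :
  vertices_in rhp t -> 0 < e ->
  (forall w, Cmod (w - p) < delta -> Cmod (f w - f p - l * (w - p))%C <= e * Cmod (w - p)) ->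
  Cmod (apex t - p) <= 2 * perimeter t -> 3 * perimeter t < delta ->
  Cmod (tri_int t) <= 3 * e * perimeter t * perimeter t.
Proof.
  intros Hv He Hw Hap Hd. set (L := perimeter t) in *.
  assert (HL : 0 <= L) by apply perimeter_ge_0.
  assert (Near : forall w, Cmod (w - apex t) <= L ->
            Cmod (f w - (f p - l * p + l * w))%C <= 3 * e * L).
  { intros w H. assert (Cmod (w - p) <= 3 * L).
    { pose proof (Cmod_sub_trans w (apex t) p). lra. }
    replace (f w - (f p - l * p + l * w))%C with (f w - f p - l * (w - p))%C by ring.
    eapply Rle_trans; [apply Hw; lra|].
    replace (3 * e * L) with (e * (3 * L)) by ring. apply Rmult_le_compat_l; lra. }
  destruct t as [[a b] c]. destruct Hv as [Ha [Hb Hc]]. unfold apex in *. simpl in *.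
  pose proof (Cmod_ge_0 (b - a)). pose proof (Cmod_ge_0 (c - b)). pose proof (Cmod_ge_0 (a - c)).
  assert (S : forall x y, rhp x -> rhp y -> (forall r, 0 <= r <= 1 -> Cmod (x + r * (y - x) - a)%C <= L) ->
            Cmod (seg_int f x y - (y - x) * (f p - l * p + l * ((x + y) / 2)))%C
            <= 3 * e * L * Cmod (y - x)).
  { intros x y Hx Hy H2. apply seg_int_near_affine; auto. }
  assert (Sc : forall r x, 0 <= r <= 1 -> Cmod (RtoC r * x)%C <= Cmod x).
  { intros r x Hr. rewrite Cmod_mult, Cmod_real_nonneg by lra. pose proof (Cmod_ge_0 x). nra. }
  assert (S1 := S a b Ha Hb). assert (S2 := S b c Hb Hc). assert (S3 := S c a Hc Ha).
  assert (A1 : forall r : R, 0 <= r <= 1 -> Cmod (a + r * (b - a) - a)%C <= L).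
  { intros r Hr. replace (a + r * (b - a) - a)%C with (r * (b - a))%C by ring.
    eapply Rle_trans; [apply Sc, Hr|]. unfold L, perimeter. lra. }
  assert (A2 : forall r : R, 0 <= r <= 1 -> Cmod (b + r * (c - b) - a)%C <= L).
  { intros r Hr. replace (b + r * (c - b) - a)%C with ((b - a) + r * (c - b))%C by ring.
    eapply Rle_trans; [apply Cmod_triangle|]. pose proof (Sc r (c - b)%C Hr). unfold L, perimeter. lra. }
  assert (A3 : forall r : R, 0 <= r <= 1 -> Cmod (c + r * (a - c) - a)%C <= L).
  { intros r Hr. replace (c + r * (a - c) - a)%C with (- (RtoC (1 - r) * (a - c)))%C
      by (rewrite RtoC_minus; ring). rewrite Cmod_opp.
    eapply Rle_trans; [apply Sc; lra|]. unfold L, perimeter. lra. }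
  specialize (S1 A1). specialize (S2 A2). specialize (S3 A3).
  replace (seg_int f a b + seg_int f b c + seg_int f c a)%C with
    ((seg_int f a b - (b - a) * (f p - l * p + l * ((a + b) / 2)))
     + (seg_int f b c - (c - b) * (f p - l * p + l * ((b + c) / 2)))
     + (seg_int f c a - (a - c) * (f p - l * p + l * ((c + a) / 2))))%C by field.
  eapply Rle_trans; [apply Cmod_triangle|].
  eapply Rle_trans; [apply Rplus_le_compat_r, Cmod_triangle|].
  replace (3 * e * L * L) with (3 * e * L * Cmod (b - a) + 3 * e * L * Cmod (c - b) + 3 * e * L * Cmod (a - c)).
  - lra.
  - unfold L at 4. simpl. ring.
Qed.

(** Goursat: the largest quarters of a triangle shrink to a point, near which
    [f] is affine up to an error that the perimeters make negligible. *)
Lemma Goursat_triangle (t : triangle) :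
  (forall z, rhp z -> cdiff f z) -> vertices_in rhp t -> tri_int t = 0.
Proof.
  intros Df Hv. set (L := perimeter t).
  assert (HL : 0 <= L) by apply perimeter_ge_0.
  assert (Hbox : exists m R, 0 < m /\ vertices_in (fun z => m <= fst z /\ Cmod z <= R) t).
  { destruct t as [[a b] c]. destruct Hv as [Ha [Hb Hc]]. unfold rhp in *.
    exists (Rmin (fst a) (Rmin (fst b) (fst c))), (Rmax (Cmod a) (Rmax (Cmod b) (Cmod c))).
    split; [repeat apply Rmin_glb_lt; assumption|]. simpl.
    pose proof (Rmin_l (fst a) (Rmin (fst b) (fst c))). pose proof (Rmin_r (fst a) (Rmin (fst b) (fst c))).
    pose proof (Rmin_l (fst b) (fst c)). pose proof (Rmin_r (fst b) (fst c)).
    pose proof (Rmax_l (Cmod a) (Rmax (Cmod b) (Cmod c))). pose proof (Rmax_r (Cmod a) (Rmax (Cmod b) (Cmod c))).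
    pose proof (Rmax_l (Cmod b) (Cmod c)). pose proof (Rmax_r (Cmod b) (Cmod c)).
    repeat split; lra. }
  destruct Hbox as [m [R [Hm HB]]].
  assert (HBn : forall n, m <= fst (apex (nested t n)) /\ Cmod (apex (nested t n)) <= R).
  { intro n. assert (H : vertices_in (fun z => m <= fst z /\ Cmod z <= R) (nested t n)).
    { apply vertices_in_nested; [|exact HB]. intros a b [Ha Ha'] [Hb Hb'].
      rewrite fst_mid. pose proof (Cmod_mid a b). split; lra. }
    destruct (nested t n) as [[a b] c]. apply H. }
  destruct (C_bounded_cluster (fun n => apex (nested t n)) R) as [p Hp].
  { intro n. apply HBn. }
  assert (Hnear : forall n, Cmod (apex (nested t n) - p) <= 2 * perimeter (nested t n)).
  { intro n. apply le_epsilon. intros eps Heps.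
    destruct (Hp eps n Heps) as [k [Hk Hkp]]. replace k with (n + (k - n))%nat in Hkp by lia.
    pose proof (apex_nested t n (k - n)) as A. rewrite Cmod_sub_sym in A.
    pose proof (Cmod_sub_trans (apex (nested t n)) (apex (nested t (n + (k - n)))) p).
    pose proof (perimeter_ge_0 (nested t (n + (k - n)))). lra. }
  assert (Hrp : rhp p).
  { unfold rhp. destruct (Hp (m / 2) O) as [n [_ Hn]]; [lra|].
    pose proof (Rabs_fst_le_Cmod (apex (nested t n) - p)) as A.
    apply Rle_lt_trans with (2 := Hn) in A. apply Rabs_lt_between in A. simpl in A.
    destruct (HBn n). lra. }
  destruct (Df p Hrp) as [l Hl].
  assert (Small : forall e, 0 < e -> Cmod (tri_int t) <= 3 * e * L * L).
  { intros e He. destruct (Hl e He) as [d [Hd Hw]].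
    destruct (pow_lt_1_zero (/2)) with (y := d / (3 * (L + 1))) as [n Hn].
    { rewrite Rabs_pos_eq; lra. }
    { apply Rdiv_lt_0_compat; lra. }
    specialize (Hn n (Nat.le_refl n)). rewrite Rabs_pos_eq in Hn by (apply pow_le; lra).
    rewrite pow_inv in Hn.
    assert (P2 : 0 < 2 ^ n) by (apply pow_lt; lra).
    assert (Hs : 3 * perimeter (nested t n) < d).
    { rewrite perimeter_nested. fold L.
      apply (Rmult_lt_compat_l (3 * (L + 1))) in Hn; [|lra].
      replace (3 * (L + 1) * (d / (3 * (L + 1)))) with d in Hn by (field; lra).
      assert (0 < / 2 ^ n) by (apply Rinv_0_lt_compat, P2). unfold Rdiv. nra. }
    pose proof (tri_int_near_linear (nested t n) p l e d) as B.
    specialize (B (vertices_in_nested rhp t n rhp_mid Hv) He Hw (Hnear n) Hs).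
    pose proof (Cmod_tri_int_nested t n Hv) as A. rewrite perimeter_nested in B. fold L in B.
    assert (E4 : 4 ^ n = 2 ^ n * 2 ^ n) by (rewrite <- Rpow_mult_distr; f_equal; lra).
    rewrite E4 in A.
    apply Rmult_le_reg_r with (/ (2 ^ n * 2 ^ n)); [apply Rinv_0_lt_compat; nra|].
    eapply Rle_trans; [exact A|]. eapply Rle_trans; [exact B|].
    apply Req_le. field. lra. }
  apply Cmod_le_eps_0. intros eps Heps.
  eapply Rle_trans; [apply (Small (eps / (3 * (L * L + 1))))|].
  - apply Rdiv_lt_0_compat; nra.
  - replace (3 * (eps / (3 * (L * L + 1))) * L * L) with (eps * (L * L / (L * L + 1))) by (field; nra).
    assert (L * L / (L * L + 1) <= 1) by (apply Rle_div_l; nra). nra.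
Qed.

End Goursat.

(** The integral along the segment from 1: by Goursat, its increment is an integral
    along a short segment. *)
Lemma rhp_primitive (f : C -> C) :
  (forall z, rhp z -> cdiff f z) ->
  exists K, forall z, rhp z -> has_cderive K z (f z).
Proof.
  intro Df.
  assert (Cf : forall z, rhp z -> ccont f z) by (intros; apply cdiff_ccont; auto).
  assert (H1 : rhp 1) by (unfold rhp; simpl; lra).
  exists (seg_int f 1). intros z Hz eps Heps.
  destruct (Cf z Hz eps Heps) as [d [Hd Hw]]. unfold rhp in Hz.
  exists (Rmin d (fst z)). split; [apply Rmin_glb_lt; assumption|]. intros w Hwz.
  assert (Hwd : Cmod (w - z) < d) by (eapply Rlt_le_trans; [exact Hwz|apply Rmin_l]).
  assert (Hw' : rhp w).
  { assert (A : Cmod (w - z) < fst z) by (eapply Rlt_le_trans; [exact Hwz|apply Rmin_r]).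
    pose proof (Rabs_fst_le_Cmod (w - z)) as B. apply Rle_lt_trans with (2 := A) in B.
    apply Rabs_lt_between in B. simpl in B. unfold rhp. lra. }
  pose proof (Goursat_triangle f Cf (RtoC 1, z, w) Df (conj H1 (conj Hz Hw'))) as T.
  unfold tri_int in T. rewrite (seg_int_rev f Cf 1 w) in T by assumption.
  replace (seg_int f 1 w - seg_int f 1 z - f z * (w - z))%C
    with (seg_int f z w - (w - z) * (f z + 0 * ((z + w) / 2)))%C.
  2:{ replace (seg_int f 1 w)%C with (seg_int f 1 z + seg_int f z w - 0)%C; [ring|].
      rewrite <- T. ring. }
  apply seg_int_near_affine; auto. intros r Hr.
  replace (f (z + r * (w - z)) - (f z + 0 * (z + r * (w - z))))%C
    with (f (z + r * (w - z)) - f z)%C by ring.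
  left. apply Hw. replace (z + r * (w - z) - z)%C with (r * (w - z))%C by ring.
  rewrite Cmod_mult, Cmod_real_nonneg by lra. pose proof (Cmod_ge_0 (w - z)). nra.
Qed.

(** * The complex exponential *)

Definition Cexp (z : C) : C := (exp (fst z) * cos (snd z), exp (fst z) * sin (snd z)).

Lemma Cmod_Cexp (z : C) : Cmod (Cexp z) = exp (fst z).
Proof.
  pose proof (exp_pos (fst z)) as P. pose proof (sin2_cos2 (snd z)) as S. unfold Rsqr in S.
  apply Rsqr_inj; [apply Cmod_ge_0|lra|]. unfold Rsqr. rewrite Cmod_sqr. simpl.
  replace (exp (fst z) * cos (snd z) * (exp (fst z) * cos (snd z)) +
    exp (fst z) * sin (snd z) * (exp (fst z) * sin (snd z)))
    with (exp (fst z) * exp (fst z) * (sin (snd z) * sin (snd z) + cos (snd z) * cos (snd z))) by ring.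
  rewrite S. ring.
Qed.

Lemma Cexp_neq_0 (z : C) : Cexp z <> 0.
Proof. apply Cmod_pos_neq_0. rewrite Cmod_Cexp. apply exp_pos. Qed.

Lemma Cexp_plus (z w : C) : Cexp (z + w) = (Cexp z * Cexp w)%C.
Proof.
  unfold Cexp. simpl. rewrite exp_plus, cos_plus, sin_plus.
  unfold Cmult. simpl. f_equal; ring.
Qed.

Lemma Cexp_0 : Cexp 0 = 1.
Proof. unfold Cexp. simpl. rewrite exp_0, cos_0, sin_0. unfold RtoC. f_equal; ring. Qed.

Lemma Cexp_opp (z : C) : Cexp (- z) = (/ Cexp z)%C.
Proof.
  assert (H : (Cexp (- z) * Cexp z)%C = 1).
  { rewrite <- Cexp_plus. replace (- z + z)%C with (RtoC 0) by ring. apply Cexp_0. }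
  pose proof (Cexp_neq_0 z).
  replace (Cexp (- z)) with (Cexp (- z) * Cexp z * / Cexp z)%C by (field; assumption).
  rewrite H. ring.
Qed.

Definition C2PI : C := (0, 2 * PI).

Lemma Cexp_periodic (z : C) : Cexp (z + C2PI) = Cexp z.
Proof.
  unfold Cexp, C2PI. simpl. rewrite Rplus_0_r, cos_plus, sin_plus, cos_2PI, sin_2PI.
  f_equal; ring.
Qed.

(** Testing against the increment itself reduces the bound to the real mean value
    theorem. *)
Lemma C_path_bound (u1 u2 d1 d2 : R -> R) (M : R) :
  (forall r, 0 <= r <= 1 -> is_derive u1 r (d1 r)) ->
  (forall r, 0 <= r <= 1 -> is_derive u2 r (d2 r)) ->
  (forall r, 0 <= r <= 1 -> Cmod (d1 r, d2 r) <= M) ->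
  Cmod ((u1 1, u2 1) - (u1 0, u2 0))%C <= M.
Proof.
  intros D1 D2 B. set (w := ((u1 1, u2 1) - (u1 0, u2 0))%C).
  set (phi := fun r => u1 r * fst w + u2 r * snd w).
  assert (D : forall r, 0 <= r <= 1 -> is_derive phi r (d1 r * fst w + d2 r * snd w)).
  { intros r Hr. unfold phi.
    apply (is_derive_plus (fun r => u1 r * fst w) (fun r => u2 r * snd w)).
    - apply (is_derive_scal_l (V := R_NormedModule) u1 r (d1 r) (fst w)), D1, Hr.
    - apply (is_derive_scal_l (V := R_NormedModule) u2 r (d2 r) (snd w)), D2, Hr. }
  destruct (MVT_gen phi 0 1 (fun r => d1 r * fst w + d2 r * snd w)) as [r [Hr E]].
  - intros x Hx. rewrite Rmin_left, Rmax_right in Hx by lra. apply D. lra.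
  - intros x Hx. rewrite Rmin_left, Rmax_right in Hx by lra.
    apply continuity_pt_filterlim, (ex_derive_continuous phi). eexists. apply D. lra.
  - rewrite Rmin_left, Rmax_right in Hr by lra.
    assert (E1 : phi 1 - phi 0 = Cmod w * Cmod w).
    { rewrite Cmod_sqr. unfold phi, w. simpl. ring. }
    rewrite E1 in E. pose proof (Cmod_ge_0 w) as P.
    assert (F : d1 r * fst w + d2 r * snd w <= M * Cmod w).
    { replace (d1 r * fst w + d2 r * snd w) with (fst ((d1 r, d2 r) * Cconj w)%C) by (simpl; ring).
      eapply Rle_trans; [apply fst_le_Cmod|]. rewrite Cmod_mult, Cmod_conj.
      apply Rmult_le_compat_r; [exact P|apply B, Hr]. }
    destruct (Req_dec (Cmod w) 0) as [Z|NZ].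
    + rewrite Z. pose proof (B r Hr). pose proof (Cmod_ge_0 (d1 r, d2 r)). lra.
    + apply Rmult_le_reg_r with (Cmod w); lra.
Qed.

Lemma Cexp_minus_1 (z : C) : Cmod z <= 1 -> Cmod (Cexp z - 1) <= 3 * Cmod z.
Proof.
  intro Hz. destruct z as [x y].
  pose proof (C_path_bound (fun r => exp (r * x) * cos (r * y)) (fun r => exp (r * x) * sin (r * y))
    (fun r => fst ((x, y) * Cexp (r * x, r * y)%R)%C) (fun r => snd ((x, y) * Cexp (r * x, r * y)%R)%C)
    (3 * Cmod (x, y))) as H.
  unfold Cexp. simpl fst. simpl snd.
  replace ((exp x * cos y, exp x * sin y)%R - 1)%C with
    ((exp (1 * x) * cos (1 * y), exp (1 * x) * sin (1 * y))%R -
         (exp (0 * x) * cos (0 * y), exp (0 * x) * sin (0 * y))%R)%C.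
  2:{ rewrite !Rmult_0_l, !Rmult_1_l, exp_0, cos_0, sin_0. unfold RtoC. do 2 f_equal; ring. }
  apply H.
  - intros r _. unfold Cexp. simpl. auto_derive; [exact I|ring].
  - intros r _. unfold Cexp. simpl. auto_derive; [exact I|ring].
  - intros r Hr. rewrite <- surjective_pairing, Cmod_mult, Cmod_Cexp. simpl fst.
    rewrite Rmult_comm. apply Rmult_le_compat_r; [apply Cmod_ge_0|].
    eapply Rle_trans; [|apply exp_le_3].
    pose proof (fst_le_Cmod (x, y)) as A. simpl in A.
    destruct (Req_dec (r * x) 1) as [->|N]; [lra|]. left. apply exp_increasing.
    assert (r * x <= 1). 2: lra.
    destruct (Rle_dec 0 x); nra.
Qed.

Lemma Cexp_minus_1_minus (z : C) : Cmod z <= 1 -> Cmod (Cexp z - 1 - z) <= 3 * Cmod z * Cmod z.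
Proof.
  intro Hz. destruct z as [x y].
  pose proof (C_path_bound (fun r => exp (r * x) * cos (r * y) - r * x)
    (fun r => exp (r * x) * sin (r * y) - r * y)
    (fun r => fst ((x, y) * (Cexp (r * x, r * y)%R - 1))%C)
    (fun r => snd ((x, y) * (Cexp (r * x, r * y)%R - 1))%C)
    (3 * Cmod (x, y) * Cmod (x, y))) as H.
  unfold Cexp. simpl fst. simpl snd.
  replace ((exp x * cos y, exp x * sin y)%R - 1 - (x, y))%C with
    ((exp (1 * x) * cos (1 * y) - 1 * x, exp (1 * x) * sin (1 * y) - 1 * y)%R -
         (exp (0 * x) * cos (0 * y) - 0 * x, exp (0 * x) * sin (0 * y) - 0 * y)%R)%C.
  2:{ rewrite !Rmult_0_l, !Rmult_1_l, exp_0, cos_0, sin_0. unfold RtoC, Cminus, Cplus, Copp. simpl. f_equal; ring. }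
  apply H.
  - intros r _. unfold Cexp. simpl. auto_derive; [exact I|ring].
  - intros r _. unfold Cexp. simpl. auto_derive; [exact I|ring].
  - intros r Hr. rewrite <- surjective_pairing, Cmod_mult.
    rewrite Rmult_comm. apply Rmult_le_compat_r; [apply Cmod_ge_0|].
    assert (E : Cmod (r * x, r * y)%R = r * Cmod (x, y)).
    { replace (r * x, r * y)%R with (RtoC r * (x, y))%C.
      - rewrite Cmod_mult, Cmod_real_nonneg by lra. reflexivity.
      - unfold Cmult, RtoC. simpl. f_equal; ring. }
    pose proof (Cmod_ge_0 (x, y)).
    eapply Rle_trans; [apply Cexp_minus_1|]; rewrite E; nra.
Qed.

Lemma has_cderive_Cexp (z : C) : has_cderive Cexp z (Cexp z).
Proof.
  intros eps Heps. pose proof (proj1 (Cmod_gt_0 _) (Cexp_neq_0 z)) as P. set (A := Cmod (Cexp z)) in *.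
  exists (Rmin 1 (eps / (3 * A))). split.
  { apply Rmin_glb_lt; [lra|]. apply Rdiv_lt_0_compat; lra. }
  intros w Hw.
  assert (H1 : Cmod (w - z) <= 1) by (left; eapply Rlt_le_trans; [exact Hw|apply Rmin_l]).
  assert (H2 : Cmod (w - z) < eps / (3 * A)) by (eapply Rlt_le_trans; [exact Hw|apply Rmin_r]).
  replace (Cexp w) with (Cexp z * Cexp (w - z))%C.
  2:{ rewrite <- Cexp_plus. f_equal. ring. }
  replace (Cexp z * Cexp (w - z) - Cexp z - Cexp z * (w - z))%C
    with (Cexp z * (Cexp (w - z) - 1 - (w - z)))%C by ring.
  rewrite Cmod_mult. fold A. pose proof (Cexp_minus_1_minus (w - z) H1) as B.
  pose proof (Cmod_ge_0 (w - z)).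
  apply Rle_trans with (A * (3 * Cmod (w - z) * Cmod (w - z))); [apply Rmult_le_compat_l; lra|].
  replace (A * (3 * Cmod (w - z) * Cmod (w - z))) with (3 * A * Cmod (w - z) * Cmod (w - z)) by ring.
  apply Rmult_le_compat_r; [assumption|].
  apply Rlt_le, (Rmult_le_compat_l (3 * A)) in H2; [|lra].
  replace (3 * A * (eps / (3 * A))) with eps in H2 by (field; lra). exact H2.
Qed.

Lemma cdiff_Cexp (f : C -> C) (z : C) : cdiff f z -> cdiff (fun w => Cexp (f w)) z.
Proof. intro H. apply (cdiff_comp Cexp f); [exact H|]. eexists. apply has_cderive_Cexp. Qed.

Lemma Cexp_polar (z : C) : z <> 0 ->
  exists w, Cexp w = z /\ fst w = ln (Cmod z) /\ Rabs (snd w) <= PI.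
Proof.
  intro Hz. pose proof (proj1 (Cmod_gt_0 z) Hz) as P. destruct z as [x y]. set (r := Cmod (x, y)) in *.
  assert (E : r * r = x * x + y * y) by apply Cmod_sqr.
  assert (Hx : -1 <= x / r <= 1).
  { pose proof (Rabs_fst_le_Cmod (x, y)) as A. fold r in A. simpl in A.
    apply Rabs_le_between in A. split; [apply Rle_div_r|apply Rle_div_l]; lra. }
  set (t := acos (x / r)).
  assert (Hc : cos t = x / r) by (apply cos_acos; exact Hx).
  assert (Hs : sin t = Rabs y / r).
  { unfold t. rewrite sin_acos by exact Hx.
    rewrite <- (sqrt_Rsqr (Rabs y / r)) by (apply Rle_div_r; [lra|rewrite Rmult_0_l; apply Rabs_pos]).
    f_equal. unfold Rsqr, Rdiv.
    replace (Rabs y * / r * (Rabs y * / r)) with (Rabs y * Rabs y / (r * r)) by (field; lra).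
    rewrite <- Rabs_mult, (Rabs_pos_eq (y * y)) by nra.
    replace (y * y) with (r * r - x * x) by lra. field. lra. }
  pose proof (acos_bound (x / r)) as B. fold t in B.
  destruct (Rle_dec 0 y) as [Hy|Hy].
  - exists (ln r, t). split; [|split; [reflexivity|]].
    + unfold Cexp. simpl. rewrite exp_ln, Hc, Hs, Rabs_pos_eq by assumption. f_equal; field; lra.
    + simpl. rewrite Rabs_pos_eq; lra.
  - exists (ln r, - t). split; [|split; [reflexivity|]].
    + unfold Cexp. simpl. rewrite exp_ln, cos_neg, sin_neg, Hc, Hs, Rabs_left by lra. f_equal; field; lra.
    + simpl. rewrite Rabs_Ropp, Rabs_pos_eq; lra.
Qed.

Lemma rhp_neq_0 (z : C) : rhp z -> z <> 0.
Proof. unfold rhp. intros H E. rewrite E in H. simpl in H. lra. Qed.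

Lemma rhp_cderive_0_const (f : C -> C) (a b : C) :
  (forall z, rhp z -> has_cderive f z 0) -> rhp a -> rhp b -> f b = f a.
Proof.
  intros H Ha Hb. apply Ceq_minus, Cmod_eq_0, Rle_antisym; [|apply Cmod_ge_0].
  replace 0 with (0 * Cmod (b - a)) by ring.
  apply (cderive_segment_bound f (fun _ => 0)).
  - intros r Hr. apply H, rhp_segment; assumption.
  - intros r Hr. rewrite Cmod_0. lra.
Qed.

(** The logarithm is taken as a primitive of the inverse, whose distance from the
    constant 1 gives the expansion at 1. *)
Lemma Cexp_log_near_1 (v : C) : Cmod v <= 1 / 2 ->
  exists e, Cexp (- e) = (1 - v)%C /\ Cmod (e - v) <= 2 * Cmod v * Cmod v.
Proof.
  intro Hv.
  destruct (rhp_primitive (fun z => / z)%C) as [L HL].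
  { intros z Hz. apply cdiff_inv; [apply cdiff_id|apply rhp_neq_0, Hz]. }
  assert (H1 : rhp 1) by (unfold rhp; simpl; lra).
  assert (Hball : forall w, Cmod (w - 1) <= Cmod v -> rhp w).
  { intros w Hw. pose proof (Rabs_fst_le_Cmod (w - 1)) as A.
    assert (A' : Rabs (fst (w - 1)%C) <= 1 / 2) by lra.
    apply Rabs_le_between in A'. simpl in A'. unfold rhp. lra. }
  assert (Hseg : forall r : R, 0 <= r <= 1 -> Cmod (1 + r * (1 - v - 1) - 1)%C <= Cmod v).
  { intros r Hr. replace (1 + r * (1 - v - 1) - 1)%C with (- (r * v))%C by ring.
    rewrite Cmod_opp, Cmod_mult, Cmod_real_nonneg by lra. pose proof (Cmod_ge_0 v). nra. }
  set (l := fun z => (L z - L 1)%C).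
  assert (Dl : forall z, rhp z -> has_cderive l z (/ z)%C).
  { intros z Hz. eapply has_cderive_eq.
    - apply has_cderive_plus; [apply HL, Hz|apply has_cderive_const].
    - ring. }
  assert (l1 : l 1 = 0) by (unfold l; ring).
  assert (Hinv : forall z, rhp z -> Cexp (l z) = z).
  { intros z Hz.
    assert (E : (z * Cexp (- l z))%C = (1 * Cexp (- l 1))%C).
    { apply (rhp_cderive_0_const (fun z => z * Cexp (- l z))%C); [|exact H1|exact Hz].
      clear z Hz. intros z Hz. pose proof (rhp_neq_0 z Hz) as Nz. eapply has_cderive_eq.
      - apply has_cderive_mult; [apply has_cderive_id|].
        apply (has_cderive_comp Cexp (fun w => - l w)%C); [apply has_cderive_opp, Dl, Hz|].
        apply has_cderive_Cexp.
      - cbv beta. field. exact Nz. }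
    rewrite l1 in E. replace (- 0)%C with (RtoC 0) in E by ring. rewrite Cexp_0, Cexp_opp in E.
    pose proof (Cexp_neq_0 (l z)).
    replace z with (z * / Cexp (l z) * Cexp (l z))%C at 2 by (field; assumption).
    rewrite E. ring. }
  exists (- l (1 - v))%C. split.
  { replace (- - l (1 - v))%C with (l (1 - v))%C by ring. apply Hinv, Hball.
    replace (1 - v - 1)%C with (- v)%C by ring. rewrite Cmod_opp. lra. }
  replace (- l (1 - v) - v)%C with (- ((l (1 - v) - (1 - v)) - (l 1 - 1)))%C by (rewrite l1; ring).
  rewrite Cmod_opp.
  replace (Cmod v) with (Cmod (1 - v - 1)) at 2 by (rewrite <- Cmod_opp; f_equal; ring).
  apply (cderive_segment_bound (fun z => l z - z)%C (fun z => / z + - (1))%C).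
  - intros r Hr. apply has_cderive_plus; [apply Dl, Hball, Hseg, Hr|].
    apply has_cderive_opp, has_cderive_id.
  - intros r Hr. specialize (Hseg r Hr). set (w := (1 + r * (1 - v - 1))%C) in *.
    assert (Hw : 1 / 2 <= Cmod w).
    { pose proof (Cmod_triangle_inv 1 w) as A. rewrite Cmod_sub_sym, Cmod_1 in A. lra. }
    assert (Nw : w <> 0) by (apply Cmod_pos_neq_0; lra).
    replace (/ w + - (1))%C with (- ((w - 1) / w))%C by (field; exact Nw).
    rewrite Cmod_opp, Cmod_div by exact Nw. apply Rle_div_l; [lra|].
    pose proof (Cmod_ge_0 v). nra.
Qed.

(** * The Schwarz lemma *)

Lemma disc_0 : unit_disc 0.
Proof. unfold unit_disc. rewrite Cmod_0. lra. Qed.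

Lemma unit_disc_Cexp_opp (z : C) : rhp z -> unit_disc (Cexp (- z)).
Proof.
  unfold rhp, unit_disc. intro H. rewrite Cmod_Cexp. simpl. rewrite <- exp_0.
  apply exp_increasing. lra.
Qed.

Lemma C2PI_Cmod : Cmod C2PI = 2 * PI.
Proof.
  pose proof PI_RGT_0. unfold C2PI. replace (0, 2 * PI) with (Ci * RtoC (2 * PI))%C.
  - rewrite Cmod_mult, Cmod_Ci, Cmod_real_nonneg by lra. ring.
  - unfold Ci, RtoC, Cmult. simpl. f_equal; ring.
Qed.

(** With [z = exp (-w)], the mean over a circle is a difference [K (w + 2 pi i) - K w]
    of a primitive [K]. By periodicity it does not depend on [w], and it tends to
    [2 pi i * h 0] as [Re w] grows. *)
Lemma center_le_circle_sup (h : C -> C) (rho B : R) :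
  (forall z, unit_disc z -> cdiff h z) -> 0 < rho < 1 ->
  (forall z, Cmod z = rho -> Cmod (h z) <= B) -> Cmod (h 0) <= B.
Proof.
  intros Dh Hrho HB. pose proof PI_RGT_0 as HPI.
  set (G := fun w => h (Cexp (- w))).
  destruct (rhp_primitive G) as [K HK].
  { intros w Hw. apply (cdiff_comp h (fun w => Cexp (- w))).
    - apply cdiff_Cexp, cdiff_opp, cdiff_id.
    - apply Dh, unit_disc_Cexp_opp, Hw. }
  assert (Hshift : forall w, rhp w -> rhp (w + C2PI)).
  { unfold rhp, C2PI. intros w Hw. simpl. lra. }
  assert (Const : forall a b, rhp a -> rhp b -> (K (b + C2PI) - K b = K (a + C2PI) - K a)%C).
  { intros a b Ha Hb. apply (rhp_cderive_0_const (fun w => K (w + C2PI) - K w)%C); auto.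
    intros w Hw. eapply has_cderive_eq.
    - apply has_cderive_plus; [|apply has_cderive_opp, HK, Hw].
      apply (has_cderive_comp K (fun w => w + C2PI)%C).
      + apply has_cderive_plus; [apply has_cderive_id|apply has_cderive_const].
      + apply HK, Hshift, Hw.
    - cbv beta. unfold G. replace (- (w + C2PI))%C with (- w - C2PI)%C by ring.
      rewrite <- (Cexp_periodic (- w - C2PI)).
      replace (- w - C2PI + C2PI)%C with (- w)%C by ring. ring. }
  assert (Seg : forall (x : R) (q : C) (M : R), 0 < x ->
     (forall z, Cmod z = exp (- x) -> Cmod (h z - q) <= M) ->
     Cmod (K (x + C2PI) - K x - q * C2PI)%C <= M * (2 * PI)).
  { intros x q M Hx HM. rewrite <- C2PI_Cmod.
    replace (K (x + C2PI) - K x - q * C2PI)%C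
      with ((K (x + C2PI) + - (q * (x + C2PI))) - (K x + - (q * x)))%C by ring.
    replace (Cmod C2PI) with (Cmod (x + C2PI - x)) by (f_equal; ring).
    assert (Hr : forall r : R, 0 <= r <= 1 -> fst (x + r * (x + C2PI - x))%C = x).
    { intros r _. simpl. ring. }
    apply (cderive_segment_bound (fun w => K w + - (q * w))%C (fun w => G w + - q)%C).
    - intros r Hr'. eapply has_cderive_eq.
      + apply has_cderive_plus; [apply HK; unfold rhp; rewrite Hr by exact Hr'; exact Hx|].
        apply has_cderive_opp, has_cderive_mult; [apply has_cderive_const|apply has_cderive_id].
      + cbv beta. ring.
    - intros r Hr'. unfold G. apply HM. rewrite Cmod_Cexp. f_equal.
      change (- fst (x + r * (x + C2PI - x))%C = - x). rewrite Hr by exact Hr'. reflexivity. }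
  assert (Hx : 0 < - ln rho).
  { pose proof (ln_increasing rho 1 (proj1 Hrho) (proj2 Hrho)). rewrite ln_1 in H. lra. }
  pose proof (Seg (- ln rho) 0 B Hx) as S1.
  rewrite Ropp_involutive, exp_ln in S1 by lra.
  assert (S1' : Cmod (K (RtoC (- ln rho) + C2PI) - K (RtoC (- ln rho)))%C <= B * (2 * PI)).
  { replace (K (RtoC (- ln rho) + C2PI) - K (RtoC (- ln rho)))%C
      with (K (RtoC (- ln rho) + C2PI) - K (RtoC (- ln rho)) - 0 * C2PI)%C by ring.
    apply S1. intros z Hz. replace (h z - 0)%C with (h z) by ring. auto. }
  clear S1. apply le_epsilon. intros eps Heps.
  destruct (cdiff_ccont h 0 (Dh 0 disc_0) eps Heps) as [d [Hd Hw]].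
  set (y := Rmax 1 (1 - ln d)).
  assert (Hy1 : 1 <= y) by apply Rmax_l. assert (Hy2 : 1 - ln d <= y) by apply Rmax_r.
  assert (S2 : Cmod (K (y + C2PI) - K y - h 0 * C2PI)%C <= eps * (2 * PI)).
  { apply Seg; [lra|]. intros z Hz. left. apply Hw.
    replace (z - 0)%C with z by ring. rewrite Hz, <- (exp_ln d Hd). apply exp_increasing. lra. }
  rewrite (Const (RtoC (- ln rho)) (RtoC y)) in S2; [|unfold rhp; simpl; lra|unfold rhp; simpl; lra].
  pose proof (Cmod_triangle_inv (h 0 * C2PI) (K (RtoC (- ln rho) + C2PI) - K (RtoC (- ln rho)))%C) as T.
  rewrite (Cmod_sub_sym (h 0 * C2PI)%C), Cmod_mult, C2PI_Cmod in T.
  apply Rmult_le_reg_r with (2 * PI); lra.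
Qed.

Lemma exp_le_linear (x : R) : 0 <= x <= 1 -> exp x <= 1 + 3 * x.
Proof.
  intro H. pose proof (Cexp_minus_1 (RtoC x)) as A. rewrite Cmod_real_nonneg in A by lra.
  pose proof (fst_le_Cmod (Cexp x - 1)) as B. unfold Cexp in *. simpl in *.
  rewrite cos_0 in *. lra.
Qed.

(** The Cayley transform maps a circle close to the unit circle into the union of a
    thin strip along the imaginary axis and a neighbourhood of infinity. On the
    strip [g] is bounded by nearly 1; near infinity the factor [1 / (1 + eps z)]
    outweighs the bound [M]. The value at the centre of the disc is then at most
    nearly 1. *)
Lemma Phragmen_Lindelof_rhp (g : C -> C) (M : R) (z0 : C) :
  (forall z, rhp z -> cdiff g z) ->
  (forall z, rhp z -> Cmod (g z) <= M) ->
  (forall z, rhp z -> Cmod (g z) <= exp (fst z)) ->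
  rhp z0 -> Cmod (g z0) <= 1.
Proof.
  intros Dg HM Hexp Hz0. set (x0 := fst z0). set (y0 := snd z0).
  assert (Hx0 : 0 < x0) by exact Hz0.
  pose proof (Rle_trans _ _ _ (Cmod_ge_0 (g z0)) (HM z0 Hz0)) as HM0.
  assert (Main : forall eps, 0 < eps -> eps <= 1 -> eps <= x0 / 2 ->
            Cmod (g z0) <= (1 + 3 * eps) * (1 + eps * Cmod z0)).
  { intros eps He He1 He2.
    set (y := Rabs y0). assert (Hy : 0 <= y) by apply Rabs_pos.
    set (eta := Rmin 1 (eps * x0 / (M + 1 + eps * y))).
    assert (Hden : 0 < M + 1 + eps * y) by nra.
    assert (Heta : 0 < eta).
    { apply Rmin_glb_lt; [lra|]. apply Rdiv_lt_0_compat; nra. }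
    assert (Heta1 : eta <= 1) by apply Rmin_l.
    assert (Heta2 : eta * (M + 1 + eps * y) <= eps * x0).
    { assert (A : eta <= eps * x0 / (M + 1 + eps * y)) by apply Rmin_r.
      apply (Rmult_le_compat_r (M + 1 + eps * y)) in A; [|lra].
      replace (eps * x0 / (M + 1 + eps * y) * (M + 1 + eps * y)) with (eps * x0) in A by (field; lra).
      exact A. }
    (* on the circle of radius sqrt (1 - c), the points that are not sent to the strip
       of width eps lie within eta of 1 *)
    set (c := eps * eta * eta / x0).
    assert (Hc : 0 < c <= 1 / 2).
    { unfold c. split; [apply Rdiv_lt_0_compat; [repeat apply Rmult_lt_0_compat; lra|lra]|].
      apply (proj2 (Rle_div_l (eps * eta * eta) (1 / 2) x0 Hx0)). assert (0 <= eta * eta <= 1) by nra. nra. }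
    set (rho := sqrt (1 - c)).
    assert (Hrho2 : rho * rho = 1 - c) by (apply sqrt_sqrt; lra).
    assert (Hrho0 : 0 < rho) by (apply sqrt_lt_R0; lra).
    assert (Hrho1 : rho < 1) by nra.
    set (psi := fun w : C => (x0 * ((1 + w) / (1 - w)) + Ci * y0)%C).
    assert (N1 : forall w, unit_disc w -> (1 - w)%C <> 0).
    { intros w Hw E. unfold unit_disc in Hw.
      replace w with (1 - (1 - w))%C in Hw by ring. rewrite E in Hw.
      replace (1 - 0)%C with (RtoC 1) in Hw by ring. rewrite Cmod_1 in Hw. lra. }
    assert (Fpsi : forall w, unit_disc w ->
              fst (psi w) * (Cmod (1 - w) * Cmod (1 - w)) = x0 * (1 - Cmod w * Cmod w)).
    { intros w Hw. pose proof (N1 w Hw) as N. pose proof (proj1 (Cmod_gt_0 _) N) as P.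
      replace (fst (psi w)) with (x0 * fst ((1 + w) / (1 - w))%C).
      2:{ unfold psi. set (q := ((1 + w) / (1 - w))%C). clearbody q. simpl. ring. }
      rewrite fst_Cdiv, (Cmod_sqr w) by exact N. set (k := Cmod (1 - w)) in *. clearbody k.
      destruct w. simpl. field. lra. }
    assert (Hpsi : forall w, unit_disc w -> rhp (psi w)).
    { intros w Hw. specialize (Fpsi w Hw). pose proof (proj1 (Cmod_gt_0 _) (N1 w Hw)) as P.
      unfold unit_disc in Hw. pose proof (Cmod_ge_0 w). unfold rhp.
      assert (A : 0 < x0 * (1 - Cmod w * Cmod w)) by (apply Rmult_lt_0_compat; nra).
      assert (0 < Cmod (1 - w) * Cmod (1 - w)) by nra. nra. }
    assert (Nden : forall z, rhp z -> 1 <= Cmod (1 + eps * z)).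
    { intros z Hz. unfold rhp in Hz. eapply Rle_trans; [|apply fst_le_Cmod]. simpl. nra. }
    set (hh := fun w => (g (psi w) / (1 + eps * psi w))%C).
    assert (Dpsi : forall w, unit_disc w -> cdiff psi w).
    { intros w Hw. unfold psi. apply cdiff_plus; [|apply cdiff_const].
      apply cdiff_mult; [apply cdiff_const|]. apply cdiff_div.
      - apply cdiff_plus; [apply cdiff_const|apply cdiff_id].
      - apply cdiff_minus; [apply cdiff_const|apply cdiff_id].
      - apply N1, Hw. }
    assert (P0 : psi 0 = z0).
    { unfold psi. replace ((1 + 0) / (1 - 0))%C with (RtoC 1) by (field; intro E; injection E; lra).
      unfold x0, y0. destruct z0 as [a b]. unfold Ci, RtoC, Cmult, Cplus. simpl. f_equal; ring. }
    assert (B : Cmod (hh 0) <= 1 + 3 * eps).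
    { apply center_le_circle_sup with rho.
      - intros w Hw. unfold hh. pose proof (Hpsi w Hw) as Hp. apply cdiff_div.
        + apply (cdiff_comp g psi); [apply Dpsi, Hw|apply Dg, Hp].
        + apply cdiff_plus; [apply cdiff_const|]. apply cdiff_mult; [apply cdiff_const|apply Dpsi, Hw].
        + apply Cmod_pos_neq_0. specialize (Nden _ Hp). lra.
      - lra.
      - intros w Hwr. assert (Hw : unit_disc w) by (unfold unit_disc; lra).
        pose proof (Hpsi w Hw) as Hp. specialize (Nden _ Hp). unfold hh.
        assert (Nz : (1 + eps * psi w)%C <> 0) by (apply Cmod_pos_neq_0; lra).
        rewrite Cmod_div by exact Nz. apply Rle_div_l; [lra|].
        destruct (Rle_dec (fst (psi w)) eps) as [Hs|Hl].
        + apply Rle_trans with (1 + 3 * eps); [|nra].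
          unfold rhp in Hp. eapply Rle_trans; [apply Hexp, Hp|].
          eapply Rle_trans; [apply exp_le_linear; lra|]. lra.
        + apply Rle_trans with (Cmod (1 + eps * psi w)); [|nra].
          eapply Rle_trans; [apply HM, Hp|].
          specialize (Fpsi w Hw). rewrite Hwr, Hrho2 in Fpsi.
          replace (x0 * (1 - (1 - c))) with (eps * (eta * eta)) in Fpsi by (unfold c; field; lra).
          pose proof (proj1 (Cmod_gt_0 _) (N1 w Hw)) as P.
          assert (Hsmall : Cmod (1 - w) < eta).
          { set (q := Cmod (1 - w)) in *.
            assert (eps * (q * q) < eps * (eta * eta)) by (rewrite <- Fpsi; apply Rmult_lt_compat_r; nra).
            apply Rmult_lt_reg_l in H; [|lra]. apply Rnot_le_lt. intro. nra. }
          (* eta was chosen to send the points within eta of 1 this far *)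
          assert (Hbig : M + 1 <= eps * Cmod (psi w)).
          { assert (T1 : x0 / eta <= Cmod (x0 * ((1 + w) / (1 - w)))).
            { rewrite Cmod_mult, Cmod_real_nonneg, Cmod_div by (try lra; apply N1, Hw).
              apply Rmult_le_compat_l; [lra|].
              assert (1 <= Cmod (1 + w)).
              { pose proof (Cmod_triangle_inv 2 (1 - w)) as T.
                replace (2 - (1 - w))%C with (1 + w)%C in T by ring.
                rewrite (Cmod_real_nonneg 2) in T by lra. lra. }
              apply Rle_div_r; [exact P|].
              apply Rle_trans with (/ eta * eta).
              - apply Rmult_le_compat_l; [left; apply Rinv_0_lt_compat; lra|lra].
              - rewrite Rinv_l by lra. exact H. }
            assert (T2 : Cmod (x0 * ((1 + w) / (1 - w))) - y <= Cmod (psi w)).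
            { pose proof (Cmod_triangle_inv (x0 * ((1 + w) / (1 - w))) (- (Ci * y0))) as T.
              rewrite Cmod_opp, (Cmod_mult Ci), Cmod_Ci, (Cmod_R y0) in T.
              replace (x0 * ((1 + w) / (1 - w)) - - (Ci * y0))%C with (psi w) in T by (unfold psi; ring).
              unfold y. lra. }
            assert (T3 : M + 1 + eps * y <= eps * (x0 / eta)).
            { replace (eps * (x0 / eta)) with (eps * x0 / eta) by (field; lra).
              apply Rle_div_r; lra. }
            nra. }
          pose proof (Cmod_triangle_inv (eps * psi w) (- (1))) as T.
          replace (eps * psi w - - (1))%C with (1 + eps * psi w)%C in T by ring.
          rewrite Cmod_opp, Cmod_1, Cmod_mult, Cmod_real_nonneg in T by lra. lra. }
    unfold hh in B. rewrite P0 in B. specialize (Nden z0 Hz0).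
    assert (Nz : (1 + eps * z0)%C <> 0) by (apply Cmod_pos_neq_0; lra).
    rewrite Cmod_div in B by exact Nz. apply Rle_div_l in B; [|lra].
    eapply Rle_trans; [exact B|]. apply Rmult_le_compat_l; [lra|].
    eapply Rle_trans; [apply Cmod_triangle|].
    rewrite Cmod_1, Cmod_mult, Cmod_real_nonneg by lra. lra. }
  pose proof (Cmod_ge_0 z0) as Pz. apply le_epsilon. intros d Hd.
  set (L := 3 + 4 * Cmod z0).
  assert (HL : 0 < L) by (unfold L; lra).
  set (eps := Rmin (Rmin 1 (x0 / 2)) (d / L)).
  assert (He : 0 < eps).
  { unfold eps. repeat apply Rmin_glb_lt; try lra. apply Rdiv_lt_0_compat; lra. }
  assert (He1 : eps <= 1) by (eapply Rle_trans; [apply Rmin_l|apply Rmin_l]).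
  assert (He2 : eps <= x0 / 2) by (eapply Rle_trans; [apply Rmin_l|apply Rmin_r]).
  assert (He3 : eps * L <= d) by (apply Rle_div_r; [exact HL|apply Rmin_r]).
  eapply Rle_trans; [apply (Main eps He He1 He2)|]. unfold L in He3. assert (eps * eps * Cmod z0 <= eps * Cmod z0) by (apply Rmult_le_compat_r; nra). nra.
Qed.

(** The coordinate [z = exp (-w)] removes the singularity of [F z / z] to infinity, where
    the differentiability of [F] at 0 keeps the quotient bounded. Near the imaginary
    axis the quotient is at most nearly 1. *)
Lemma Schwarz_lemma (F : C -> C) (z : C) :
  (forall z, unit_disc z -> cdiff F z) ->
  (forall z, unit_disc z -> Cmod (F z) <= 1) -> F 0 = 0 ->
  unit_disc z -> Cmod (F z) <= Cmod z.
Proof.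
  intros DF BF F0 Hz. destruct (Ceq_dec z 0) as [->|Nz].
  { rewrite F0. apply Rle_refl. }
  set (g := fun w => (F (Cexp (- w)) * Cexp w)%C).
  destruct (DF 0 disc_0) as [l Hl].
  destruct (has_cderive_lipschitz F 0 l Hl) as [d [Hd HLip]].
  assert (Bg : forall w, rhp w -> Cmod (g w) <= Rmax (Cmod l + 1) (/ d)).
  { intros w Hw. unfold g. pose proof (unit_disc_Cexp_opp w Hw) as Hu.
    set (u := Cexp (- w)) in *. assert (Eu : Cexp w = (/ u)%C).
    { unfold u. rewrite Cexp_opp. field. apply Cexp_neq_0. }
    assert (Nu : u <> 0) by apply Cexp_neq_0. pose proof (proj1 (Cmod_gt_0 u) Nu) as Pu.
    rewrite Eu. fold (F u / u)%C. rewrite Cmod_div by exact Nu.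
    destruct (Rlt_dec (Cmod u) d) as [H|H].
    - eapply Rle_trans; [|apply Rmax_l]. apply Rle_div_l; [exact Pu|].
      specialize (HLip u). replace (u - 0)%C with u in HLip by ring.
      specialize (HLip H). rewrite F0 in HLip. replace (F u - 0)%C with (F u) in HLip by ring. exact HLip.
    - eapply Rle_trans; [|apply Rmax_r]. apply Rle_div_l; [exact Pu|].
      apply Rle_trans with 1; [apply BF, Hu|].
      rewrite <- (Rinv_l d) by lra. apply Rmult_le_compat_l; [|lra].
      left. apply Rinv_0_lt_compat, Hd. }
  destruct (Cexp_polar z Nz) as [w [Ew [Fw _]]].
  pose proof (proj1 (Cmod_gt_0 z) Nz) as Pz.
  assert (Hw : rhp (- w)).
  { unfold rhp. simpl. rewrite Fw. pose proof (ln_increasing _ 1 Pz Hz). rewrite ln_1 in H. lra. }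
  assert (Dg : forall v, rhp v -> cdiff g v).
  { intros v Hv. unfold g. apply cdiff_mult.
    - apply (cdiff_comp F (fun v => Cexp (- v))); [apply cdiff_Cexp, cdiff_opp, cdiff_id|].
        apply DF, unit_disc_Cexp_opp, Hv.
    - apply cdiff_Cexp, cdiff_id. }
  assert (Eg : forall v, rhp v -> Cmod (g v) <= exp (fst v)).
  { intros v Hv. unfold g. rewrite Cmod_mult, Cmod_Cexp.
    pose proof (BF _ (unit_disc_Cexp_opp v Hv)). pose proof (exp_pos (fst v)). nra. }
  pose proof (Phragmen_Lindelof_rhp g _ (- w)%C Dg Bg Eg Hw) as P.
  unfold g in P. replace (- - w)%C with w in P by ring.
  rewrite Cexp_opp, Ew in P. fold (F z / z)%C in P. rewrite Cmod_div in P by exact Nz.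
  apply Rle_div_l in P; [|exact Pz]. lra.
Qed.

(** * Schwarz-Pick and Harnack inequalities *)

Lemma Pick_identity_disc (a z : C) :
  Cmod (1 - Cconj a * z) * Cmod (1 - Cconj a * z)
  = Cmod (z - a) * Cmod (z - a) + (1 - Cmod a * Cmod a) * (1 - Cmod z * Cmod z).
Proof. rewrite !Cmod_sqr. destruct a, z. simpl. ring. Qed.

Lemma Pick_identity_rhp (p q : C) :
  Cmod (p + Cconj q) * Cmod (p + Cconj q)
  = Cmod (p - q) * Cmod (p - q) + 4 * (fst p * fst q).
Proof. rewrite !Cmod_sqr. destruct p, q. simpl. ring. Qed.

Lemma Rsqr_le_le (a b : R) : 0 <= b -> a * a <= b * b -> a <= b.
Proof. intros. nra. Qed.

Lemma Cmod_conj_mult_lt_1 (a z : C) : Cmod a <= 1 -> unit_disc z -> Cmod (Cconj a * z) < 1.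
Proof.
  unfold unit_disc. intros Ha Hz. rewrite Cmod_mult, Cmod_conj.
  pose proof (Cmod_ge_0 a). pose proof (Cmod_ge_0 z). nra.
Qed.

Lemma one_minus_neq_0 (z : C) : Cmod z < 1 -> (1 - z)%C <> 0.
Proof.
  intros H. apply Cmod_pos_neq_0. pose proof (Cmod_triangle_inv 1 z). rewrite Cmod_1 in H0. lra.
Qed.

(** The Schwarz lemma between the automorphisms that carry [a] and [f a] to 0. *)
Lemma Schwarz_Pick_disc (f : C -> C) (a b : C) :
  (forall z, unit_disc z -> cdiff f z) ->
  (forall z, unit_disc z -> unit_disc (f z)) ->
  unit_disc a -> unit_disc b ->
  Cmod (f b - f a) * Cmod (1 - Cconj a * b) <= Cmod (b - a) * Cmod (1 - Cconj (f a) * f b).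
Proof.
  intros Df Hf Ha Hb.
  set (phi := fun v : C => ((v + a) / (1 + Cconj a * v))%C).
  assert (Nphi : forall v, unit_disc v -> (1 + Cconj a * v)%C <> 0).
  { intros v Hv. replace (1 + Cconj a * v)%C with (1 - Cconj a * (- v))%C by ring.
    apply one_minus_neq_0, Cmod_conj_mult_lt_1; unfold unit_disc in *; [lra|].
    rewrite Cmod_opp. exact Hv. }
  assert (Hphi : forall v, unit_disc v -> unit_disc (phi v)).
  { intros v Hv. unfold phi, unit_disc in *. rewrite Cmod_div by (apply Nphi, Hv).
    pose proof (proj1 (Cmod_gt_0 _) (Nphi v Hv)) as P. apply Rlt_div_l; [exact P|].
    rewrite Rmult_1_l. pose proof (Pick_identity_disc (- a) v) as E.
    rewrite Cmod_opp, Copp_conj in E.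
    replace (1 - - Cconj a * v)%C with (1 + Cconj a * v)%C in E by ring.
    replace (v - - a)%C with (v + a)%C in E by ring.
    pose proof (Cmod_ge_0 a). pose proof (Cmod_ge_0 v).
    assert (0 < (1 - Cmod a * Cmod a) * (1 - Cmod v * Cmod v)) by (apply Rmult_lt_0_compat; nra).
    apply Rnot_le_lt. intro. nra. }
  assert (Nf : forall z, unit_disc z -> (1 - Cconj (f a) * f z)%C <> 0).
  { intros z Hz. apply one_minus_neq_0, Cmod_conj_mult_lt_1; [|apply Hf, Hz].
    left. apply Hf, Ha. }
  set (F := fun v => ((f (phi v) - f a) / (1 - Cconj (f a) * f (phi v)))%C).
  set (v := ((b - a) / (1 - Cconj a * b))%C).
  assert (Nv : (1 - Cconj a * b)%C <> 0).
  { apply one_minus_neq_0, Cmod_conj_mult_lt_1; [left; exact Ha|exact Hb]. }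
  pose proof (proj1 (Cmod_gt_0 _) Nv) as Pv.
  assert (Hv : unit_disc v).
  { unfold v, unit_disc in *. rewrite Cmod_div by exact Nv. apply Rlt_div_l; [exact Pv|].
    rewrite Rmult_1_l. pose proof (Pick_identity_disc a b) as E.
    pose proof (Cmod_ge_0 a). pose proof (Cmod_ge_0 b).
    assert (0 < (1 - Cmod a * Cmod a) * (1 - Cmod b * Cmod b)) by (apply Rmult_lt_0_compat; nra).
    apply Rnot_le_lt. intro. nra. }
  assert (Ev : phi v = b).
  { unfold phi, v. field. split; [exact Nv|].
    replace (1 - Cconj a * b + Cconj a * (b - a))%C with (1 - Cconj a * a)%C by ring.
    apply one_minus_neq_0, Cmod_conj_mult_lt_1; [left; exact Ha|exact Ha]. }
  assert (S : Cmod (F v) <= Cmod v).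
  { apply Schwarz_lemma; [| | |exact Hv].
    - intros w Hw. assert (D : cdiff (fun w => f (phi w)) w).
      { apply (cdiff_comp f phi); [|apply Df, Hphi, Hw]. unfold phi. apply cdiff_div.
        - apply cdiff_plus; [apply cdiff_id|apply cdiff_const].
        - apply cdiff_plus; [apply cdiff_const|]. apply cdiff_mult; [apply cdiff_const|apply cdiff_id].
        - apply Nphi, Hw. }
      unfold F. apply cdiff_div.
      + apply cdiff_minus; [exact D|apply cdiff_const].
      + apply cdiff_minus; [apply cdiff_const|]. apply cdiff_mult; [apply cdiff_const|exact D].
      + apply Nf, Hphi, Hw.
    - intros w Hw. unfold F. pose proof (Nf _ (Hphi w Hw)) as N.
      rewrite Cmod_div by exact N. apply Rle_div_l; [apply Cmod_gt_0, N|]. rewrite Rmult_1_l.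
      pose proof (Pick_identity_disc (f a) (f (phi w))) as E.
      pose proof (Hf a Ha) as A. pose proof (Hf _ (Hphi w Hw)) as B. unfold unit_disc in A, B.
      pose proof (Cmod_ge_0 (f a)). pose proof (Cmod_ge_0 (f (phi w))).
      apply Rsqr_le_le; [apply Cmod_ge_0|].
      assert (0 <= (1 - Cmod (f a) * Cmod (f a)) * (1 - Cmod (f (phi w)) * Cmod (f (phi w))))
        by (apply Rmult_le_pos; nra). lra.
    - assert (E0 : phi 0 = a).
      { unfold phi. replace (1 + Cconj a * 0)%C with (RtoC 1) by ring. field. }
      unfold F. rewrite E0. unfold Cdiv. ring. }
  unfold F in S. rewrite Ev in S. unfold v in S.
  pose proof (proj1 (Cmod_gt_0 _) (Nf b Hb)) as Pf.
  rewrite !Cmod_div in S by (try exact Nv; apply Nf, Hb).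
  apply (proj1 (Rle_div_l _ _ _ Pf)) in S.
  apply (Rmult_le_compat_r (Cmod (1 - Cconj a * b))) in S; [|lra].
  eapply Rle_trans; [exact S|]. apply Req_le. field. lra.
Qed.

(** The imaginary axis is included, since rotations and translations have imaginary
    constants as velocities. *)
Definition herglotz (U : C -> C) : Prop :=
  (forall z, rhp z -> cdiff U z) /\ (forall z, rhp z -> 0 <= fst (U z)).

Lemma rhp_plus_conj_neq_0 (p q : C) : 0 < fst p + fst q -> (p + Cconj q)%C <> 0.
Proof.
  intros H E. assert (E' : fst (p + Cconj q)%C = 0) by (rewrite E; reflexivity).
  simpl in E'. lra.
Qed.

(** The Schwarz lemma between the Cayley transforms that carry [w] and [U w] to 0. *)
Lemma Schwarz_Pick_rhp (U : C -> C) (z w : C) :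
  herglotz U -> rhp z -> rhp w ->
  Cmod (U z - U w) * Cmod (z + Cconj w) <= Cmod (z - w) * Cmod (U z + Cconj (U w)).
Proof.
  intros [DU RU] Hz Hw. unfold rhp in Hz, Hw.
  set (psi := fun v : C => ((w + Cconj w * v) / (1 - v))%C).
  assert (Hpsi : forall v, unit_disc v -> rhp (psi v)).
  { intros v Hv. pose proof (one_minus_neq_0 v Hv) as N.
    pose proof (proj1 (Cmod_gt_0 _) N) as P.
    assert (F : fst (psi v) * (Cmod (1 - v) * Cmod (1 - v)) = fst w * (1 - Cmod v * Cmod v)).
    { unfold psi. rewrite fst_Cdiv, (Cmod_sqr v) by exact N. set (k := Cmod (1 - v)) in *.
      clearbody k. clear Hz Hw DU RU. destruct v, w. simpl. field. lra. }
    unfold unit_disc in Hv. pose proof (Cmod_ge_0 v).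
    assert (0 < fst w * (1 - Cmod v * Cmod v)) by (apply Rmult_lt_0_compat; nra).
    unfold rhp. nra. }
  set (v := ((z - w) / (z + Cconj w))%C).
  assert (Nv : (z + Cconj w)%C <> 0) by (apply rhp_plus_conj_neq_0; lra).
  pose proof (proj1 (Cmod_gt_0 _) Nv) as Pv.
  assert (Hv : unit_disc v).
  { unfold v, unit_disc. rewrite Cmod_div by exact Nv. apply Rlt_div_l; [exact Pv|].
    pose proof (Pick_identity_rhp z w). pose proof (Cmod_ge_0 (z - w)).
    assert (0 < fst z * fst w) by nra. apply Rnot_le_lt. intro. nra. }
  assert (Ev : psi v = z).
  { unfold psi, v. field. split; [exact Nv|].
    replace (z + Cconj w - (z - w))%C with (w + Cconj w)%C by ring.
    apply rhp_plus_conj_neq_0. lra. }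
  (* a positive constant is added to U, which may be purely imaginary *)
  assert (Main : forall e, 0 < e ->
     Cmod (U z - U w) * Cmod (z + Cconj w) <= Cmod (z - w) * (Cmod (U z + Cconj (U w)) + 2 * e)).
  { intros e He.
    set (T := fun v => (U v + e)%C).
    assert (RT : forall y, rhp y -> 0 < fst (T y)).
    { intros y Hy. specialize (RU y Hy). unfold T. simpl. lra. }
    set (F := fun y => ((T (psi y) - T w) / (T (psi y) + Cconj (T w)))%C).
    assert (NT : forall y, rhp y -> (T y + Cconj (T w))%C <> 0).
    { intros y Hy. apply rhp_plus_conj_neq_0. pose proof (RT y Hy). pose proof (RT w Hw). lra. }
    assert (S : Cmod (F v) <= Cmod v).
    { apply Schwarz_lemma; [| | |exact Hv].
      - intros y Hy. assert (D : cdiff (fun y => T (psi y)) y).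
        { unfold T. apply cdiff_plus; [|apply cdiff_const].
          apply (cdiff_comp U psi); [|apply DU, Hpsi, Hy]. unfold psi. apply cdiff_div.
          - apply cdiff_plus; [apply cdiff_const|]. apply cdiff_mult; [apply cdiff_const|apply cdiff_id].
          - apply cdiff_minus; [apply cdiff_const|apply cdiff_id].
          - apply one_minus_neq_0, Hy. }
        unfold F. apply cdiff_div; [| |apply NT, Hpsi, Hy].
        + apply cdiff_minus; [exact D|apply cdiff_const].
        + apply cdiff_plus; [exact D|apply cdiff_const].
      - intros y Hy. unfold F. pose proof (NT _ (Hpsi y Hy)) as N.
        rewrite Cmod_div by exact N. apply Rle_div_l; [apply Cmod_gt_0, N|]. rewrite Rmult_1_l.
        pose proof (Pick_identity_rhp (T (psi y)) (T w)).
        pose proof (RT w Hw). pose proof (RT _ (Hpsi y Hy)).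
        apply Rsqr_le_le; [apply Cmod_ge_0|]. nra.
      - assert (E0 : psi 0 = w).
        { unfold psi. field. }
        unfold F. rewrite E0. unfold Cdiv. ring. }
    unfold F in S. rewrite Ev in S. unfold v in S.
    pose proof (NT z Hz) as N. pose proof (proj1 (Cmod_gt_0 _) N) as P.
    rewrite !Cmod_div in S by (try exact Nv; exact N).
    apply (proj1 (Rle_div_l _ _ _ P)) in S.
    apply (Rmult_le_compat_r (Cmod (z + Cconj w))) in S; [|lra].
    replace (T z - T w)%C with (U z - U w)%C in S by (unfold T; ring).
    eapply Rle_trans; [exact S|].
    replace (Cmod (z - w) / Cmod (z + Cconj w) * Cmod (T z + Cconj (T w)) * Cmod (z + Cconj w))
      with (Cmod (z - w) * Cmod (T z + Cconj (T w))) by (field; lra).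
    apply Rmult_le_compat_l; [apply Cmod_ge_0|].
    replace (T z + Cconj (T w))%C with (U z + Cconj (U w) + RtoC (2 * e))%C.
    - eapply Rle_trans; [apply Cmod_triangle|]. rewrite (Cmod_real_nonneg (2 * e)) by lra. lra.
    - unfold T. rewrite Cplus_conj, RtoC_mult.
      replace (Cconj e) with (RtoC e) by (unfold Cconj, RtoC; simpl; f_equal; ring). ring. }
  apply le_epsilon. intros d Hd. pose proof (Cmod_ge_0 (z - w)) as P.
  eapply Rle_trans; [apply (Main (d / (2 * (Cmod (z - w) + 1))))|].
  - apply Rdiv_lt_0_compat; lra.
  - rewrite Rmult_plus_distr_l. apply Rplus_le_compat_l.
    replace (Cmod (z - w) * (2 * (d / (2 * (Cmod (z - w) + 1)))))
      with (d * (Cmod (z - w) / (Cmod (z - w) + 1))) by (field; lra).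
    assert (Cmod (z - w) / (Cmod (z - w) + 1) <= 1) by (apply Rle_div_l; lra). nra.
Qed.

(** Schwarz-Pick, with both sides rewritten by the identity of Pick, compares
    [fst z * fst w] with [fst (U z) * fst (U w)]. *)
Lemma herglotz_Re_Harnack (U : C -> C) (z w : C) :
  herglotz U -> rhp z -> rhp w ->
  fst (U w) * (fst z * fst w) <= fst (U z) * (Cmod (z + Cconj w) * Cmod (z + Cconj w)).
Proof.
  intros HU Hz Hw. pose proof (Schwarz_Pick_rhp U z w HU Hz Hw) as S.
  destruct HU as [_ RU]. pose proof (RU z Hz) as Az. pose proof (RU w Hw) as Aw.
  unfold rhp in Hz, Hw.
  pose proof (Pick_identity_rhp z w) as I1. pose proof (Pick_identity_rhp (U z) (U w)) as I2.
  pose proof (fst_le_Cmod (U z + Cconj (U w))) as L. simpl in L.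
  set (a := fst (U z)) in *. set (b := fst (U w)) in *.
  set (N := Cmod (z + Cconj w)) in *. set (m := Cmod (z - w)) in *.
  set (A := Cmod (U z + Cconj (U w))) in *. set (B := Cmod (U z - U w)) in *.
  assert (HN : 0 <= N) by apply Cmod_ge_0. assert (Hm : 0 <= m) by apply Cmod_ge_0.
  assert (HA : 0 <= A) by apply Cmod_ge_0. assert (HB : 0 <= B) by apply Cmod_ge_0.
  destruct (Req_dec b 0) as [Z|NZ]; [rewrite Z, Rmult_0_l; nra|].
  assert (S2 : (B * N) * (B * N) <= (m * A) * (m * A)) by (apply Rmult_le_compat; nra).
  assert (K : (4 * (fst z * fst w)) * (A * A) <= 4 * (a * b) * (N * N)).
  { replace (4 * (a * b)) with (A * A - B * B) by lra.
    replace (4 * (fst z * fst w)) with (N * N - m * m) by lra. lra. }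
  assert (Hp : 0 < fst z * fst w) by nra.
  assert (K2 : fst z * fst w * (b * b) <= fst z * fst w * (A * A)).
  { apply Rmult_le_compat_l; [lra|]. apply Rmult_le_compat; lra. }
  apply Rmult_le_reg_r with b; [lra|]. lra.
Qed.

Lemma herglotz_Cmod_Harnack (U : C -> C) (z w : C) :
  herglotz U -> rhp z -> rhp w ->
  Cmod (U z) * (fst z * fst w) <= Cmod (U w) * (Cmod (z + Cconj w) * Cmod (z + Cconj w)).
Proof.
  intros HU Hz Hw. pose proof (Schwarz_Pick_rhp U z w HU Hz Hw) as S.
  unfold rhp in Hz, Hw. pose proof (Pick_identity_rhp z w) as I1.
  pose proof (Cmod_triangle (U z) (Cconj (U w))) as T1. rewrite Cmod_conj in T1.
  pose proof (Cmod_triangle_inv (U z) (U w)) as T2.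
  set (N := Cmod (z + Cconj w)) in *. set (m := Cmod (z - w)) in *.
  set (a := Cmod (U z)) in *. set (b := Cmod (U w)) in *.
  assert (HN : 0 <= N) by apply Cmod_ge_0. assert (Hm : 0 <= m) by apply Cmod_ge_0.
  assert (Ha : 0 <= a) by apply Cmod_ge_0. assert (Hb : 0 <= b) by apply Cmod_ge_0.
  assert (Hp : 0 < fst z * fst w) by nra.
  assert (HmN : m < N) by (apply Rnot_le_lt; intro; nra).
  assert (K : (a - b) * N <= m * (a + b)).
  { eapply Rle_trans; [apply Rmult_le_compat_r; [exact HN|exact T2]|].
    eapply Rle_trans; [exact S|]. apply Rmult_le_compat_l; lra. }
  assert (K1 : a * (N - m) <= b * (N + m)) by lra.
  apply (Rmult_le_compat_r (N + m)) in K1; [|lra].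
  assert (K2 : b * ((N + m) * (N + m)) <= b * (4 * (N * N))) by (apply Rmult_le_compat_l; nra).
  assert (K3 : a * (N - m) * (N + m) = 4 * (a * (fst z * fst w))).
  { replace (a * (N - m) * (N + m)) with (a * (N * N - m * m)) by ring. rewrite I1. ring. }
  lra.
Qed.

(** Close points have close values, relative to the size of the value: a small
    pseudohyperbolic distance bounds the relative oscillation. *)
Lemma herglotz_lipschitz (U : C -> C) (z w : C) :
  herglotz U -> rhp z -> rhp w -> 2 * Cmod (z - w) <= fst w ->
  Cmod (U z - U w) * fst w <= 4 * Cmod (z - w) * Cmod (U w).
Proof.
  intros HU Hz Hw H. pose proof (Schwarz_Pick_rhp U z w HU Hz Hw) as S.
  unfold rhp in Hz, Hw.
  pose proof (Cmod_triangle (U z) (Cconj (U w))) as T1. rewrite Cmod_conj in T1.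
  pose proof (Cmod_triangle_inv (U z) (U w)) as T2.
  pose proof (fst_le_Cmod (z + Cconj w)) as L. simpl in L.
  pose proof (Cmod_ge_0 (z - w)). pose proof (Cmod_ge_0 (U z - U w)). pose proof (Cmod_ge_0 (U w)).
  set (m := Cmod (z - w)) in *. set (B := Cmod (U z - U w)) in *.
  assert (K : B * fst w <= m * (B + 2 * Cmod (U w))).
  { apply Rle_trans with (B * Cmod (z + Cconj w)); [apply Rmult_le_compat_l; lra|].
    eapply Rle_trans; [exact S|]. apply Rmult_le_compat_l; lra. }
  nra.
Qed.

(** If [U w] is imaginary, the inequality of Schwarz and Pick has [U z - U w] on both
    sides, with the larger factor on the left. *)
Lemma herglotz_Re_0_const (U : C -> C) (z w : C) :
  herglotz U -> rhp z -> rhp w -> fst (U w) = 0 -> U z = U w.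
Proof.
  intros HU Hz Hw H. pose proof (Schwarz_Pick_rhp U z w HU Hz Hw) as S.
  replace (Cconj (U w)) with (- U w)%C in S.
  2:{ destruct (U w) as [a b]. simpl in H. subst a. unfold Cconj, Copp. simpl. f_equal. ring. }
  fold (U z - U w)%C in S. unfold rhp in Hz, Hw.
  pose proof (Pick_identity_rhp z w) as I. pose proof (Cmod_ge_0 (z - w)).
  pose proof (Cmod_ge_0 (z + Cconj w)). assert (0 < fst z * fst w) by nra.
  assert (Cmod (z - w) < Cmod (z + Cconj w)) by (apply Rnot_le_lt; intro; nra).
  apply Ceq_minus, Cmod_eq_0. pose proof (Cmod_ge_0 (U z - U w)). nra.
Qed.

(** * The displacement along a discrete orbit *)

Lemma fst_Cinv (z : C) : z <> 0 -> fst (/ z)%C = fst z / (Cmod z * Cmod z).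
Proof.
  intro H. rewrite Cmod_sqr. destruct z as [x y]. simpl. f_equal. ring.
Qed.

Lemma herglotz_pos (U : C -> C) (z : C) :
  herglotz U -> 0 < fst (U 1) -> rhp z -> 0 < fst (U z).
Proof.
  intros HU H1 Hz. assert (R1 : rhp 1) by (unfold rhp; simpl; lra).
  pose proof (herglotz_Re_Harnack U z 1 HU Hz R1) as H. unfold rhp in Hz. simpl in H.
  pose proof (Cmod_ge_0 (z + Cconj 1)).
  assert (0 < fst (U 1) * (fst z * 1)) by (apply Rmult_lt_0_compat; lra).
  destruct (proj2 HU z Hz) as [P|P]; [exact P|]. rewrite <- P in H. lra.
Qed.

Lemma herglotz_inv (U : C -> C) :
  herglotz U -> 0 < fst (U 1) -> herglotz (fun z => / U z)%C.
Proof.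
  intros HU H1.
  assert (P : forall z, rhp z -> 0 < fst (U z)) by (intros; apply herglotz_pos; assumption).
  split; intros z Hz.
  - apply cdiff_inv; [apply HU, Hz|]. apply rhp_neq_0, P, Hz.
  - specialize (P z Hz). rewrite fst_Cinv by (apply rhp_neq_0, P).
    pose proof (fst_le_Cmod (U z)). apply Rlt_le, Rdiv_lt_0_compat; nra.
Qed.

(** The inequality behind the square root. The quotient of the increments of [K] and
    of its argument is the mean of [Q] over the segment. By Harnack, the real part of
    [Q] is at least of the order of the distance to the imaginary axis, and on the
    half of the segment next to [b] this distance is at least the mean of those of
    [a] and [b]. If the increment of [K] is a real number [t], the real part on the
    right is [t * (fst b - fst a)], at most [t * (fst a + fst b)]: the sum cancels. *)
Lemma herglotz_primitive_increment (Q K : C -> C) (c : R) (a b : C) :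
  herglotz Q -> c <= fst (Q 1) -> 0 < c ->
  (forall z, rhp z -> has_cderive K z (Q z)) ->
  rhp a -> fst a <= fst b ->
  c * (fst a + fst b) * (Cmod (b - a) * Cmod (b - a))
  <= 4 * fst ((K b - K a) * Cconj (b - a))%C
     * ((Cmod a + 1 + Cmod (b - a)) * (Cmod a + 1 + Cmod (b - a))).
Proof.
  intros HQ Hc Hc0 DK Ha Hab. unfold rhp in Ha. set (v := (b - a)%C). set (M := Cmod a + 1 + Cmod v).
  assert (Hb : rhp b) by (unfold rhp; lra). assert (R1 : rhp 1) by (unfold rhp; simpl; lra).
  assert (Hseg : forall r, 0 <= r <= 1 -> rhp (a + r * v)) by (intros; apply rhp_segment; assumption).
  pose proof (Cmod_ge_0 a). pose proof (Cmod_ge_0 v).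
  (* the first half contributes a nonnegative amount, the second one the bound *)
  destruct (cderive_segment_MVT K Q a v (Cconj v) 0 (1/2)) as [r1 [Hr1 E1]]; [lra| |].
  { intros r Hr. apply DK, Hseg. lra. }
  destruct (cderive_segment_MVT K Q a v (Cconj v) (1/2) 1) as [r2 [Hr2 E2]]; [lra| |].
  { intros r Hr. apply DK, Hseg. lra. }
  assert (Sq : forall q, fst (q * v * Cconj v)%C = fst q * (Cmod v * Cmod v)).
  { intro q. rewrite Cmod_sqr. destruct q, v. simpl. ring. }
  rewrite Sq in E1, E2.
  assert (E : fst ((K b - K a) * Cconj v)%C
     = fst ((K (a + (1/2)%R * v) - K (a + 0 * v)) * Cconj v)%C
     + fst ((K (a + 1 * v) - K (a + (1/2)%R * v)) * Cconj v)%C).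
  { replace (a + 0 * v)%C with a by ring. replace (a + 1 * v)%C with b by (unfold v; ring).
    simpl. ring. }
  rewrite E, E1, E2. clear E E1 E2.
  set (w := (a + r2 * v)%C). assert (Hw : rhp w) by (apply Hseg; lra).
  assert (Q1 : 0 <= fst (Q (a + r1 * v)%C)) by (apply HQ, Hseg; lra).
  pose proof (herglotz_Re_Harnack Q w 1 HQ Hw R1) as Hk.
  assert (Hfw : (fst a + fst b) / 2 <= fst w) by (unfold w, v; simpl; nra).
  set (N := Cmod (w + Cconj 1)) in *.
  assert (HN : 0 <= N <= M).
  { split; [apply Cmod_ge_0|]. unfold N, w, M.
    eapply Rle_trans; [apply Cmod_triangle|]. rewrite Cmod_conj, Cmod_1.
    eapply Rle_trans; [apply Rplus_le_compat_r, Cmod_triangle|].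
    rewrite Cmod_mult, Cmod_real_nonneg by lra. nra. }
  change (fst (RtoC 1)) with 1 in Hk.
  assert (P : 0 <= fst (Q w)) by (apply HQ, Hw).
  assert (K1 : c * ((fst a + fst b) / 2) <= fst (Q w) * (M * M)).
  { apply Rle_trans with (fst (Q 1) * (fst w * 1)).
    - apply Rmult_le_compat; lra.
    - eapply Rle_trans; [exact Hk|]. apply Rmult_le_compat_l; [exact P|]. nra. }
  set (V := Cmod v * Cmod v). assert (HV : 0 <= V) by (unfold V; nra).
  set (q1 := fst (Q (a + r1 * v)%C)) in *. set (q2 := fst (Q w)) in *.
  assert (0 <= q1 * V * (M * M)).
  { repeat apply Rmult_le_pos; try assumption; unfold M; lra. }
  apply (Rmult_le_compat_r V) in K1; [|exact HV]. lra.
Qed.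

(** The increment of [K] is [(z' - z) / U z] up to the oscillation of [1 / U] between
    the two points, that is [s] up to an error of order [s^2]. *)
Lemma herglotz_primitive_step (U K : C -> C) (z z' : C) (s x0 B : R) :
  herglotz U -> 0 < fst (U 1) ->
  (forall z, rhp z -> has_cderive K z (/ U z)%C) ->
  0 < x0 -> x0 <= fst z -> x0 <= fst z' -> 0 < s -> Cmod (U z) <= B ->
  2 * s * B <= 1 -> 4 * s * B <= x0 ->
  Cmod (z' - z - s * U z) <= 2 * (s * Cmod (U z)) * (s * Cmod (U z)) ->
  Cmod (z' - z) <= 2 * s * B /\
  Cmod (K z' - K z - s) <= s * s * (B * (16 / x0 + 2)).
Proof.
  intros HU H1 DK Hx0 Hx Hx' Hs HB Hs1 Hs2 He.
  assert (Hz : rhp z) by (unfold rhp; lra). assert (Hz' : rhp z') by (unfold rhp; lra).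
  pose proof (herglotz_inv U HU H1) as HQ.
  assert (Pz : 0 < fst (U z)) by (apply herglotz_pos; assumption).
  assert (Nz : U z <> 0) by (apply rhp_neq_0, Pz).
  pose proof (proj1 (Cmod_gt_0 _) Nz) as Pu. set (u := Cmod (U z)) in *.
  set (e := (z' - z)%C) in *.
  assert (Hsu : s * u <= s * B) by (apply Rmult_le_compat_l; lra).
  assert (Hsu0 : 0 < s * u) by nra.
  assert (Ee : Cmod e <= 2 * (s * u)).
  { pose proof (Cmod_triangle_inv e (s * U z)) as T.
    rewrite Cmod_mult, Cmod_real_nonneg in T by lra. fold u in T. nra. }
  split; [lra|].
  pose proof (Cmod_ge_0 e) as Pe.
  assert (A1 : Cmod (K z' - K z - e / U z) <= 4 * Cmod e / (x0 * u) * Cmod e).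
  { replace (K z' - K z - e / U z)%C
      with ((K z' + - (/ U z * z')) - (K z + - (/ U z * z)))%C by (unfold e, Cdiv; ring).
    apply (cderive_segment_bound (fun w => K w + - (/ U z * w))%C (fun w => / U w + - / U z)%C).
    - intros r Hr. eapply has_cderive_eq.
      + apply has_cderive_plus; [apply DK, rhp_segment; assumption|].
        apply has_cderive_opp, has_cderive_mult; [apply has_cderive_const|apply has_cderive_id].
      + cbv beta. ring.
    - intros r Hr. set (w := (z + r * (z' - z))%C).
      assert (Hw : rhp w) by (apply rhp_segment; assumption).
      assert (Ew : Cmod (w - z) <= Cmod e).
      { replace (w - z)%C with (r * e)%C by (unfold w, e; ring).
        rewrite Cmod_mult, Cmod_real_nonneg by lra. nra. }
      pose proof (herglotz_lipschitz _ w z HQ Hw Hz ltac:(lra)) as L.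
      cbv beta in L. rewrite (Cmod_inv (U z) Nz) in L. fold u in L. fold (/ U w - / U z)%C.
      replace (4 * Cmod e / (x0 * u)) with (4 * Cmod e * / u / x0) by (field; lra).
      apply Rle_div_r; [lra|].
      apply Rle_trans with (Cmod (/ U w - / U z) * fst z).
      + apply Rmult_le_compat_l; [apply Cmod_ge_0|exact Hx].
      + eapply Rle_trans; [exact L|]. apply Rmult_le_compat_r; [|lra].
        left. apply Rinv_0_lt_compat, Pu. }
  assert (A2 : Cmod (e / U z - s) <= 2 * s * (s * u)).
  { replace (e / U z - s)%C with ((e - s * U z) / U z)%C by (field; exact Nz).
    rewrite Cmod_div by exact Nz. fold u. apply Rle_div_l; [exact Pu|]. lra. }
  replace (K z' - K z - s)%C with ((K z' - K z - e / U z) + (e / U z - s))%C by ring.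
  eapply Rle_trans; [apply Cmod_triangle|].
  assert (A3 : 4 * Cmod e / (x0 * u) * Cmod e <= 16 * s * (s * u) / x0).
  { replace (16 * s * (s * u) / x0) with (4 * (2 * (s * u)) / (x0 * u) * (2 * (s * u))) by (field; lra).
    assert (0 < / (x0 * u)) by (apply Rinv_0_lt_compat; nra).
    apply Rmult_le_compat; try lra.
    - unfold Rdiv. apply Rmult_le_pos; lra.
    - unfold Rdiv. apply Rmult_le_compat_r; lra. }
  assert (A4 : 16 * s * (s * u) / x0 <= 16 * s * (s * B) / x0).
  { unfold Rdiv. apply Rmult_le_compat_r; [left; apply Rinv_0_lt_compat, Hx0|].
    apply Rmult_le_compat_l; lra. }
  replace (s * s * (B * (16 / x0 + 2))) with (16 * s * (s * B) / x0 + 2 * s * (s * B)) by (field; lra).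
  assert (2 * s * (s * u) <= 2 * s * (s * B)) by (apply Rmult_le_compat_l; lra). lra.
Qed.

Lemma quadratic_displacement_bound (c t L D : R) :
  0 < c -> 0 < t -> 16 * t <= c -> 0 <= L -> 0 <= D ->
  c * (D * D) <= 4 * t * ((L + D) * (L + D)) -> D <= 4 * sqrt (t / c) * L.
Proof.
  intros Hc Ht Htc HL HD H.
  assert (Hq : 0 < t / c) by (apply Rdiv_lt_0_compat; lra).
  set (q := sqrt (t / c)). assert (q0 : 0 < q) by (apply sqrt_lt_R0, Hq).
  assert (Eq : q * q = t / c) by (apply sqrt_sqrt; lra).
  assert (Et : t = q * q * c) by (rewrite Eq; field; lra).
  assert (q4 : q <= 1 / 4).
  { apply Rsqr_le_le; [lra|]. rewrite Eq. apply Rle_div_l; lra. }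
  assert (K : D <= 2 * q * (L + D)).
  { apply Rsqr_le_le; [apply Rmult_le_pos; lra|].
    apply Rmult_le_reg_l with c; [exact Hc|]. rewrite Et in H. lra. }
  nra.
Qed.

(** A discrete orbit of step [s] of the vector field [U]. A primitive of [1 / U]
    grows by nearly [s] at each step, so that its total increment is nearly the
    real number [n s]. For small [s] the accumulated error stays below the initial
    abscissa, which the estimate absorbs. *)
Lemma chain_displacement (U : C -> C) (c1 C1 s B : R) (n : nat) (zeta : nat -> C) :
  herglotz U -> 0 < c1 -> c1 <= fst (U 1) -> Cmod (U 1) <= C1 ->
  rhp (zeta O) -> 0 < s -> (0 < n)%nat ->
  (forall k, (k <= n)%nat -> fst (zeta O) <= fst (zeta k)) ->
  (forall k, (k < n)%nat -> Cmod (U (zeta k)) <= B /\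
     Cmod (zeta (S k) - zeta k - s * U (zeta k))
       <= 2 * (s * Cmod (U (zeta k))) * (s * Cmod (U (zeta k)))) ->
  2 * s * B <= 1 -> 4 * s * B <= fst (zeta O) ->
  s * (B * (16 / fst (zeta O) + 2)) * (2 * (INR n * s) * B) <= fst (zeta O) ->
  16 * (INR n * s) <= c1 / (C1 * C1) ->
  Cmod (zeta n - zeta O) <= 4 * sqrt (INR n * s / (c1 / (C1 * C1))) * (Cmod (zeta O) + 1).
Proof.
  intros HU Hc1 HRe HMod H0 Hs Hn Hmono Hchain Hs1 Hs2 Hs3 Ht.
  set (x0 := fst (zeta O)) in *. unfold rhp in H0. fold x0 in H0.
  assert (H1 : 0 < fst (U 1)) by lra.
  assert (R1 : rhp 1) by (unfold rhp; simpl; lra).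
  pose proof (herglotz_inv U HU H1) as HQ.
  destruct (rhp_primitive _ (proj1 HQ)) as [K DK].
  pose proof (fst_le_Cmod (U 1)) as F1.
  set (c := c1 / (C1 * C1)) in *.
  assert (Hc : 0 < c) by (apply Rdiv_lt_0_compat; nra).
  assert (HcQ : c <= fst (/ U 1)%C).
  { rewrite fst_Cinv by (apply rhp_neq_0, H1). unfold c, Rdiv.
    apply Rmult_le_compat; [lra|left; apply Rinv_0_lt_compat; nra|exact HRe|].
    apply Rinv_le_contravar; nra. }
  set (E := B * (16 / x0 + 2)) in *.
  assert (Ind : forall k, (k <= n)%nat ->
            Cmod (zeta k - zeta O) <= INR k * (2 * s * B) /\
            Cmod (K (zeta k) - K (zeta O) - RtoC (INR k * s))%C <= INR k * (s * s * E)).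
  { induction k as [|k IH]; intro Hk.
    - simpl INR. rewrite !Rmult_0_l.
      replace (zeta O - zeta O)%C with (RtoC 0) by ring.
      replace (K (zeta O) - K (zeta O) - 0)%C with (RtoC 0) by ring. rewrite Cmod_0. lra.
    - destruct (IH ltac:(lia)) as [I1 I2]. destruct (Hchain k ltac:(lia)) as [HB He].
      destruct (herglotz_primitive_step U K (zeta k) (zeta (S k)) s x0 B) as [J1 J2];
        try assumption; try (apply Hmono; lia).
      fold E in J2. rewrite S_INR. split.
      + pose proof (Cmod_sub_trans (zeta (S k)) (zeta k) (zeta O)). lra.
      + replace (K (zeta (S k)) - K (zeta O) - RtoC ((INR k + 1) * s))%C
          with ((K (zeta (S k)) - K (zeta k) - s) + (K (zeta k) - K (zeta O) - RtoC (INR k * s)))%C.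
        2:{ rewrite !RtoC_mult, RtoC_plus. ring. }
        eapply Rle_trans; [apply Cmod_triangle|]. lra. }
  destruct (Ind n (Nat.le_refl n)) as [D1 D2]. clear Ind.
  pose proof (herglotz_primitive_increment _ K c (zeta O) (zeta n) HQ HcQ Hc DK H0
                (Hmono n (Nat.le_refl n))) as G.
  set (t := INR n * s) in *.
  assert (Pn : 0 < INR n) by (apply lt_0_INR, Hn).
  assert (Pt : 0 < t) by (unfold t; nra).
  set (v := (zeta n - zeta O)%C) in *. set (kd := (K (zeta n) - K (zeta O))%C) in *.
  pose proof (Hmono n (Nat.le_refl n)) as Hx. fold x0 in G. set (xn := fst (zeta n)) in *.
  pose proof (Cmod_ge_0 v) as Pv.
  assert (Up : fst (kd * Cconj v)%C <= t * (x0 + xn)).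
  { replace (kd * Cconj v)%C with ((kd - t) * Cconj v + t * Cconj v)%C by ring.
    replace (fst ((kd - t) * Cconj v + t * Cconj v)%C)
      with (fst ((kd - t) * Cconj v)%C + t * (xn - x0)).
    2:{ unfold xn, x0, v. simpl. ring. }
    assert (A : fst ((kd - t) * Cconj v)%C <= t * x0).
    { eapply Rle_trans; [apply fst_le_Cmod|]. rewrite Cmod_mult, Cmod_conj.
      apply Rle_trans with (INR n * (s * s * E) * (INR n * (2 * s * B))).
      - apply Rmult_le_compat; try apply Cmod_ge_0; assumption.
      - replace (INR n * (s * s * E) * (INR n * (2 * s * B)))
          with (t * (s * E * (2 * (INR n * s) * B))) by (unfold t; ring).
        apply Rmult_le_compat_l; [lra|exact Hs3]. }
    assert (0 < t * x0) by (apply Rmult_lt_0_compat; lra). lra. }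
  apply quadratic_displacement_bound; try assumption.
  - pose proof (Cmod_ge_0 (zeta O)). lra.
  - set (M := Cmod (zeta O) + 1 + Cmod v) in *.
    assert (HM : 0 <= M * M) by nra.
    apply Rmult_le_reg_r with (x0 + xn); [lra|].
    apply (Rmult_le_compat_r (M * M)) in Up; [|exact HM]. lra.
Qed.

Lemma Rmin_Rle_l (a b c : R) : a <= Rmin b c -> a <= b /\ a <= c.
Proof. pose proof (Rmin_l b c). pose proof (Rmin_r b c). lra. Qed.

Lemma exists_small_step (t sigma : R) : 0 < t -> 0 < sigma ->
  exists n, (0 < n)%nat /\ t / INR n <= sigma.
Proof.
  intros Ht Hs. destruct (archimed_cor1 (sigma / t)) as [n [Hn Hn0]].
  - apply Rdiv_lt_0_compat; assumption.
  - exists n. split; [exact Hn0|].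
    replace sigma with (t * (sigma / t)) by (field; lra). unfold Rdiv at 1.
    apply Rmult_le_compat_l; lra.
Qed.

(** The step may depend on the starting point and on the time, so that the bound [B] on
    the velocities, which degenerates near the imaginary axis, does not enter the
    conclusion. *)
Lemma fine_chain_displacement (P : C -> Prop) (c1 C1 t sigma B : R) (z0 : C) :
  0 < c1 -> 0 < B -> 0 < t -> 0 < sigma -> rhp z0 ->
  16 * t <= c1 / (C1 * C1) ->
  (forall n, (0 < n)%nat -> t / INR n <= sigma -> exists U zeta,
     herglotz U /\ c1 <= fst (U 1) /\ Cmod (U 1) <= C1 /\ zeta O = z0 /\
     (forall k, (k <= n)%nat -> fst z0 <= fst (zeta k)) /\
     (forall k, (k < n)%nat -> Cmod (U (zeta k)) <= B /\
        Cmod (zeta (S k) - zeta k - RtoC (t / INR n) * U (zeta k))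
          <= 2 * (t / INR n * Cmod (U (zeta k))) * (t / INR n * Cmod (U (zeta k)))) /\
     P (zeta n)) ->
  exists z, P z /\ fst z0 <= fst z /\
    Cmod (z - z0) <= 4 * sqrt (t / (c1 / (C1 * C1))) * (Cmod z0 + 1).
Proof.
  intros Hc1 HB Ht Hsig Hz0 Ht16 H. set (x0 := fst z0). assert (Hx0 : 0 < x0) by exact Hz0.
  set (E := B * (16 / x0 + 2)).
  assert (HE : 0 < E).
  { unfold E. apply Rmult_lt_0_compat; [exact HB|].
    assert (0 < 16 / x0) by (apply Rdiv_lt_0_compat; lra). lra. }
  assert (HEB : 0 < E * (2 * t * B)).
  { apply Rmult_lt_0_compat; [exact HE|]. repeat apply Rmult_lt_0_compat; lra. }
  set (s0 := Rmin (Rmin sigma (/ (2 * B))) (Rmin (x0 / (4 * B)) (x0 / (E * (2 * t * B))))).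
  destruct (exists_small_step t s0 Ht) as [n [Hn Hs]].
  { unfold s0. repeat apply Rmin_glb_lt; [exact Hsig| | |].
    - apply Rinv_0_lt_compat. lra.
    - apply Rdiv_lt_0_compat; lra.
    - apply Rdiv_lt_0_compat; assumption. }
  set (s := t / INR n) in *.
  assert (Pn : 0 < INR n) by (apply lt_0_INR, Hn).
  assert (Ps : 0 < s) by (apply Rdiv_lt_0_compat; lra).
  assert (Ens : INR n * s = t) by (unfold s; field; lra).
  apply Rmin_Rle_l in Hs as [[S1 S2]%Rmin_Rle_l [S3 S4]%Rmin_Rle_l].
  destruct (H n Hn S1) as [U [zeta [HU [A1 [A2 [A3 [A4 [A5 A6]]]]]]]].
  exists (zeta n). split; [exact A6|]. split; [apply A4; lia|].
  subst z0. rewrite <- Ens. fold s in A5.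
  apply (chain_displacement U c1 C1 s B n zeta); try assumption.
  - replace (2 * s * B) with (s * (2 * B)) by ring.
    apply Rle_div_r; [lra|]. unfold Rdiv. lra.
  - replace (4 * s * B) with (s * (4 * B)) by ring. apply Rle_div_r; [lra|exact S3].
  - fold x0 E. rewrite Ens, Rmult_assoc. apply Rle_div_r; [exact HEB|exact S4].
  - rewrite Ens. exact Ht16.
Qed.

(** * Orbits of a semigroup *)

(** Continuity is only asked at time 0 and at each point: by Schwarz-Pick it spreads
    to all times, uniformly along an orbit. *)
Record disc_semigroup (Phi : R -> C -> C) : Prop := {
  ds_diff : forall t z, 0 <= t -> unit_disc z -> cdiff (Phi t) z;
  ds_self : forall t z, 0 <= t -> unit_disc z -> unit_disc (Phi t z);
  ds_comp : forall t u z, 0 <= t -> 0 <= u -> unit_disc z -> Phi t (Phi u z) = Phi (t + u) z;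
  ds_cont : forall z eps, unit_disc z -> 0 < eps ->
    exists delta, 0 < delta /\ forall t, 0 <= t < delta -> Cmod (Phi t z - z) < eps
}.

Lemma continuous_semigroup_disc (Phi : R -> C -> C) :
  continuous_semigroup unit_disc Phi -> disc_semigroup Phi.
Proof.
  intros [Hh Hs H0 Hc Hl]. split; auto.
  - intros t z Ht Hz. apply ex_derive_cdiff, (Hh t Ht z Hz).
  - intros z eps Hz Heps.
    destruct (Hl (fun w => w = z)) with (eps := mkposreal eps Heps) as [d Hd].
    + intros I U _ Hcov. destruct (Hcov z eq_refl) as [i Hi]. exists (i :: nil)%list.
      intros x ->. exists i. split; [left; reflexivity|exact Hi].
    + intros w ->. exact Hz.
    + exists d. split; [apply cond_pos|]. intros t [Ht1 Ht2].
      rewrite <- (H0 z Hz) at 2. destruct Ht1 as [Ht1|<-].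
      * apply (Hd t); [|exact Ht1|reflexivity].
        unfold ball; simpl; unfold AbsRing_ball, abs, minus, plus, opp; simpl.
        rewrite Ropp_0, Rplus_0_r, Rabs_pos_eq; lra.
      * replace (Phi 0 z - Phi 0 z)%C with (RtoC 0) by ring. rewrite Cmod_0. exact Heps.
Qed.

(** [Phi a] does not increase the pseudohyperbolic distance of [Phi h z] and [z]. *)
Lemma orbit_increment (Phi : R -> C -> C) (z : C) (a h : R) :
  disc_semigroup Phi -> unit_disc z -> 0 <= a -> 0 <= h ->
  Cmod (Phi (a + h) z - Phi a z) * (1 - Cmod z) <= 2 * Cmod (Phi h z - z).
Proof.
  intros HP Hz Ha Hh. pose proof (ds_self _ HP h z Hh Hz) as Hhz.
  rewrite <- (ds_comp _ HP a h z Ha Hh Hz).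
  pose proof (Schwarz_Pick_disc (Phi a) z (Phi h z) (fun w => ds_diff _ HP a w Ha)
                (fun w => ds_self _ HP a w Ha) Hz Hhz) as S.
  set (u := Phi a z) in *. set (v := Phi a (Phi h z)) in *.
  assert (Hu : unit_disc u) by (apply (ds_self _ HP a z Ha Hz)).
  assert (Hv : unit_disc v) by (apply (ds_self _ HP a _ Ha Hhz)).
  unfold unit_disc in *.
  pose proof (Cmod_ge_0 z). pose proof (Cmod_ge_0 (Phi h z)).
  pose proof (Cmod_ge_0 u). pose proof (Cmod_ge_0 v).
  assert (A : 1 - Cmod z <= Cmod (1 - Cconj z * Phi h z)).
  { pose proof (Cmod_triangle_inv 1 (Cconj z * Phi h z)) as T.
    rewrite Cmod_mult, Cmod_conj, Cmod_1 in T. nra. }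
  assert (B : Cmod (1 - Cconj u * v) <= 2).
  { eapply Rle_trans; [apply Cmod_triangle_sub|]. rewrite Cmod_mult, Cmod_conj, Cmod_1. nra. }
  pose proof (Cmod_ge_0 (v - u)). pose proof (Cmod_ge_0 (Phi h z - z)).
  apply Rle_trans with (Cmod (v - u) * Cmod (1 - Cconj z * Phi h z)).
  - apply Rmult_le_compat_l; assumption.
  - eapply Rle_trans; [exact S|]. nra.
Qed.

Lemma orbit_uniformly_continuous (Phi : R -> C -> C) (z : C) (eps : R) :
  disc_semigroup Phi -> unit_disc z -> 0 < eps ->
  exists delta, 0 < delta /\ forall a b, 0 <= a -> 0 <= b -> Rabs (b - a) < delta ->
    Cmod (Phi b z - Phi a z) < eps.
Proof.
  intros HP Hz Heps. unfold unit_disc in Hz.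
  destruct (ds_cont _ HP z (eps * (1 - Cmod z) / 2) Hz) as [d [Hd Hw]].
  { apply Rdiv_lt_0_compat; [apply Rmult_lt_0_compat|]; lra. }
  assert (Main : forall a h, 0 <= a -> 0 <= h < d -> Cmod (Phi (a + h) z - Phi a z) < eps).
  { intros a h Ha Hh. pose proof (orbit_increment Phi z a h HP Hz Ha (proj1 Hh)) as I.
    specialize (Hw h Hh). apply Rmult_lt_reg_r with (1 - Cmod z); lra. }
  exists d. split; [exact Hd|]. intros a b Ha Hb H. apply Rabs_lt_between in H.
  destruct (Rle_dec a b) as [L|L].
  - replace b with (a + (b - a)) by ring. apply Main; lra.
  - rewrite Cmod_sub_sym. replace a with (b + (a - b)) by ring. apply Main; lra.
Qed.

Lemma orbit_compact (Phi : R -> C -> C) (z : C) (t : R) :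
  disc_semigroup Phi -> unit_disc z -> 0 <= t ->
  exists d, 0 < d /\ forall r, 0 <= r <= t -> Cmod (Phi r z) <= 1 - d.
Proof.
  intros HP Hz Ht.
  destruct (continuity_ab_maj (fun r => Cmod (Phi (Rabs r) z)) 0 t Ht) as [m [Hm Hm0]].
  - intros c Hc. apply limit1_imp with (D := fun _ => True); [intros; exact I|].
    intros eps Heps.
    destruct (orbit_uniformly_continuous Phi z eps HP Hz Heps) as [d [Hd Hw]].
    exists d. split; [exact Hd|]. intros x [_ Hx]. simpl in *. unfold R_dist in *.
    assert (A : Cmod (Phi (Rabs x) z - Phi (Rabs c) z) < eps).
    { apply Hw; try apply Rabs_pos. eapply Rle_lt_trans; [apply Rabs_triang_inv2|exact Hx]. }
    pose proof (Cmod_triangle_inv (Phi (Rabs x) z) (Phi (Rabs c) z)).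
    pose proof (Cmod_triangle_inv (Phi (Rabs c) z) (Phi (Rabs x) z)) as B.
    rewrite (Cmod_sub_sym (Phi (Rabs c) z)) in B. apply Rabs_lt_between. lra.
  - exists (1 - Cmod (Phi (Rabs m) z)). pose proof (ds_self _ HP (Rabs m) z (Rabs_pos m) Hz) as A.
    unfold unit_disc in A. split; [lra|]. intros r Hr. specialize (Hm r Hr). simpl in Hm.
    rewrite (Rabs_pos_eq r) in Hm by lra. lra.
Qed.

(** * The Denjoy-Wolff point *)

Lemma Rle_div_r_intro (a b c : R) : 0 < c -> a * c <= b -> a <= b / c.
Proof. intros Hc H. apply Rle_div_r; assumption. Qed.

Definition pseudo_dist (a b : C) : R := Cmod (b - a) / Cmod (1 - Cconj a * b).

Lemma pseudo_denom_pos (a b : C) :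
  Cmod a <= 1 -> unit_disc b -> 0 < Cmod (1 - Cconj a * b).
Proof. intros Ha Hb. apply Cmod_gt_0, one_minus_neq_0, Cmod_conj_mult_lt_1; assumption. Qed.

Lemma pseudo_dist_Schwarz_Pick (f : C -> C) (a b : C) :
  (forall z, unit_disc z -> cdiff f z) ->
  (forall z, unit_disc z -> unit_disc (f z)) ->
  unit_disc a -> unit_disc b -> pseudo_dist (f a) (f b) <= pseudo_dist a b.
Proof.
  intros Df Hf Ha Hb. pose proof (Schwarz_Pick_disc f a b Df Hf Ha Hb) as S. unfold pseudo_dist.
  pose proof (pseudo_denom_pos a b (Rlt_le _ _ Ha) Hb) as P1.
  pose proof (pseudo_denom_pos (f a) (f b) (Rlt_le _ _ (Hf a Ha)) (Hf b Hb)) as P2.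
  apply Rle_div_l; [exact P2|].
  replace (Cmod (b - a) / Cmod (1 - Cconj a * b) * Cmod (1 - Cconj (f a) * f b))
    with (Cmod (b - a) * Cmod (1 - Cconj (f a) * f b) / Cmod (1 - Cconj a * b)) by (field; lra).
  apply Rle_div_r; [exact P1|exact S].
Qed.

Lemma one_minus_scaled (c : C) (r : R) : 0 < r < 1 -> Cmod c <= 1 ->
  (1 + r * r) * Cmod (1 - c) <= 2 * Cmod (1 - r * r * c).
Proof.
  intros Hr Hc. pose proof (Cmod_ge_0 c) as P. pose proof (Cmod_sqr c) as S.
  pose proof (Rabs_fst_le_Cmod c) as A. apply Rabs_le_between in A.
  apply Rsqr_le_le; [pose proof (Cmod_ge_0 (1 - r * r * c)); lra|].
  replace ((1 + r * r) * Cmod (1 - c) * ((1 + r * r) * Cmod (1 - c)))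
    with ((1 + r * r) * (1 + r * r) * (Cmod (1 - c) * Cmod (1 - c))) by ring.
  replace (2 * Cmod (1 - r * r * c) * (2 * Cmod (1 - r * r * c)))
    with (4 * (Cmod (1 - r * r * c) * Cmod (1 - r * r * c))) by ring.
  rewrite !Cmod_sqr. set (q := Cmod c) in *. destruct c as [x y]. simpl in *.
  set (k := r * r). assert (Hk : 0 < k < 1) by (unfold k; nra).
  assert (E : 4 * (1 - 2 * k * x + k * k * (q * q)) - (1 + k) * (1 + k) * (1 - 2 * x + q * q)
     = (1 - k) * (2 * (x + q) * (1 - k) + (1 - q) * (3 + k + q * (1 + 3 * k)))) by ring.
  assert (0 <= (1 - k) * (2 * (x + q) * (1 - k) + (1 - q) * (3 + k + q * (1 + 3 * k)))).
  { apply Rmult_le_pos; [lra|]. apply Rplus_le_le_0_compat.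
    - repeat apply Rmult_le_pos; lra.
    - assert (0 <= q * (1 + 3 * k)) by (apply Rmult_le_pos; lra). apply Rmult_le_pos; lra. }
  rewrite <- E in H. rewrite S in H. lra.
Qed.

Lemma pseudo_dist_scaled (u v : C) (r : R) : 0 < r < 1 -> unit_disc u -> unit_disc v ->
  pseudo_dist (r * u) (r * v) <= 2 * r / (1 + r * r) * pseudo_dist u v.
Proof.
  intros Hr Hu Hv. unfold pseudo_dist.
  assert (Hc : Cmod (Cconj u * v) <= 1) by (left; apply Cmod_conj_mult_lt_1; [left; exact Hu|exact Hv]).
  pose proof (one_minus_scaled _ r Hr Hc) as A.
  pose proof (pseudo_denom_pos u v (Rlt_le _ _ Hu) Hv) as P1.
  replace (1 - Cconj (r * u) * (r * v))%C with (1 - r * r * (Cconj u * v))%C.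
  2:{ rewrite Cmult_conj. replace (Cconj r) with (RtoC r) by (unfold Cconj, RtoC; simpl; f_equal; ring). ring. }
  replace (r * v - r * u)%C with (r * (v - u))%C by ring.
  rewrite Cmod_mult, Cmod_real_nonneg by lra.
  assert (P2 : 0 < Cmod (1 - r * r * (Cconj u * v))).
  { assert (0 < (1 + r * r) * Cmod (1 - Cconj u * v)) by (apply Rmult_lt_0_compat; nra). lra. }
  apply Rle_div_l; [exact P2|].
  replace (2 * r / (1 + r * r) * (Cmod (v - u) / Cmod (1 - Cconj u * v)) * Cmod (1 - r * r * (Cconj u * v)))
    with (r * Cmod (v - u) * (2 * Cmod (1 - r * r * (Cconj u * v))) / ((1 + r * r) * Cmod (1 - Cconj u * v)))
    by (field; split; nra).
  apply Rle_div_r_intro; [apply Rmult_lt_0_compat; nra|].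
  apply Rmult_le_compat_l; [|exact A]. apply Rmult_le_pos; [lra|apply Cmod_ge_0].
Qed.

(** [r * f] is a strict contraction of the pseudohyperbolic distance: Picard
    iteration yields almost fixed points in a compact part of the disc. *)
Lemma scaled_fixed_point (f : C -> C) (r : R) :
  (forall z, unit_disc z -> cdiff f z) ->
  (forall z, unit_disc z -> unit_disc (f z)) -> 0 < r < 1 ->
  exists tau, unit_disc tau /\ (r * f tau)%C = tau.
Proof.
  intros Df Hf Hr.
  set (F := fun z => (r * f z)%C).
  assert (HF : forall z, unit_disc z -> Cmod (F z) <= r).
  { intros z Hz. unfold F. rewrite Cmod_mult, Cmod_real_nonneg by lra.
    specialize (Hf z Hz). unfold unit_disc in Hf. pose proof (Cmod_ge_0 (f z)). nra. }
  set (u := fix u n := match n with O => RtoC 0 | S n => F (u n) end).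
  assert (Hu : forall n, Cmod (u n) <= r).
  { induction n; simpl; [rewrite Cmod_0; lra|]. apply HF. unfold unit_disc. lra. }
  assert (Hud : forall n, unit_disc (u n)) by (intro n; specialize (Hu n); unfold unit_disc; lra).
  set (kap := 2 * r / (1 + r * r)).
  assert (Hkap : 0 <= kap < 1).
  { unfold kap. split; [apply Rlt_le, Rdiv_lt_0_compat; nra|]. apply Rlt_div_l; nra. }
  assert (Hd : forall n, pseudo_dist (u n) (u (S n)) <= 2 * kap ^ n).
  { induction n.
    - simpl. unfold pseudo_dist.
      replace (1 - Cconj 0 * F 0)%C with (RtoC 1).
      2:{ replace (Cconj 0) with (RtoC 0) by (unfold Cconj, RtoC; simpl; f_equal; ring). ring. }
      replace (F 0 - 0)%C with (F 0) by ring. rewrite Cmod_1. pose proof (HF 0 disc_0). lra.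
    - change (u (S (S n))) with (r * f (u (S n)))%C. change (u (S n)) with (r * f (u n))%C at 1.
      eapply Rle_trans; [apply pseudo_dist_scaled; auto|]. fold kap.
      replace (2 * kap ^ S n) with (kap * (2 * kap ^ n)) by (simpl; ring).
      apply Rmult_le_compat_l; [lra|]. eapply Rle_trans; [|exact IHn].
      apply pseudo_dist_Schwarz_Pick; auto. }
  assert (He : forall n, Cmod (F (u n) - u n) <= 4 * kap ^ n).
  { intro n. specialize (Hd n). change (u (S n)) with (F (u n)) in Hd. unfold pseudo_dist in Hd.
    pose proof (Hud (S n)) as A. change (u (S n)) with (F (u n)) in A.
    pose proof (pseudo_denom_pos (u n) (F (u n)) (Rlt_le _ _ (Hud n)) A) as P.
    apply (proj1 (Rle_div_l _ _ _ P)) in Hd.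
    assert (B : Cmod (1 - Cconj (u n) * F (u n)) <= 2).
    { eapply Rle_trans; [apply Cmod_triangle_sub|].
      pose proof (Cmod_conj_mult_lt_1 (u n) (F (u n)) (Rlt_le _ _ (Hud n)) A). rewrite Cmod_1. lra. }
    assert (0 <= kap ^ n) by (apply pow_le; lra). nra. }
  destruct (C_bounded_cluster u r Hu) as [tau Htau].
  assert (Ht : Cmod tau <= r).
  { apply le_epsilon. intros eps Heps. destruct (Htau eps O Heps) as [n [_ Hn]].
    rewrite Cmod_sub_sym in Hn. pose proof (Cmod_triangle_inv tau (u n)). specialize (Hu n). lra. }
  assert (Htd : unit_disc tau) by (unfold unit_disc; lra).
  exists tau. split; [exact Htd|]. apply Ceq_minus, Cmod_le_eps_0. intros eps Heps.
  assert (CF : ccont F tau).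
  { apply cdiff_ccont. unfold F. apply cdiff_mult; [apply cdiff_const|apply Df, Htd]. }
  destruct (CF (eps / 4)) as [d [Hd' Hw]]; [lra|].
  destruct (pow_lt_1_zero kap) with (y := eps / 16) as [N HN].
  { rewrite Rabs_pos_eq; lra. }
  { lra. }
  destruct (Htau (Rmin d (eps / 4)) N) as [n [Hn Hnt]].
  { apply Rmin_glb_lt; lra. }
  assert (H1 : Cmod (F (u n) - F tau) < eps / 4).
  { apply Hw. eapply Rlt_le_trans; [exact Hnt|apply Rmin_l]. }
  assert (H2 : Cmod (u n - tau) < eps / 4) by (eapply Rlt_le_trans; [exact Hnt|apply Rmin_r]).
  specialize (HN n Hn). rewrite Rabs_pos_eq in HN by (apply pow_le; lra).
  specialize (He n). fold (F tau).
  pose proof (Cmod_sub_trans (F tau) (F (u n)) tau) as T1. rewrite (Cmod_sub_sym (F tau) (F (u n))) in T1.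
  pose proof (Cmod_sub_trans (F (u n)) (u n) tau). lra.
Qed.

(** For [Cmod tau < 1] a decreasing function of the pseudohyperbolic distance
    to [tau], for [Cmod tau = 1] the Poisson kernel with pole [tau]. *)
Definition horo (tau z : C) : R :=
  (1 - Cmod z * Cmod z) / (Cmod (1 - Cconj tau * z) * Cmod (1 - Cconj tau * z)).

Lemma horo_pos (tau z : C) : Cmod tau <= 1 -> unit_disc z -> 0 < horo tau z.
Proof.
  intros Ht Hz. pose proof (pseudo_denom_pos tau z Ht Hz). unfold unit_disc in Hz.
  pose proof (Cmod_ge_0 z). apply Rdiv_lt_0_compat; nra.
Qed.

(** Schwarz-Pick at the fixed point, rewritten by the identity of Pick. *)
Lemma horo_fixed_point (F : C -> C) (tau z : C) :
  (forall z, unit_disc z -> cdiff F z) ->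
  (forall z, unit_disc z -> unit_disc (F z)) ->
  unit_disc tau -> F tau = tau -> unit_disc z -> horo tau z <= horo tau (F z).
Proof.
  intros DF HF Ht Hfix Hz.
  pose proof (Schwarz_Pick_disc F tau z DF HF Ht Hz) as S. rewrite Hfix in S.
  pose proof (pseudo_denom_pos tau z (Rlt_le _ _ Ht) Hz) as P1.
  pose proof (pseudo_denom_pos tau (F z) (Rlt_le _ _ Ht) (HF z Hz)) as P2.
  pose proof (Pick_identity_disc tau z) as I1. pose proof (Pick_identity_disc tau (F z)) as I2.
  pose proof (Cmod_ge_0 (F z - tau)). pose proof (Cmod_ge_0 (z - tau)). pose proof (Cmod_ge_0 tau).
  unfold horo.
  set (A := Cmod (1 - Cconj tau * z)) in *. set (B := Cmod (1 - Cconj tau * F z)) in *.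
  set (m := Cmod (z - tau)) in *. set (n := Cmod (F z - tau)) in *.
  assert (S2 : (n * A) * (n * A) <= (m * B) * (m * B)) by (apply Rmult_le_compat; nra).
  unfold unit_disc in Ht. assert (0 < 1 - Cmod tau * Cmod tau) by nra.
  apply Rle_div_l; [nra|].
  replace ((1 - Cmod (F z) * Cmod (F z)) / (B * B) * (A * A))
    with ((1 - Cmod (F z) * Cmod (F z)) * (A * A) / (B * B)) by (field; lra).
  apply Rle_div_r; [nra|].
  apply Rmult_le_reg_l with (1 - Cmod tau * Cmod tau); [assumption|].
  replace ((1 - Cmod tau * Cmod tau) * ((1 - Cmod z * Cmod z) * (B * B)))
    with ((A * A - m * m) * (B * B)) by (rewrite I1; ring).
  replace ((1 - Cmod tau * Cmod tau) * ((1 - Cmod (F z) * Cmod (F z)) * (A * A)))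
    with ((B * B - n * n) * (A * A)) by (rewrite I2; ring).
  lra.
Qed.

(** The loss when the values of [r * f] are replaced by those of [f], at points that
    stay at distance [d] from the unit circle. *)
Lemma horo_scaled (tau w : C) (r d : R) :
  Cmod tau <= 1 -> 0 < d -> Cmod w <= 1 - d -> 0 < r < 1 -> 4 * (1 - r) <= d ->
  horo tau (r * w) <= horo tau w * (1 + 8 * ((1 - r) / d)).
Proof.
  intros Ht Hd Hw Hr Hrd. set (eta := (1 - r) / d).
  assert (Ee : 1 - r = eta * d) by (unfold eta; field; lra).
  assert (He : 0 < eta <= 1 / 4).
  { unfold eta. split; [apply Rdiv_lt_0_compat; lra|apply Rle_div_l; lra]. }
  pose proof (Cmod_ge_0 w) as Pw.
  assert (Hwd : unit_disc w) by (unfold unit_disc; lra).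
  assert (Hrw : unit_disc (r * w)).
  { unfold unit_disc. rewrite Cmod_mult, Cmod_real_nonneg by lra. nra. }
  pose proof (pseudo_denom_pos tau w Ht Hwd) as P1. pose proof (pseudo_denom_pos tau _ Ht Hrw) as P2.
  unfold horo. rewrite Cmod_mult, Cmod_real_nonneg by lra.
  set (A := Cmod (1 - Cconj tau * w)) in *. set (B := Cmod (1 - Cconj tau * (r * w))) in *.
  assert (HA : d <= A).
  { pose proof (Cmod_triangle_inv 1 (Cconj tau * w)) as T. fold A in T.
    rewrite Cmod_1, Cmod_mult, Cmod_conj in T. pose proof (Cmod_ge_0 tau). nra. }
  assert (HB : A * (1 - eta) <= B).
  { pose proof (Cmod_triangle_inv (1 - Cconj tau * w) (- (RtoC (1 - r) * (Cconj tau * w)))) as T.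
    rewrite Cmod_opp, !Cmod_mult, Cmod_conj, Cmod_real_nonneg in T by lra.
    replace (1 - Cconj tau * w - - (RtoC (1 - r) * (Cconj tau * w)))%C
      with (1 - Cconj tau * (r * w))%C in T by (rewrite RtoC_minus; ring).
    fold A B in T. pose proof (Cmod_ge_0 tau).
    assert (Cmod tau * Cmod w <= 1) by nra.
    assert ((1 - r) * (Cmod tau * Cmod w) <= (1 - r) * 1) by (apply Rmult_le_compat_l; lra).
    assert (eta * d <= eta * A) by (apply Rmult_le_compat_l; lra). lra. }
  set (q := Cmod w) in *.
  assert (Hnum : 1 - r * q * (r * q) <= (1 - q * q) * (1 + 2 * eta)).
  { assert (d <= 1 - q * q) by nra.
    assert (eta * d <= eta * (1 - q * q)) by (apply Rmult_le_compat_l; lra).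
    assert (q * q <= 1) by nra.
    assert ((1 - r) * ((1 + r) * (q * q)) <= (1 - r) * 2) by (apply Rmult_le_compat_l; nra). lra. }
  apply Rle_div_l; [nra|].
  replace ((1 - q * q) / (A * A) * (1 + 8 * eta) * (B * B))
    with ((1 - q * q) * ((1 + 8 * eta) * (B * B)) / (A * A)) by (field; lra).
  apply Rle_div_r; [nra|].
  assert (HB2 : A * (1 - eta) * (A * (1 - eta)) <= B * B).
  { apply Rmult_le_compat; nra. }
  apply Rle_trans with ((1 - q * q) * (1 + 2 * eta) * (A * A)).
  { apply Rmult_le_compat_r; [nra|exact Hnum]. }
  rewrite Rmult_assoc. apply Rmult_le_compat_l; [nra|].
  apply Rle_trans with ((1 + 8 * eta) * (A * (1 - eta) * (A * (1 - eta)))).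
  2:{ apply Rmult_le_compat_l; lra. }
  replace ((1 + 8 * eta) * (A * (1 - eta) * (A * (1 - eta))))
    with ((1 + 8 * eta) * ((1 - eta) * (1 - eta)) * (A * A)) by ring.
  apply Rmult_le_compat_r; [nra|].
  assert (0 <= eta * (4 - 15 * eta + 8 * (eta * eta))) by (apply Rmult_le_pos; nra). nra.
Qed.

Lemma disc_semigroup_iter (Phi : R -> C -> C) (z : C) (s : R) (k : nat) :
  disc_semigroup Phi -> unit_disc z -> 0 <= s ->
  Phi (INR (S k) * s) z = Phi s (Phi (INR k * s) z).
Proof.
  intros HP Hz Hs. rewrite (ds_comp _ HP) by first [assumption | apply Rmult_le_pos; [apply pos_INR|lra]].
  f_equal. rewrite S_INR. ring.
Qed.

Lemma ds_0 (Phi : R -> C -> C) (z : C) : disc_semigroup Phi -> unit_disc z -> Phi 0 z = z.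
Proof.
  intros HP Hz. apply Ceq_minus, Cmod_le_eps_0. intros eps Heps.
  destruct (ds_cont _ HP z eps Hz Heps) as [d [Hd H]]. left. apply H. lra.
Qed.

(** Each of the [k] steps loses a factor [1 + 8 s^2 / d] at most, and [k * s <= t]. *)
Lemma horo_almost_fixed_point (Phi : R -> C -> C) (tau z : C) (s t d : R) (k : nat) :
  disc_semigroup Phi -> unit_disc z -> 0 < s < 1 -> unit_disc tau ->
  (RtoC (1 - s * s) * Phi s tau)%C = tau ->
  (forall r, 0 <= r <= t -> Cmod (Phi r z) <= 1 - d) -> 0 < d -> 4 * (s * s) <= d ->
  INR k * s <= t ->
  horo tau z <= horo tau (Phi (INR k * s) z) * exp (8 * s * t / d).
Proof.
  intros HP Hz Hs Ht Hfix Hd Hd0 Hsd Hk.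
  assert (Hs0 : 0 <= s) by lra.
  assert (Hdisc : forall j : nat, unit_disc (Phi (INR j * s) z)).
  { intro j. apply (ds_self _ HP); [|exact Hz]. apply Rmult_le_pos; [apply pos_INR|lra]. }
  assert (HF : forall w, unit_disc w -> unit_disc (RtoC (1 - s * s) * Phi s w)).
  { intros w Hw. pose proof (ds_self _ HP s w Hs0 Hw) as A. unfold unit_disc in *.
    rewrite Cmod_mult, Cmod_real_nonneg by nra. pose proof (Cmod_ge_0 (Phi s w)). nra. }
  set (eta := s * s / d). assert (Heta : 0 < eta) by (apply Rdiv_lt_0_compat; nra).
  assert (Ind : forall j, (j <= k)%nat ->
            horo tau z <= horo tau (Phi (INR j * s) z) * exp (INR j * (8 * eta))).
  { induction j as [|j IH]; intro Hj.
    - simpl. rewrite !Rmult_0_l, exp_0, (ds_0 Phi z HP Hz). lra.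
    - eapply Rle_trans; [apply IH; lia|].
      rewrite disc_semigroup_iter by assumption. set (w := Phi (INR j * s) z).
      replace (INR (S j) * (8 * eta)) with (8 * eta + INR j * (8 * eta)) by (rewrite S_INR; ring).
      rewrite exp_plus, <- (Rmult_assoc _ (exp (8 * eta))). apply Rmult_le_compat_r; [left; apply exp_pos|].
      assert (Hw : unit_disc w) by apply Hdisc.
      eapply Rle_trans.
      { apply (horo_fixed_point (fun w => RtoC (1 - s * s) * Phi s w)%C tau w).
        - intros v Hv. apply cdiff_mult; [apply cdiff_const|apply (ds_diff _ HP); assumption].
        - exact HF.
        - exact Ht.
        - exact Hfix.
        - exact Hw. }
      cbv beta. assert (Hpw : Cmod (Phi s w) <= 1 - d).
      { unfold w. rewrite <- disc_semigroup_iter by assumption. apply Hd. split.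
        - apply Rmult_le_pos; [apply pos_INR|lra].
        - eapply Rle_trans; [|exact Hk]. apply Rmult_le_compat_r; [lra|]. apply le_INR, Hj. }
      eapply Rle_trans; [apply horo_scaled with (d := d)|].
      + left; exact Ht.
      + exact Hd0.
      + exact Hpw.
      + nra.
      + lra.
      + replace ((1 - (1 - s * s)) / d) with eta by (unfold eta; f_equal; ring).
        apply Rmult_le_compat_l.
        * left. apply horo_pos; [left; exact Ht|apply (ds_self _ HP); assumption].
        * left. apply exp_ineq1. lra. }
  eapply Rle_trans; [apply (Ind k (Nat.le_refl k))|].
  apply Rmult_le_compat_l; [left; apply horo_pos; [left; exact Ht|apply Hdisc]|].
  assert (A : INR k * (8 * eta) <= 8 * s * t / d).
  { unfold eta. replace (INR k * (8 * (s * s / d))) with (8 * s * (INR k * s) / d) by (field; lra).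
    unfold Rdiv. apply Rmult_le_compat_r; [left; apply Rinv_0_lt_compat, Hd0|].
    apply Rmult_le_compat_l; lra. }
  destruct A as [A|A]; [left; apply exp_increasing, A|rewrite A; lra].
Qed.

Definition C_lim (u : nat -> C) (l : C) : Prop := is_lim_seq (fun n => Cmod (u n - l)) 0.

Lemma C_lim_Cmod (u : nat -> C) (l : C) : C_lim u l -> is_lim_seq (fun n => Cmod (u n)) (Cmod l).
Proof.
  intro H. apply is_lim_seq_le_le with (u := fun n => Cmod l - Cmod (u n - l))
    (w := fun n => Cmod l + Cmod (u n - l)).
  - intro n. pose proof (Cmod_triangle_inv (u n) l). pose proof (Cmod_triangle_inv l (u n)) as B.
    rewrite (Cmod_sub_sym l) in B. lra.
  - replace (Finite (Cmod l)) with (Finite (Cmod l - 0)) by (f_equal; ring).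
    apply is_lim_seq_minus'; [apply is_lim_seq_const|exact H].
  - replace (Finite (Cmod l)) with (Finite (Cmod l + 0)) by (f_equal; ring).
    apply is_lim_seq_plus'; [apply is_lim_seq_const|exact H].
Qed.

Lemma C_lim_one_minus_conj_mult (u v : nat -> C) (a b : C) :
  C_lim u a -> C_lim v b -> C_lim (fun n => 1 - Cconj (u n) * v n)%C (1 - Cconj a * b)%C.
Proof.
  intros Hu Hv. unfold C_lim.
  apply is_lim_seq_le_le with (u := fun _ => 0)
    (w := fun n => Cmod (u n - a) * Cmod (v n) + Cmod a * Cmod (v n - b)).
  - intro n. split; [apply Cmod_ge_0|].
    replace (1 - Cconj (u n) * v n - (1 - Cconj a * b))%C
      with (- (Cconj (u n - a) * v n + Cconj a * (v n - b)))%C by (rewrite Cminus_conj; ring).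
    rewrite Cmod_opp. eapply Rle_trans; [apply Cmod_triangle|].
    rewrite !Cmod_mult, !Cmod_conj. lra.
  - apply is_lim_seq_const.
  - replace 0 with (0 * Cmod b + Cmod a * 0) by ring.
    apply is_lim_seq_plus'.
    + apply is_lim_seq_mult'; [exact Hu|apply C_lim_Cmod, Hv].
    + apply is_lim_seq_mult'; [apply is_lim_seq_const|exact Hv].
Qed.

Lemma C_bounded_subsequence (u : nat -> C) (M : R) :
  (forall n, Cmod (u n) <= M) ->
  exists p phi, (forall n, (n <= phi n)%nat) /\ C_lim (fun n => u (phi n)) p.
Proof.
  intro H. destruct (C_bounded_cluster u M H) as [p Hp].
  destruct (functional_choice (fun n k => (n <= k)%nat /\ Cmod (u k - p) < / (INR n + 1))) as [phi Hphi].
  { intro n. apply Hp, Rinv_0_lt_compat. pose proof (pos_INR n). lra. }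
  exists p, phi. split; [apply Hphi|]. apply is_lim_seq_spec. intros eps.
  destruct (archimed_cor1 eps (cond_pos eps)) as [N [HN HN0]]. exists N. intros n Hn.
  rewrite Rminus_0_r, Rabs_pos_eq by apply Cmod_ge_0.
  destruct (Hphi n) as [_ A]. eapply Rlt_trans; [exact A|]. eapply Rle_lt_trans; [|exact HN].
  apply Rinv_le_contravar; [apply lt_0_INR, HN0|]. apply le_INR in Hn. lra.
Qed.

(** The maps [(1 - s^2) Phi s] have fixed points [tau_s] in the disc. As [s] tends
    to 0 the product of the factors by which [horo tau_s] may decrease along an
    orbit up to a given time tends to 1, since there are about [t / s] of them. A
    limit of the [tau_s] therefore serves all times at once. *)
Lemma Denjoy_Wolff (Phi : R -> C -> C) :
  disc_semigroup Phi ->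
  exists tau, Cmod tau <= 1 /\
    forall t z, 0 <= t -> unit_disc z -> horo tau z <= horo tau (Phi t z).
Proof.
  intro HP. set (s := fun n : nat => / (INR n + 2)).
  assert (Hs : forall n, 0 < s n < 1).
  { intro n. unfold s. pose proof (pos_INR n). split; [apply Rinv_0_lt_compat; lra|].
    rewrite <- Rinv_1. apply Rinv_lt_contravar; lra. }
  destruct (functional_choice (fun n tau => unit_disc tau /\
             (RtoC (1 - s n * s n) * Phi (s n) tau)%C = tau)) as [T HT].
  { intro n. specialize (Hs n). apply scaled_fixed_point; [| |nra].
    - intros z Hz. apply (ds_diff _ HP); [lra|exact Hz].
    - intros z Hz. apply (ds_self _ HP); [lra|exact Hz]. }
  destruct (C_bounded_subsequence T 1) as [tau [phi [Hphi Hlim]]].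
  { intro n. left. apply HT. }
  assert (Htau : Cmod tau <= 1).
  { apply (is_lim_seq_le (fun n => Cmod (T (phi n))) (fun _ => 1) (Cmod tau) 1).
    - intro n. left. apply HT.
    - apply C_lim_Cmod, Hlim.
    - apply is_lim_seq_const. }
  exists tau. split; [exact Htau|]. intros t z Ht Hz.
  assert (Ls : is_lim_seq (fun n => s (phi n)) 0).
  { apply is_lim_seq_spec. intros eps.
    destruct (archimed_cor1 eps (cond_pos eps)) as [N [HN HN0]]. exists N. intros n Hn.
    rewrite Rminus_0_r, Rabs_pos_eq by (apply Rlt_le, Hs). eapply Rle_lt_trans; [|exact HN].
    unfold s. apply Rinv_le_contravar; [apply lt_0_INR, HN0|].
    assert (INR N <= INR (phi n)) by (apply le_INR; specialize (Hphi n); lia). lra. }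
  destruct (orbit_compact Phi z t HP Hz Ht) as [d [Hd Horb]].
  destruct (functional_choice (fun n k => INR k * s (phi n) <= t < INR k * s (phi n) + s (phi n))) as [kk Hk].
  { intro n. specialize (Hs (phi n)).
    destruct (nfloor_ex (t / s (phi n))) as [k [Hk1 Hk2]].
    { apply Rmult_le_pos; [exact Ht|]. left. apply Rinv_0_lt_compat. lra. }
    exists k. split; [apply Rle_div_r; lra|]. apply (Rlt_div_l t) in Hk2; lra. }
  set (w := fun n => Phi (INR (kk n) * s (phi n)) z).
  assert (Lw : C_lim w (Phi t z)).
  { apply is_lim_seq_spec. intros eps.
    destruct (orbit_uniformly_continuous Phi z eps HP Hz (cond_pos eps)) as [dd [Hdd Hw]].
    apply is_lim_seq_spec in Ls. destruct (Ls (mkposreal dd Hdd)) as [N HN]. exists N. intros n Hn.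
    rewrite Rminus_0_r, Rabs_pos_eq by apply Cmod_ge_0. unfold w.
    specialize (HN n Hn). simpl in HN. specialize (Hk n). specialize (Hs (phi n)).
    rewrite Rminus_0_r, Rabs_pos_eq in HN by lra.
    apply Hw; [exact Ht|apply Rmult_le_pos; [apply pos_INR|lra]|].
    apply Rabs_lt_between. lra. }
  assert (Lc : forall c, C_lim (fun _ => c) c).
  { intro c. apply is_lim_seq_ext with (u := fun _ => 0); [|apply is_lim_seq_const].
    intros _. replace (c - c)%C with (RtoC 0) by ring. symmetry. apply Cmod_0. }
  set (a := fun n => T (phi n)).
  assert (Ineq : forall n, 4 * (s (phi n) * s (phi n)) <= d ->
     (1 - Cmod z * Cmod z) * (Cmod (1 - Cconj (a n) * w n) * Cmod (1 - Cconj (a n) * w n))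
     <= (1 - Cmod (w n) * Cmod (w n)) * (Cmod (1 - Cconj (a n) * z) * Cmod (1 - Cconj (a n) * z))
        * exp (8 * s (phi n) * t / d)).
  { intros n Hn. destruct (HT (phi n)) as [Ha Hfix]. specialize (Hk n).
    pose proof (horo_almost_fixed_point Phi (a n) z (s (phi n)) t d (kk n) HP Hz (Hs (phi n)) Ha
                  Hfix Horb Hd Hn (proj1 Hk)) as I.
    fold (w n) in I. unfold horo in I.
    assert (Hwn : unit_disc (w n)).
    { apply (ds_self _ HP); [|exact Hz]. specialize (Hs (phi n)).
      apply Rmult_le_pos; [apply pos_INR|lra]. }
    pose proof (pseudo_denom_pos (a n) z (Rlt_le _ _ Ha) Hz) as P1.
    pose proof (pseudo_denom_pos (a n) (w n) (Rlt_le _ _ Ha) Hwn) as P2.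
    set (A := Cmod (1 - Cconj (a n) * z)) in *. set (B := Cmod (1 - Cconj (a n) * w n)) in *.
    set (e := exp (8 * s (phi n) * t / d)) in *.
    apply (proj1 (Rle_div_l _ _ (A * A) ltac:(nra))) in I.
    replace ((1 - Cmod (w n) * Cmod (w n)) / (B * B) * e * (A * A))
      with ((1 - Cmod (w n) * Cmod (w n)) * (A * A) * e / (B * B)) in I by (field; lra).
    apply (proj2 (Rle_div_r _ _ (B * B) ltac:(nra))) in I. exact I. }
  assert (La := C_lim_Cmod _ _ (C_lim_one_minus_conj_mult a w _ _ Hlim Lw)).
  assert (Lz := C_lim_Cmod _ _ (C_lim_one_minus_conj_mult a _ _ _ Hlim (Lc z))).
  assert (Lwm := C_lim_Cmod _ _ Lw).
  assert (Le : is_lim_seq (fun n => exp (8 * s (phi n) * t / d)) 1).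
  { rewrite <- exp_0. apply is_lim_seq_continuous.
    - apply derivable_continuous_pt, derivable_pt_exp.
    - apply is_lim_seq_ext with (u := fun n => s (phi n) * (8 * t / d)); [intro n; field; lra|].
      replace 0 with (0 * (8 * t / d)) by ring.
      apply is_lim_seq_mult'; [exact Ls|apply is_lim_seq_const]. }
  assert (Ev : exists N, forall n, (N <= n)%nat -> 4 * (s (phi n) * s (phi n)) <= d).
  { apply is_lim_seq_spec in Ls. assert (Hd4 : 0 < d / 4) by lra.
    destruct (Ls (mkposreal _ Hd4)) as [N HN]. exists N. intros n Hn. specialize (HN n Hn). simpl in HN.
    specialize (Hs (phi n)). rewrite Rminus_0_r, Rabs_pos_eq in HN by lra. nra. }
  destruct Ev as [N HN].
  assert (Lim : (1 - Cmod z * Cmod z) * (Cmod (1 - Cconj tau * Phi t z) * Cmod (1 - Cconj tau * Phi t z))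
     <= (1 - Cmod (Phi t z) * Cmod (Phi t z)) * (Cmod (1 - Cconj tau * z) * Cmod (1 - Cconj tau * z)) * 1).
  { match goal with |- ?x <= ?y => change (Rbar_le (Finite x) (Finite y)) end.
    eapply is_lim_seq_le_loc; [exists N; intros n Hn; exact (Ineq n (HN n Hn))| |].
    - apply is_lim_seq_mult'; [apply is_lim_seq_const|]. apply is_lim_seq_mult'; exact La.
    - apply is_lim_seq_mult'; [|exact Le]. apply is_lim_seq_mult'.
      + apply is_lim_seq_minus'; [apply is_lim_seq_const|]. apply is_lim_seq_mult'; exact Lwm.
      + apply is_lim_seq_mult'; exact Lz. }
  rewrite Rmult_1_r in Lim.
  pose proof (pseudo_denom_pos tau z Htau Hz) as P1.
  pose proof (pseudo_denom_pos tau (Phi t z) Htau (ds_self _ HP t z Ht Hz)) as P2.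
  unfold horo. apply Rle_div_l; [nra|].
  match goal with |- _ <= ?x / ?y * ?u => replace (x / y * u) with (x * u / y) by (field; lra) end.
  apply Rle_div_r; [nra|exact Lim].
Qed.

(** * Bounds at a base point *)

Lemma rhp_1 : rhp 1.
Proof. unfold rhp. simpl. lra. Qed.

Lemma near_1_rhp (z : C) : Cmod (z - 1) <= 1 / 16 -> 15 / 16 <= fst z.
Proof.
  intro H. pose proof (Rabs_fst_le_Cmod (z - 1)) as A.
  apply Rle_trans with (2 := H) in A. apply Rabs_le_between in A. simpl in A. lra.
Qed.

(** Near 1 the Harnack inequalities make [U] almost constant, and the orbit is almost
    an arithmetic progression. *)
Lemma chain_near_1 (U : C -> C) (s : R) (n : nat) (zeta : nat -> C) :
  herglotz U -> 0 <= s -> zeta O = 1 ->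
  (forall k, (k <= n)%nat -> Cmod (zeta k - 1) <= 1 / 16) ->
  (forall k, (k < n)%nat ->
     Cmod (zeta (S k) - zeta k - s * U (zeta k)) <= s * Cmod (U (zeta k)) / 4 /\
     fst (zeta (S k)) - fst (zeta k) <= 2 * s * fst (U (zeta k))) ->
  INR n * s * Cmod (U 1) <= 1 /\
  fst (zeta n) - 1 <= 12 * (INR n * s) * fst (U 1).
Proof.
  intros HU Hs H0 Hnear Hstep.
  pose proof (Cmod_ge_0 (U 1)) as P. pose proof (proj2 HU 1 rhp_1) as Pr.
  set (u := Cmod (U 1)) in *.
  assert (Loc : forall k, (k <= n)%nat -> Cmod (U (zeta k) - U 1) <= u / 4 /\ fst (U (zeta k)) <= 6 * fst (U 1)).
  { intros k Hk. specialize (Hnear k Hk). pose proof (near_1_rhp _ Hnear) as Hx.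
    assert (Hr : rhp (zeta k)) by (unfold rhp; lra). split.
    - pose proof (herglotz_lipschitz U (zeta k) 1 HU Hr rhp_1) as L. simpl in L. fold u in L.
      specialize (L ltac:(lra)).
      assert (4 * Cmod (zeta k - 1) * u <= 4 * (1 / 16) * u) by (apply Rmult_le_compat_r; lra). lra.
    - pose proof (herglotz_Re_Harnack U 1 (zeta k) HU rhp_1 Hr) as A. change (fst (RtoC 1)) with 1 in A.
      assert (N : Cmod (1 + Cconj (zeta k)) <= 33 / 16).
      { replace (1 + Cconj (zeta k))%C with (2 + Cconj (zeta k - 1))%C.
        - eapply Rle_trans; [apply Cmod_triangle|]. rewrite Cmod_conj, Cmod_real_nonneg by lra. lra.
        - destruct (zeta k). unfold Cconj, Cplus, Cminus, Copp, RtoC. simpl. f_equal; ring. }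
      pose proof (Cmod_ge_0 (1 + Cconj (zeta k))). pose proof (proj2 HU _ Hr).
      set (N1 := Cmod (1 + Cconj (zeta k))) in *.
      assert (fst (U 1) * (N1 * N1) <= fst (U 1) * (33 / 16 * (33 / 16))).
      { apply Rmult_le_compat_l; [exact Pr|]. apply Rmult_le_compat; lra. }
      nra. }
  assert (Ind : forall k, (k <= n)%nat ->
     Cmod (zeta k - 1 - RtoC (INR k * s) * U 1) <= 9 / 16 * (INR k * s) * u /\
     fst (zeta k) - 1 <= 12 * (INR k * s) * fst (U 1)).
  { induction k as [|k IH]; intro Hk.
    - simpl INR. rewrite H0, Rmult_0_l. replace (1 - 1 - 0 * U 1)%C with (RtoC 0) by ring.
      rewrite Cmod_0. simpl. lra.
    - destruct (IH ltac:(lia)) as [I1 I2]. destruct (Hstep k ltac:(lia)) as [S1 S2].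
      destruct (Loc k ltac:(lia)) as [L1 L2]. rewrite S_INR. split.
      + replace (zeta (S k) - 1 - RtoC ((INR k + 1) * s) * U 1)%C
          with ((zeta k - 1 - RtoC (INR k * s) * U 1) + ((zeta (S k) - zeta k - s * U (zeta k))
                + s * (U (zeta k) - U 1)))%C by (rewrite !RtoC_mult, RtoC_plus; ring).
        eapply Rle_trans; [apply Cmod_triangle|].
        assert (A : Cmod (zeta (S k) - zeta k - s * U (zeta k) + s * (U (zeta k) - U 1)) <= 9 / 16 * s * u).
        { eapply Rle_trans; [apply Cmod_triangle|]. rewrite Cmod_mult, Cmod_real_nonneg by lra.
          pose proof (Cmod_triangle_inv (U (zeta k)) (U 1)) as T. fold u in T.
          assert (s * Cmod (U (zeta k)) <= s * (5 / 4 * u)) by (apply Rmult_le_compat_l; lra).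
          assert (s * Cmod (U (zeta k) - U 1) <= s * (u / 4)) by (apply Rmult_le_compat_l; lra). lra. }
        lra.
      + assert (2 * s * fst (U (zeta k)) <= 2 * s * (6 * fst (U 1))) by (apply Rmult_le_compat_l; lra).
        lra. }
  destruct (Ind n (Nat.le_refl n)) as [I1 I2]. split; [|exact I2].
  specialize (Hnear n (Nat.le_refl n)).
  pose proof (Cmod_triangle_inv (RtoC (INR n * s) * U 1) (zeta n - 1)) as T.
  rewrite (Cmod_sub_sym (RtoC (INR n * s) * U 1)%C), Cmod_mult, Cmod_real_nonneg in T
    by (apply Rmult_le_pos; [apply pos_INR|lra]).
  fold u in T. lra.
Qed.

(** [X t] stands for the progress of the orbit of the base point up to time [t]. The
    number of steps is chosen with [T / 2 <= n * s <= T], which makes the bounds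
    uniform in [s]. *)
Lemma base_point_bounds (U : R -> C -> C) (X : R -> R) (T : R) :
  (forall s, 0 < s -> herglotz (U s)) -> 0 < T ->
  (forall a b, 0 <= a -> a <= b -> b <= T -> X a <= X b) ->
  (forall s n, 0 < s -> INR n * s <= T -> exists zeta : nat -> C,
     zeta O = 1 /\ (forall k, (k <= n)%nat -> Cmod (zeta k - 1) <= 1 / 16) /\
     (forall k, (k < n)%nat ->
       Cmod (zeta (S k) - zeta k - s * U s (zeta k)) <= s * Cmod (U s (zeta k)) / 4 /\
       fst (zeta (S k)) - fst (zeta k) <= 2 * s * fst (U s (zeta k))) /\
     fst (zeta n) - 1 = X (INR n * s)) ->
  forall s, 0 < s <= T / 2 ->
    Cmod (U s 1) <= 2 / T /\ X (T / 2) <= 12 * T * fst (U s 1).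
Proof.
  intros HU HT HX Hchain s Hs.
  destruct (nfloor_ex (T / s)) as [n [Hn1 Hn2]].
  { apply Rlt_le, Rdiv_lt_0_compat; lra. }
  apply (Rle_div_r _ T) in Hn1; [|lra]. apply (Rlt_div_l T) in Hn2; [|lra].
  destruct (Hchain s n (proj1 Hs) Hn1) as [zeta [Z0 [Z1 [Z2 Z3]]]].
  destruct (chain_near_1 (U s) s n zeta (HU s (proj1 Hs)) ltac:(lra) Z0 Z1 Z2) as [C1 C2].
  pose proof (Cmod_ge_0 (U s 1)) as P. pose proof (proj2 (HU s (proj1 Hs)) 1 rhp_1) as Pr.
  assert (Hns : T / 2 <= INR n * s) by lra. split.
  - apply Rle_div_r_intro; [exact HT|].
    assert (T / 2 * Cmod (U s 1) <= INR n * s * Cmod (U s 1)) by (apply Rmult_le_compat_r; lra). lra.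
  - apply Rle_trans with (X (INR n * s)); [apply HX; lra|]. rewrite <- Z3.
    eapply Rle_trans; [exact C2|]. apply Rmult_le_compat_r; [exact Pr|]. lra.
Qed.

(** * Semigroups without fixed point in the disc *)

Lemma sqrt_bound_of_linear (x C1 t : R) : 0 <= C1 -> 0 < t <= 1 -> x <= C1 * t -> x <= C1 * sqrt t.
Proof.
  intros HC Ht H. eapply Rle_trans; [exact H|]. apply Rmult_le_compat_l; [exact HC|].
  pose proof (sqrt_sqrt t ltac:(lra)) as E. pose proof (sqrt_pos t).
  assert (sqrt t <= 1) by (rewrite <- sqrt_1; apply sqrt_le_1; lra). nra.
Qed.

Section BoundaryPoint.

Variable tau : C.
Hypothesis tau_unit : Cmod tau = 1.

(** The half-plane coordinate whose real part is [horo tau]: the semigroup moves points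
    to the right. *)
Definition to_rhp (z : C) : C := ((1 + Cconj tau * z) / (1 - Cconj tau * z))%C.
Definition of_rhp (w : C) : C := (tau * ((w - 1) / (w + 1)))%C.

Lemma tau_conj : (Cconj tau * tau)%C = 1.
Proof.
  replace (Cconj tau * tau)%C with (tau * Cconj tau)%C by ring.
  rewrite <- Cmod2_conj, tau_unit. f_equal. ring.
Qed.

Lemma to_rhp_denom (z : C) : unit_disc z -> (1 - Cconj tau * z)%C <> 0.
Proof. intro H. apply one_minus_neq_0, Cmod_conj_mult_lt_1; [lra|exact H]. Qed.

Lemma fst_to_rhp (z : C) : unit_disc z -> fst (to_rhp z) = horo tau z.
Proof.
  intro Hz. pose proof (to_rhp_denom z Hz) as N. pose proof (proj1 (Cmod_gt_0 _) N) as P.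
  unfold horo, to_rhp. set (c := (Cconj tau * z)%C) in *.
  assert (Ec : Cmod z = Cmod c) by (unfold c; rewrite Cmod_mult, Cmod_conj, tau_unit; ring).
  rewrite Ec, fst_Cdiv, (Cmod_sqr c) by exact N. f_equal. clearbody c. destruct c. simpl. ring.
Qed.

Lemma rhp_to_rhp (z : C) : unit_disc z -> rhp (to_rhp z).
Proof. intro Hz. unfold rhp. rewrite fst_to_rhp by exact Hz. apply horo_pos; [lra|exact Hz]. Qed.

Lemma of_rhp_denom (w : C) : rhp w -> 1 <= Cmod (w + 1).
Proof. unfold rhp. intro H. eapply Rle_trans; [|apply fst_le_Cmod]. simpl. lra. Qed.

Lemma of_rhp_denom_neq_0 (w : C) : rhp w -> (w + 1)%C <> 0.
Proof. intro H. apply Cmod_pos_neq_0. pose proof (of_rhp_denom w H). lra. Qed.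

Lemma unit_disc_of_rhp (w : C) : rhp w -> unit_disc (of_rhp w).
Proof.
  intro Hw. unfold unit_disc, of_rhp. rewrite Cmod_mult, tau_unit, Rmult_1_l.
  rewrite Cmod_div by (apply of_rhp_denom_neq_0, Hw). pose proof (of_rhp_denom w Hw).
  apply (Rlt_div_l (Cmod (w - 1))); [lra|].
  pose proof (Pick_identity_rhp w 1) as I. replace (Cconj 1) with (RtoC 1) in I
    by (unfold Cconj, RtoC; simpl; f_equal; ring).
  unfold rhp in Hw. simpl fst in I. pose proof (Cmod_ge_0 (w - 1)). apply Rnot_le_lt. intro. nra.
Qed.

Lemma of_to_rhp (z : C) : unit_disc z -> of_rhp (to_rhp z) = z.
Proof.
  intro Hz. pose proof (to_rhp_denom z Hz) as N. unfold of_rhp, to_rhp.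
  transitivity (tau * Cconj tau * z)%C.
  - field. split; [exact N|]. replace (1 + Cconj tau * z + (1 - Cconj tau * z))%C with (RtoC 2) by ring.
    intro E. apply RtoC_inj in E. lra.
  - replace (tau * Cconj tau)%C with (Cconj tau * tau)%C by ring. rewrite tau_conj. ring.
Qed.

Lemma to_of_rhp (w : C) : rhp w -> to_rhp (of_rhp w) = w.
Proof.
  intro Hw. pose proof (of_rhp_denom_neq_0 w Hw) as N. unfold of_rhp, to_rhp.
  rewrite Cmult_assoc, tau_conj. field. split; [exact N|].
  replace (w + 1 - (w - 1))%C with (RtoC 2) by ring. intro E. apply RtoC_inj in E. lra.
Qed.

Lemma Cmod_of_rhp_sub (a b : C) : rhp a -> rhp b ->
  Cmod (of_rhp b - of_rhp a) <= 2 * Cmod (b - a) / Cmod (a + 1).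
Proof.
  intros Ha Hb. pose proof (of_rhp_denom_neq_0 a Ha) as Na. pose proof (of_rhp_denom_neq_0 b Hb) as Nb.
  pose proof (of_rhp_denom a Ha) as Pa. pose proof (of_rhp_denom b Hb) as Pb.
  unfold of_rhp.
  replace (tau * ((b - 1) / (b + 1)) - tau * ((a - 1) / (a + 1)))%C
    with (tau * (2 * (b - a) / ((a + 1) * (b + 1))))%C by (field; split; assumption).
  rewrite Cmod_mult, tau_unit, Rmult_1_l, Cmod_div by (apply Cmult_neq_0; assumption).
  rewrite !Cmod_mult, Cmod_real_nonneg by lra.
  pose proof (Cmod_ge_0 (b - a)).
  unfold Rdiv. apply Rmult_le_compat_l; [lra|]. apply Rinv_le_contravar; nra.
Qed.

Lemma cdiff_to_rhp (z : C) : unit_disc z -> cdiff to_rhp z.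
Proof.
  intro Hz. unfold to_rhp. apply cdiff_div; [| |apply to_rhp_denom, Hz].
  - apply cdiff_plus; [apply cdiff_const|apply cdiff_mult; [apply cdiff_const|apply cdiff_id]].
  - apply cdiff_minus; [apply cdiff_const|apply cdiff_mult; [apply cdiff_const|apply cdiff_id]].
Qed.

Lemma cdiff_of_rhp (w : C) : rhp w -> cdiff of_rhp w.
Proof.
  intro Hw. unfold of_rhp. apply cdiff_mult; [apply cdiff_const|].
  apply cdiff_div; [| |apply of_rhp_denom_neq_0, Hw].
  - apply cdiff_minus; [apply cdiff_id|apply cdiff_const].
  - apply cdiff_plus; [apply cdiff_id|apply cdiff_const].
Qed.

Variable Phi : R -> C -> C.
Hypothesis HP : disc_semigroup Phi.
Hypothesis Hhoro : forall t z, 0 <= t -> unit_disc z -> horo tau z <= horo tau (Phi t z).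

Definition rhp_flow (t : R) (w : C) : C := to_rhp (Phi t (of_rhp w)).

Definition rhp_velocity (s : R) (w : C) : C := ((rhp_flow s w - w) / s)%C.

Lemma rhp_flow_self (t : R) (w : C) : 0 <= t -> rhp w -> rhp (rhp_flow t w).
Proof. intros Ht Hw. apply rhp_to_rhp, (ds_self _ HP); [exact Ht|apply unit_disc_of_rhp, Hw]. Qed.

Lemma rhp_flow_mono (t : R) (w : C) : 0 <= t -> rhp w -> fst w <= fst (rhp_flow t w).
Proof.
  intros Ht Hw. pose proof (unit_disc_of_rhp w Hw) as Hd. unfold rhp_flow.
  rewrite fst_to_rhp by (apply (ds_self _ HP); assumption).
  rewrite <- (to_of_rhp w Hw) at 1. rewrite fst_to_rhp by exact Hd. apply Hhoro; assumption.
Qed.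

Lemma rhp_flow_comp (t u : R) (w : C) :
  0 <= t -> 0 <= u -> rhp w -> rhp_flow t (rhp_flow u w) = rhp_flow (t + u) w.
Proof.
  intros Ht Hu Hw. pose proof (unit_disc_of_rhp w Hw) as Hd. unfold rhp_flow.
  rewrite of_to_rhp by (apply (ds_self _ HP); assumption).
  rewrite (ds_comp _ HP) by assumption. reflexivity.
Qed.

Lemma rhp_flow_0 (w : C) : rhp w -> rhp_flow 0 w = w.
Proof.
  intro Hw. unfold rhp_flow. rewrite (ds_0 Phi) by (try assumption; apply unit_disc_of_rhp, Hw).
  apply to_of_rhp, Hw.
Qed.

Lemma rhp_flow_step (s : R) (w : C) : 0 < s -> rhp_flow s w = (w + s * rhp_velocity s w)%C.
Proof. intro Hs. unfold rhp_velocity. field. intro E. apply RtoC_inj in E. lra. Qed.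

Lemma rhp_flow_succ (s : R) (k : nat) (w : C) : 0 < s -> rhp w ->
  rhp_flow (INR (S k) * s) w
  = (rhp_flow (INR k * s) w + s * rhp_velocity s (rhp_flow (INR k * s) w))%C.
Proof.
  intros Hs Hw. rewrite <- rhp_flow_step by exact Hs.
  rewrite rhp_flow_comp; [|lra|apply Rmult_le_pos; [apply pos_INR|lra]|exact Hw].
  f_equal. rewrite S_INR. ring.
Qed.

Lemma herglotz_rhp_velocity (s : R) : 0 < s -> herglotz (rhp_velocity s).
Proof.
  intro Hs. split; intros w Hw.
  - pose proof (unit_disc_of_rhp w Hw) as Hd. unfold rhp_velocity. apply cdiff_div.
    + apply cdiff_minus; [|apply cdiff_id]. unfold rhp_flow.
      apply (cdiff_comp to_rhp (fun w => Phi s (of_rhp w))).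
      * apply (cdiff_comp (Phi s) of_rhp); [apply cdiff_of_rhp, Hw|].
        apply (ds_diff _ HP); [lra|exact Hd].
      * apply cdiff_to_rhp, (ds_self _ HP); [lra|exact Hd].
    + apply cdiff_const.
    + intro E. apply RtoC_inj in E. lra.
  - unfold rhp_velocity, Cdiv. rewrite <- RtoC_inv by lra.
    pose proof (rhp_flow_mono s w ltac:(lra) Hw).
    replace (fst ((rhp_flow s w - w) * (/ s)%R)%C) with ((fst (rhp_flow s w) - fst w) * / s)
      by (simpl; ring).
    apply Rmult_le_pos; [lra|]. left. apply Rinv_0_lt_compat, Hs.
Qed.

Lemma rhp_flow_near_1 : exists T, 0 < T /\ forall r, 0 <= r <= T -> Cmod (rhp_flow r 1 - 1) <= 1 / 16.
Proof.
  assert (E1 : of_rhp 1 = 0) by (unfold of_rhp; replace (1 - 1)%C with (RtoC 0) by ring; unfold Cdiv; ring).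
  assert (E2 : to_rhp 0 = 1).
  { unfold to_rhp. replace (1 + Cconj tau * 0)%C with (RtoC 1) by ring.
    replace (1 - Cconj tau * 0)%C with (RtoC 1) by ring. field. }
  destruct (cdiff_ccont to_rhp 0 (cdiff_to_rhp 0 disc_0) (1 / 16)) as [d [Hd Hw]]; [lra|].
  destruct (ds_cont _ HP 0 d disc_0 Hd) as [T [HT HTd]].
  exists (T / 2). split; [lra|]. intros r Hr. unfold rhp_flow. rewrite E1, <- E2 at 1.
  left. apply Hw. apply HTd. lra.
Qed.

(** The bound on the half-plane displacement grows like [Cmod w + 1]; the derivative of
    the coordinate change decays fast enough to compensate for it. *)
Lemma boundary_case :
  exists t1 M, 0 < t1 /\ 0 <= M /\
    forall z t, unit_disc z -> 0 < t <= t1 -> Cmod (Phi t z - z) <= M * sqrt t.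
Proof.
  destruct rhp_flow_near_1 as [T [HT Hnear]].
  set (X := fun t => fst (rhp_flow t 1) - 1).
  assert (HX : forall a b, 0 <= a -> a <= b -> b <= T -> X a <= X b).
  { intros a b Ha Hab _. unfold X. replace b with ((b - a) + a) by ring.
    rewrite <- rhp_flow_comp by (try apply rhp_1; lra).
    pose proof (rhp_flow_mono (b - a) (rhp_flow a 1) ltac:(lra) (rhp_flow_self a 1 Ha rhp_1)). lra. }
  assert (Base : forall s, 0 < s <= T / 2 ->
            Cmod (rhp_velocity s 1) <= 2 / T /\ X (T / 2) <= 12 * T * fst (rhp_velocity s 1)).
  { apply base_point_bounds; [apply herglotz_rhp_velocity|exact HT|exact HX|].
    intros s n Hs Hns. exists (fun k => rhp_flow (INR k * s) 1).
    assert (Hk : forall k, (k <= n)%nat -> 0 <= INR k * s <= T).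
    { intros k Hk. apply le_INR in Hk. pose proof (pos_INR k). nra. }
    split; [|split; [|split]].
    - simpl. rewrite Rmult_0_l. apply rhp_flow_0, rhp_1.
    - intros k Hk'. apply Hnear, Hk, Hk'.
    - intros k Hk'. rewrite rhp_flow_succ by (try exact Hs; apply rhp_1).
      set (w := rhp_flow (INR k * s) 1). split.
      + replace (w + s * rhp_velocity s w - w - s * rhp_velocity s w)%C with (RtoC 0) by ring.
        rewrite Cmod_0. pose proof (Cmod_ge_0 (rhp_velocity s w)). nra.
      + assert (0 <= fst (rhp_velocity s w)).
        { apply herglotz_rhp_velocity; [exact Hs|]. apply rhp_flow_self; [|apply rhp_1]. apply Hk. lia. }
        pose proof (Rmult_le_pos s _ ltac:(lra) H).
        set (v := rhp_velocity s w) in *. clearbody v w. simpl. lra.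
    - reflexivity. }
  assert (X0 : 0 <= X (T / 2)).
  { unfold X. pose proof (rhp_flow_mono (T / 2) 1 ltac:(lra) rhp_1) as A. change (fst (RtoC 1)) with 1 in A. lra. }
  set (C1 := 2 / T) in *. assert (HC1 : 0 < C1) by (apply Rdiv_lt_0_compat; lra).
  assert (Final : forall z t w', unit_disc z -> 0 < t -> w' = rhp_flow t (to_rhp z) ->
     Cmod (Phi t z - z) <= 2 * Cmod (w' - to_rhp z) / Cmod (to_rhp z + 1)).
  { intros z t w' Hz Ht ->.
    replace (Phi t z - z)%C with (of_rhp (rhp_flow t (to_rhp z)) - of_rhp (to_rhp z))%C.
    - apply Cmod_of_rhp_sub; [apply rhp_to_rhp, Hz|apply rhp_flow_self; [lra|apply rhp_to_rhp, Hz]].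
    - unfold rhp_flow. rewrite (of_to_rhp z Hz), of_to_rhp; [reflexivity|].
      apply (ds_self _ HP); [lra|exact Hz]. }
  destruct X0 as [X0|X0].
  - (* the orbit of the base point leaves its vertical line *)
    set (c1 := X (T / 2) / (12 * T)). assert (Hc1 : 0 < c1) by (apply Rdiv_lt_0_compat; lra).
    set (c := c1 / (C1 * C1)). assert (Hc : 0 < c) by (apply Rdiv_lt_0_compat; nra).
    exists (c / 16), (16 * / sqrt c).
    pose proof (sqrt_lt_R0 c Hc) as Psc.
    split; [lra|]. split; [apply Rmult_le_pos; [lra|left; apply Rinv_0_lt_compat, Psc]|].
    intros z t Hz Ht. set (w0 := to_rhp z).
    assert (Hw0 : rhp w0) by (apply rhp_to_rhp, Hz).
    destruct (orbit_compact Phi z t HP Hz ltac:(lra)) as [d [Hd Horb]].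
    set (B := C1 * ((2 / d + 1) * (2 / d + 1)) / fst w0).
    assert (H2d : 0 < 2 / d) by (apply Rdiv_lt_0_compat; lra).
    assert (HB : 0 < B).
    { apply Rdiv_lt_0_compat; [|exact Hw0]. apply Rmult_lt_0_compat; nra. }
    assert (Hflow : forall r, 0 <= r <= t -> Cmod (rhp_flow r w0 + Cconj 1) <= 2 / d + 1).
    { intros r Hr. eapply Rle_trans; [apply Cmod_triangle|]. rewrite Cmod_conj, Cmod_1.
      apply Rplus_le_compat_r. unfold rhp_flow, w0. rewrite of_to_rhp by exact Hz.
      specialize (Horb r Hr). set (v := Phi r z) in *.
      assert (Hv : unit_disc v) by (unfold unit_disc; lra).
      unfold to_rhp. rewrite Cmod_div by (apply to_rhp_denom, Hv).
      pose proof (Cmod_triangle 1 (Cconj tau * v)) as T1.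
      pose proof (Cmod_triangle_inv 1 (Cconj tau * v)) as T2.
      rewrite Cmod_mult, Cmod_conj, tau_unit, Cmod_1 in T1, T2.
      unfold Rdiv. apply Rmult_le_compat; [apply Cmod_ge_0|left; apply Rinv_0_lt_compat; lra|lra|].
      apply Rinv_le_contravar; lra. }
    destruct (fine_chain_displacement (fun w => w = rhp_flow t w0) c1 C1 t (T / 2) B w0)
      as [w' [Hw' [_ Hbound]]]; try assumption; try lra.
    { fold c. lra. }
    { intros n Hn Hs. set (s := t / INR n) in *.
      assert (Pn : 0 < INR n) by (apply lt_0_INR, Hn).
      assert (Ps : 0 < s) by (apply Rdiv_lt_0_compat; lra).
      assert (Ens : INR n * s = t) by (unfold s; field; lra).
      assert (Hk : forall k, (k <= n)%nat -> 0 <= INR k * s <= t).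
      { intros k Hk. apply le_INR in Hk. pose proof (pos_INR k). nra. }
      destruct (Base s (conj Ps Hs)) as [B1 B2].
      exists (rhp_velocity s), (fun k => rhp_flow (INR k * s) w0).
      split; [apply herglotz_rhp_velocity, Ps|]. split; [|split; [exact B1|split; [|split; [|split]]]].
      - unfold c1. apply Rle_div_l; lra.
      - simpl. rewrite Rmult_0_l. apply rhp_flow_0, Hw0.
      - intros k Hk'. apply rhp_flow_mono; [apply Hk, Hk'|exact Hw0].
      - intros k Hk'. rewrite rhp_flow_succ by assumption.
        specialize (Hk k ltac:(lia)). specialize (Hflow _ Hk).
        pose proof (rhp_flow_self _ w0 (proj1 Hk) Hw0) as Hr.
        pose proof (rhp_flow_mono _ w0 (proj1 Hk) Hw0) as Hm.
        set (w := rhp_flow (INR k * s) w0) in *. split.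
        + pose proof (herglotz_Cmod_Harnack _ w 1 (herglotz_rhp_velocity s Ps) Hr rhp_1) as A.
          change (fst (RtoC 1)) with 1 in A. rewrite Rmult_1_r in A.
          unfold B. apply Rle_div_r_intro; [exact Hw0|].
          apply Rle_trans with (Cmod (rhp_velocity s w) * fst w).
          * apply Rmult_le_compat_l; [apply Cmod_ge_0|exact Hm].
          * eapply Rle_trans; [exact A|]. pose proof (Cmod_ge_0 (w + Cconj 1)).
            apply Rmult_le_compat; [apply Cmod_ge_0|nra|exact B1|]. apply Rmult_le_compat; lra.
        + replace (w + s * rhp_velocity s w - w - RtoC s * rhp_velocity s w)%C with (RtoC 0) by ring.
          rewrite Cmod_0. pose proof (Cmod_ge_0 (rhp_velocity s w)).
          assert (0 <= s * Cmod (rhp_velocity s w)) by (apply Rmult_le_pos; lra). nra.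
      - rewrite Ens. reflexivity. }
    eapply Rle_trans; [apply (Final z t w' Hz (proj1 Ht) Hw')|]. fold w0 c in Hbound |- *.
    pose proof (of_rhp_denom w0 Hw0) as Pd.
    assert (Hw1 : Cmod w0 + 1 <= 2 * Cmod (w0 + 1)).
    { assert (Cmod w0 <= Cmod (w0 + 1)); [|lra].
      apply Rsqr_le_le; [apply Cmod_ge_0|]. rewrite !Cmod_sqr. clear - Hw0. clearbody w0.
      unfold rhp in Hw0. simpl. nra. }
    rewrite sqrt_div_alt in Hbound by exact Hc. unfold Rdiv in Hbound.
    pose proof (sqrt_pos t) as Pst. pose proof (Rinv_0_lt_compat _ Psc) as Pi.
    apply Rle_div_l; [lra|].
    assert (0 <= sqrt t * / sqrt c) by (apply Rmult_le_pos; lra).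
    assert (4 * (sqrt t * / sqrt c) * (Cmod w0 + 1) <= 4 * (sqrt t * / sqrt c) * (2 * Cmod (w0 + 1)))
      by (apply Rmult_le_compat_l; lra).
    lra.
  - (* the orbit of the base point stays on its vertical line: each map is a vertical
       translation, by a length proportional to the time at most *)
    exists (Rmin (T / 2) 1), (2 * C1).
    split; [apply Rmin_glb_lt; lra|]. split; [lra|]. intros z t Hz Ht.
    pose proof (Rmin_l (T / 2) 1). pose proof (Rmin_r (T / 2) 1).
    assert (Ht' : 0 < t <= T / 2) by lra. destruct (Base t Ht') as [B1 _].
    set (w0 := to_rhp z). assert (Hw0 : rhp w0) by (apply rhp_to_rhp, Hz).
    assert (Z : fst (rhp_velocity t 1) = 0).
    { apply Rle_antisym; [|apply herglotz_rhp_velocity; [lra|apply rhp_1]].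
      pose proof (HX t (T / 2) ltac:(lra) ltac:(lra) ltac:(lra)) as A. rewrite <- X0 in A.
      unfold X in A. rewrite (rhp_flow_step t 1) in A by lra.
      set (v := rhp_velocity t 1) in *. clearbody v. simpl in A. nra. }
    pose proof (herglotz_Re_0_const _ w0 1 (herglotz_rhp_velocity t ltac:(lra)) Hw0 rhp_1 Z) as E.
    apply sqrt_bound_of_linear; [lra|lra|].
    eapply Rle_trans; [apply (Final z t _ Hz (proj1 Ht) eq_refl)|]. fold w0.
    rewrite (rhp_flow_step t w0), E by lra.
    replace (w0 + t * rhp_velocity t 1 - w0)%C with (t * rhp_velocity t 1)%C by ring.
    rewrite Cmod_mult, Cmod_real_nonneg by lra.
    pose proof (of_rhp_denom w0 Hw0). pose proof (Cmod_ge_0 (rhp_velocity t 1)).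
    apply Rle_div_l; [lra|].
    assert (t * Cmod (rhp_velocity t 1) <= t * C1) by (apply Rmult_le_compat_l; lra).
    assert (0 <= t * C1) by nra. nra.
Qed.

End BoundaryPoint.

(** * Semigroups with a fixed point in the disc *)

Lemma exp_le_inv (x y : R) : exp x <= exp y -> x <= y.
Proof. intros [H|H]; [left; apply exp_lt_inv, H|right; apply exp_inv, H]. Qed.

Lemma Cexp_opp_sub (a b v : C) : Cexp (- b) = (Cexp (- a) * (1 - v))%C -> Cexp (- (b - a)) = (1 - v)%C.
Proof.
  intro H. replace (- (b - a))%C with (- b + a)%C by ring. rewrite Cexp_plus, H, Cexp_opp.
  field. apply Cexp_neq_0.
Qed.

(** [e] is the logarithm of [1 / (1 - v)], whose real part is at most [2 * fst v] because
    [Cmod (1 - v)^2 >= 1 - 2 * fst v]. *)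
Lemma log_step_near_1 (e v : C) :
  Cexp (- e) = (1 - v)%C -> Cmod e <= 1 / 16 -> 0 <= fst v ->
  Cmod (e - v) <= Cmod v / 4 /\ fst e <= 2 * fst v.
Proof.
  intros He Hsmall Hv. pose proof (Cmod_ge_0 e) as Pe.
  assert (A : Cmod (e - v) <= 3 * Cmod e * Cmod e).
  { pose proof (Cexp_minus_1_minus (- e)) as B. rewrite Cmod_opp, He in B.
    replace (1 - v - 1 - - e)%C with (e - v)%C in B by ring. apply B. lra. }
  assert (A' : Cmod (e - v) <= 3 / 16 * Cmod e) by nra.
  pose proof (Cmod_triangle_inv e v) as T.
  assert (Bv : Cmod e <= 16 / 13 * Cmod v) by lra.
  split; [lra|].
  assert (Hv8 : Cmod v <= 1 / 8).
  { rewrite Cmod_sub_sym in A'. pose proof (Cmod_triangle_inv v e). lra. }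
  pose proof (fst_le_Cmod v) as Fv.
  (* the modulus of 1 - v is at least sqrt (1 - 2 Re v), hence at least exp (- 2 Re v) *)
  assert (E : exp (- fst e) * exp (- fst e) = Cmod (1 - v) * Cmod (1 - v)).
  { rewrite <- He, Cmod_Cexp. reflexivity. }
  assert (L : 1 - 2 * fst v <= Cmod (1 - v) * Cmod (1 - v)).
  { rewrite Cmod_sqr. destruct v. simpl. nra. }
  rewrite <- E in L. apply Rnot_lt_le. intro H.
  assert (L2 : exp (- fst e) <= exp (- (2 * fst v))) by (left; apply exp_increasing; lra).
  pose proof (exp_pos (- fst e)) as P. pose proof (exp_ineq1_le (2 * fst v)) as I.
  rewrite (exp_Ropp (2 * fst v)) in L2.
  assert (L3 : / exp (2 * fst v) <= / (1 + 2 * fst v)) by (apply Rinv_le_contravar; lra).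
  set (x := 2 * fst v) in *. assert (Hx : 0 <= x <= 1 / 4) by (unfold x; lra).
  destruct (Req_dec x 0) as [Z|NZ].
  { (* Re v = 0 forces Re e <= 0 *)
    rewrite Z in L. assert (1 <= exp (- fst e)) by nra.
    rewrite <- exp_0 in H0. apply exp_le_inv in H0. lra. }
  set (q := exp (- fst e)) in *.
  assert (Q : q * (1 + x) <= 1).
  { apply Rle_trans with (/ (1 + x) * (1 + x)); [apply Rmult_le_compat_r; lra|]. rewrite Rinv_l; lra. }
  assert (Q2 : (q * (1 + x)) * (q * (1 + x)) <= 1 * 1) by (apply Rmult_le_compat; nra).
  assert ((1 - x) * ((1 + x) * (1 + x)) <= q * q * ((1 + x) * (1 + x))) by (apply Rmult_le_compat_r; nra).
  assert (0 < x * (1 - x - x * x)) by (apply Rmult_lt_0_compat; nra). nra.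
Qed.

Section FixedPointAtZero.

Variable Psi : R -> C -> C.
Hypothesis HP : disc_semigroup Psi.
Hypothesis Hfix : forall t, 0 <= t -> Psi t 0 = 0.

Lemma Cmod_Psi_le (t : R) (z : C) : 0 <= t -> unit_disc z -> Cmod (Psi t z) <= Cmod z.
Proof.
  intros Ht Hz. apply Schwarz_lemma; auto.
  - intros w Hw. apply (ds_diff _ HP); assumption.
  - intros w Hw. left. apply (ds_self _ HP); assumption.
Qed.

Definition quotient (s : R) (w : C) : C := (Psi s (Cexp (- w)) * Cexp w)%C.

(** The velocity, over a time step [s], in the coordinate [z = exp (-w)], up to second
    order: one step multiplies [z] by [1 - s * log_velocity s w]. The real part is
    nonnegative because [Psi s z / z] has modulus at most 1. *)
Definition log_velocity (s : R) (w : C) : C := ((1 - quotient s w) / s)%C.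

Lemma Cmod_quotient_le (s : R) (w : C) : 0 <= s -> rhp w -> Cmod (quotient s w) <= 1.
Proof.
  intros Hs Hw. unfold quotient. rewrite Cmod_mult.
  pose proof (Cmod_Psi_le s _ Hs (unit_disc_Cexp_opp w Hw)) as A.
  apply Rle_trans with (Cmod (Cexp (- w)) * Cmod (Cexp w)).
  - apply Rmult_le_compat_r; [apply Cmod_ge_0|exact A].
  - rewrite <- Cmod_mult, <- Cexp_plus. replace (- w + w)%C with (RtoC 0) by ring.
    rewrite Cexp_0, Cmod_1. lra.
Qed.

Lemma cdiff_quotient (s : R) (w : C) : 0 <= s -> rhp w -> cdiff (quotient s) w.
Proof.
  intros Hs Hw. unfold quotient. apply cdiff_mult; [|apply cdiff_Cexp, cdiff_id].
  apply (cdiff_comp (Psi s) (fun w => Cexp (- w))); [apply cdiff_Cexp, cdiff_opp, cdiff_id|].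
  apply (ds_diff _ HP); [exact Hs|apply unit_disc_Cexp_opp, Hw].
Qed.

Lemma RtoC_neq_0 (s : R) : s <> 0 -> RtoC s <> 0.
Proof. intros H E. apply RtoC_inj in E. contradiction. Qed.

Lemma herglotz_log_velocity (s : R) : 0 < s -> herglotz (log_velocity s).
Proof.
  intro Hs. split; intros w Hw.
  - unfold log_velocity. apply cdiff_div.
    + apply cdiff_minus; [apply cdiff_const|apply cdiff_quotient; [lra|exact Hw]].
    + apply cdiff_const.
    + apply RtoC_neq_0. lra.
  - pose proof (Cmod_quotient_le s w ltac:(lra) Hw) as A.
    pose proof (fst_le_Cmod (quotient s w)) as B.
    unfold log_velocity, Cdiv. rewrite <- RtoC_inv by lra.
    set (q := quotient s w) in *. clearbody q.
    replace (fst ((1 - q) * (/ s)%R)%C) with ((1 - fst q) * / s) by (simpl; ring).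
    apply Rmult_le_pos; [lra|]. left. apply Rinv_0_lt_compat, Hs.
Qed.

Lemma Psi_Cexp_opp (s : R) (w : C) : 0 < s ->
  Psi s (Cexp (- w)) = (Cexp (- w) * (1 - s * log_velocity s w))%C.
Proof.
  intro Hs. unfold log_velocity, quotient.
  replace (Cexp w) with (/ Cexp (- w))%C.
  - field. split; [apply Cexp_neq_0|apply RtoC_neq_0; lra].
  - rewrite Cexp_opp. field. apply Cexp_neq_0.
Qed.

Lemma log_velocity_ext (s : R) (a b : C) :
  Cexp (- a) = Cexp (- b) -> log_velocity s a = log_velocity s b.
Proof.
  intro H. unfold log_velocity, quotient. rewrite H.
  replace (Cexp a) with (Cexp b); [reflexivity|].
  replace (Cexp b) with (/ Cexp (- b))%C by (rewrite Cexp_opp; field; apply Cexp_neq_0).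
  rewrite <- H, Cexp_opp. field. apply Cexp_neq_0.
Qed.

Lemma exists_lift (z : C) : z <> 0 -> unit_disc z ->
  exists w, Cexp (- w) = z /\ rhp w /\ Rabs (snd w) <= PI.
Proof.
  intros Nz Hz. pose proof (proj1 (Cmod_gt_0 z) Nz) as Pz.
  destruct (Cexp_polar z Nz) as [w [Ew [Fw Sw]]]. exists (- w)%C.
  split; [replace (- - w)%C with w by ring; exact Ew|]. split.
  - unfold rhp. simpl. rewrite Fw. pose proof (ln_increasing _ 1 Pz Hz). rewrite ln_1 in H. lra.
  - simpl. rewrite Rabs_Ropp. exact Sw.
Qed.

Definition base : C := Cexp (- (1)).

Lemma base_disc : unit_disc base.
Proof. apply unit_disc_Cexp_opp, rhp_1. Qed.

(** Near the base point, orbits have lifts near 1. *)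
Lemma exists_base_lift : exists T e, 0 < T /\ e 0 = RtoC 0 /\
  forall r, 0 <= r <= T -> Cexp (- (1 + e r)) = Psi r base /\ Cmod (e r) <= 1 / 32.
Proof.
  pose proof (Cexp_neq_0 (- (1))) as Nb. fold base in Nb.
  pose proof (proj1 (Cmod_gt_0 _) Nb) as Pb.
  destruct (ds_cont _ HP base (Cmod base / 64) base_disc) as [T [HT Hw]]; [lra|].
  destruct (functional_choice (fun r e => 0 <= r < T ->
     Cexp (- e) = (1 - (1 - Psi r base / base))%C /\
     Cmod (e - (1 - Psi r base / base)) <= 2 * Cmod (1 - Psi r base / base) * Cmod (1 - Psi r base / base)))
    as [e He].
  { intro r. destruct (Rlt_dec r T) as [H1|H1]; [|exists 0; lra].
    destruct (Rle_dec 0 r) as [H2|H2]; [|exists 0; lra].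
    destruct (Cexp_log_near_1 (1 - Psi r base / base)) as [e He]; [|exists e; auto].
    specialize (Hw r (conj H2 H1)).
    replace (1 - Psi r base / base)%C with (- ((Psi r base - base) / base))%C by (field; exact Nb).
    rewrite Cmod_opp, Cmod_div by exact Nb. apply Rle_div_l; lra. }
  assert (Bound : forall r, 0 <= r < T -> Cmod (1 - Psi r base / base) <= 1 / 64).
  { intros r Hr. specialize (Hw r Hr).
    replace (1 - Psi r base / base)%C with (- ((Psi r base - base) / base))%C by (field; exact Nb).
    rewrite Cmod_opp, Cmod_div by exact Nb. apply Rle_div_l; lra. }
  exists (T / 2), e. split; [lra|]. split.
  - destruct (He 0 ltac:(lra)) as [_ B]. rewrite (ds_0 _ _ HP base_disc) in B.
    replace (1 - base / base)%C with (RtoC 0) in B by (field; exact Nb).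
    rewrite Cmod_0 in B. replace (e 0 - 0)%C with (e 0) in B by ring.
    apply Cmod_eq_0. pose proof (Cmod_ge_0 (e 0)). lra.
  - intros r Hr. destruct (He r ltac:(lra)) as [A B]. specialize (Bound r ltac:(lra)).
    set (v := (1 - Psi r base / base)%C) in *. split.
    + replace (- (1 + e r))%C with (- (1) + - e r)%C by ring. rewrite Cexp_plus, A. fold base.
      unfold v. field. exact Nb.
    + pose proof (Cmod_triangle_inv (e r) v). pose proof (Cmod_ge_0 v). nra.
Qed.

(** The maximum principle for the quotient, rotated so that its value at 1 is 1. *)
Lemma quotient_const (s : R) (w : C) : 0 <= s -> rhp w ->
  Cmod (quotient s 1) = 1 -> quotient s w = quotient s 1.
Proof.
  intros Hs Hw H1. set (n := quotient s 1) in *.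
  assert (Hn : (n * Cconj n)%C = 1) by (rewrite <- Cmod2_conj, H1; f_equal; ring).
  assert (HU : herglotz (fun w => 1 - quotient s w * Cconj n)%C).
  { split; intros v Hv.
    - apply cdiff_minus; [apply cdiff_const|]. apply cdiff_mult; [|apply cdiff_const].
      apply cdiff_quotient; assumption.
    - pose proof (fst_le_Cmod (quotient s v * Cconj n)) as A.
      rewrite Cmod_mult, Cmod_conj, H1 in A. pose proof (Cmod_quotient_le s v Hs Hv).
      set (p := (quotient s v * Cconj n)%C) in *. clearbody p. simpl. lra. }
  assert (E : (1 - quotient s w * Cconj n)%C = (1 - quotient s 1 * Cconj n)%C).
  { apply (herglotz_Re_0_const _ w 1 HU Hw rhp_1). fold n. rewrite Hn. simpl. ring. }
  fold n in E. rewrite Hn in E.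
  transitivity (quotient s w * (n * Cconj n))%C; [rewrite Hn; ring|].
  replace (quotient s w * (n * Cconj n))%C with (n * (1 - (1 - quotient s w * Cconj n)))%C by ring.
  rewrite E. ring.
Qed.

(** A bound for the velocity that only depends on the height: the velocity has
    period [2 pi i], and there is a lift of small imaginary part. *)
Lemma Cmod_log_velocity_le (s C1 : R) (w : C) : 0 < s -> rhp w ->
  Cmod (log_velocity s 1) <= C1 ->
  Cmod (log_velocity s w) * fst w <= C1 * ((fst w + 5) * (fst w + 5)).
Proof.
  intros Hs Hw HC. destruct (exists_lift _ (Cexp_neq_0 (- w)) (unit_disc_Cexp_opp w Hw)) as [v [Ev [Hv Sv]]].
  rewrite <- (log_velocity_ext s v w Ev).
  assert (Fv : fst v = fst w).
  { assert (E : exp (- fst v) = exp (- fst w)).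
    { change (exp (fst (- v)%C) = exp (fst (- w)%C)). rewrite <- !Cmod_Cexp, Ev. reflexivity. }
    apply exp_inv in E. lra. }
  pose proof (herglotz_Cmod_Harnack _ v 1 (herglotz_log_velocity s Hs) Hv rhp_1) as A.
  change (fst (RtoC 1)) with 1 in A. rewrite Rmult_1_r, Fv in A.
  eapply Rle_trans; [exact A|].
  assert (N : Cmod (v + Cconj 1) <= fst w + 5).
  { eapply Rle_trans; [apply Cmod_triangle|]. rewrite Cmod_conj, Cmod_1.
    pose proof (Cmod_le_abs_fst_snd v) as B. unfold rhp in Hv. rewrite (Rabs_pos_eq (fst v)) in B by lra.
    pose proof PI_4. lra. }
  pose proof (Cmod_ge_0 (v + Cconj 1)). pose proof (Cmod_ge_0 (log_velocity s 1)).
  apply Rmult_le_compat; [assumption|nra|exact HC|]. apply Rmult_le_compat; lra.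
Qed.

(** A lift to the half-plane of an orbit with step [s], by successive logarithms of the
    factors [1 - s * log_velocity s w]. The velocity is at most linear in the abscissa,
    so that the abscissa grows at most exponentially in time; this bounds the velocity
    along the orbit and keeps the orbit away from 0 in the disc. *)
Lemma exists_log_chain (s C1 x0 t : R) (w0 : C) :
  0 < s -> 0 < C1 -> Cmod (log_velocity s 1) <= C1 -> fst w0 = x0 -> 0 < x0 ->
  let A := 25 * C1 * ((1 + x0) / x0) in
  let B := A * ((1 + x0) * exp (2 * A * t)) in
  s * B <= 1 / 2 ->
  exists zeta : nat -> C, zeta O = w0 /\
    forall k, INR k * s <= t ->
      Cexp (- zeta k) = Psi (INR k * s) (Cexp (- w0)) /\ x0 <= fst (zeta k) /\
      Cmod (log_velocity s (zeta k)) <= B /\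
      Cmod (zeta (S k) - zeta k - s * log_velocity s (zeta k))
        <= 2 * (s * Cmod (log_velocity s (zeta k))) * (s * Cmod (log_velocity s (zeta k))).
Proof.
  intros Hs HC1 HC Hx Hx0 A B HsB.
  assert (HA : 0 < A).
  { unfold A. assert (0 < (1 + x0) / x0) by (apply Rdiv_lt_0_compat; lra).
    apply Rmult_lt_0_compat; lra. }
  assert (Hw0 : rhp w0) by (unfold rhp; lra).
  pose proof (unit_disc_Cexp_opp w0 Hw0) as Hu0.
  destruct (functional_choice (fun w w' => s * Cmod (log_velocity s w) <= 1 / 2 ->
     Cexp (- w') = (Cexp (- w) * (1 - s * log_velocity s w))%C /\
     Cmod (w' - w - s * log_velocity s w)
        <= 2 * (s * Cmod (log_velocity s w)) * (s * Cmod (log_velocity s w)))) as [g Hg].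
  { intro w. set (v := (s * log_velocity s w)%C).
    assert (Ev : Cmod v = s * Cmod (log_velocity s w)).
    { unfold v. rewrite Cmod_mult, Cmod_real_nonneg by lra. reflexivity. }
    rewrite <- Ev. destruct (Rle_dec (Cmod v) (1 / 2)) as [H|H]; [|exists 0; intro; lra].
    destruct (Cexp_log_near_1 v H) as [e [E1 E2]]. exists (w + e)%C. intros _. split.
    - replace (- (w + e))%C with (- w + - e)%C by ring. rewrite Cexp_plus, E1. reflexivity.
    - replace (w + e - w - v)%C with (e - v)%C by ring. exact E2. }
  set (zeta := fix zeta k := match k with O => w0 | S k => g (zeta k) end).
  assert (Vel : forall w x, x0 <= fst w -> 1 + fst w <= (1 + x0) * exp (2 * A * x) -> x <= t ->
            Cmod (log_velocity s w) <= A * (1 + fst w) /\ Cmod (log_velocity s w) <= B).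
  { intros w x Hw1 Hw2 Hxt. assert (Hw : rhp w) by (unfold rhp; lra).
    pose proof (Cmod_log_velocity_le s C1 w Hs Hw HC) as V. unfold rhp in Hw.
    assert (V1 : Cmod (log_velocity s w) <= A * (1 + fst w)).
    { apply Rmult_le_reg_r with (fst w); [exact Hw|]. eapply Rle_trans; [exact V|].
      apply Rle_trans with (C1 * (25 * ((1 + fst w) * (1 + fst w)))).
      - apply Rmult_le_compat_l; [lra|nra].
      - unfold A. replace (25 * C1 * ((1 + x0) / x0) * (1 + fst w) * fst w)
          with (C1 * (25 * ((1 + fst w) * ((1 + x0) / x0 * fst w)))) by ring.
        apply Rmult_le_compat_l; [lra|]. apply Rmult_le_compat_l; [lra|].
        apply Rmult_le_compat_l; [lra|].
        replace ((1 + x0) / x0 * fst w) with ((1 + x0) * fst w / x0) by (field; lra).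
        apply Rle_div_r_intro; [exact Hx0|]. nra. }
    split; [exact V1|]. eapply Rle_trans; [exact V1|]. unfold B.
    apply Rmult_le_compat_l; [lra|]. eapply Rle_trans; [exact Hw2|].
    apply Rmult_le_compat_l; [lra|].
    assert (2 * A * x <= 2 * A * t) by (apply Rmult_le_compat_l; lra).
    destruct H as [H|H]; [left; apply exp_increasing, H|rewrite H; lra]. }
  assert (Ind : forall k, INR k * s <= t ->
      Cexp (- zeta k) = Psi (INR k * s) (Cexp (- w0)) /\ x0 <= fst (zeta k) /\
      1 + fst (zeta k) <= (1 + x0) * exp (2 * A * (INR k * s))).
  { induction k as [|k IH]; intro Hk.
    - simpl. rewrite Rmult_0_l, Rmult_0_r, exp_0, (ds_0 _ _ HP Hu0). repeat split; lra.
    - assert (Hk' : INR k * s <= t) by (rewrite S_INR in Hk; lra).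
      destruct (IH Hk') as [I1 [I2 I3]]. destruct (Vel _ _ I2 I3 Hk') as [V1 V2].
      assert (Hv : s * Cmod (log_velocity s (zeta k)) <= 1 / 2).
      { eapply Rle_trans; [|exact HsB]. apply Rmult_le_compat_l; lra. }
      destruct (Hg (zeta k) Hv) as [G1 G2]. change (g (zeta k)) with (zeta (S k)) in G1, G2.
      rewrite <- Psi_Cexp_opp, I1, <- disc_semigroup_iter in G1 by (try assumption; lra).
      split; [exact G1|].
      assert (Mono : fst (zeta k) <= fst (zeta (S k))).
      { assert (M : exp (fst (- zeta (S k))%C) <= exp (fst (- zeta k)%C)).
        { rewrite <- !Cmod_Cexp, G1, I1, disc_semigroup_iter by (try assumption; lra).
          apply Cmod_Psi_le; [lra|]. rewrite <- I1. apply unit_disc_Cexp_opp. unfold rhp. lra. }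
        apply exp_le_inv in M. change (fst (- zeta (S k))%C) with (- fst (zeta (S k))) in M.
        change (fst (- zeta k)%C) with (- fst (zeta k)) in M. lra. }
      split; [lra|].
      set (u := Cmod (log_velocity s (zeta k))) in *. assert (Pu : 0 <= u) by apply Cmod_ge_0.
      assert (St : fst (zeta (S k)) - fst (zeta k) <= 2 * (s * u)).
      { apply Rle_trans with (Cmod (zeta (S k) - zeta k)).
        - pose proof (fst_le_Cmod (zeta (S k) - zeta k)) as F. clearbody zeta. simpl in F. lra.
        - pose proof (Cmod_triangle_inv (zeta (S k) - zeta k) (s * log_velocity s (zeta k))) as T.
          rewrite (Cmod_mult s), Cmod_real_nonneg in T by lra. fold u in T.
          assert (0 <= s * u) by (apply Rmult_le_pos; lra). nra. }
      apply Rle_trans with ((1 + fst (zeta k)) * (1 + 2 * A * s)).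
      + assert (s * u <= s * (A * (1 + fst (zeta k)))) by (apply Rmult_le_compat_l; lra). lra.
      + replace (2 * A * (INR (S k) * s)) with (2 * A * (INR k * s) + 2 * A * s) by (rewrite S_INR; ring).
        rewrite exp_plus, <- (Rmult_assoc (1 + x0)).
        assert (0 < A * s) by (apply Rmult_lt_0_compat; assumption).
        apply Rmult_le_compat; [lra|lra|exact I3|left; apply exp_ineq1; lra]. }
  exists zeta. split; [reflexivity|]. intros k Hk. destruct (Ind k Hk) as [I1 [I2 I3]].
  destruct (Vel _ _ I2 I3 Hk) as [V1 V2]. repeat split; try assumption.
  apply (Hg (zeta k)). eapply Rle_trans; [|exact HsB]. apply Rmult_le_compat_l; lra.
Qed.

Lemma Cmod_Cexp_opp_sub (a b : C) : rhp a -> fst a <= fst b ->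
  Cmod (Cexp (- b) - Cexp (- a)) <= exp (- fst a) * Cmod (b - a).
Proof.
  intros Ha Hab. apply (cderive_segment_bound (fun w => Cexp (- w)) (fun w => Cexp (- w) * - (1))%C).
  - intros r _. apply (has_cderive_comp Cexp (fun w => - w)%C); [|apply has_cderive_Cexp].
    apply has_cderive_opp, has_cderive_id.
  - intros r Hr. rewrite Cmod_mult, Cmod_opp, Cmod_1, Rmult_1_r, Cmod_Cexp.
    assert (H : fst (- (a + r * (b - a)))%C <= - fst a) by (simpl; nra).
    destruct H as [H|H]; [left; apply exp_increasing, H|rewrite H; lra].
Qed.

(** The factor [Cmod w + 1] in the bound on the lifted displacement is outweighed by
    the decay of [exp (-w)], since the starting point has a lift of bounded imaginary
    part. *)
Lemma interior_case_at_0 :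
  exists t1 M, 0 < t1 /\ 0 <= M /\
    forall z t, unit_disc z -> 0 < t <= t1 -> Cmod (Psi t z - z) <= M * sqrt t.
Proof.
  destruct exists_base_lift as [T [e [HT [He0 He]]]].
  set (X := fun t => fst (1 + e t)%C - 1).
  assert (HX : forall a b, 0 <= a -> a <= b -> b <= T -> X a <= X b).
  { intros a b Ha Hab Hb. destruct (He a ltac:(lra)) as [Ea _]. destruct (He b ltac:(lra)) as [Eb _].
    assert (M : exp (fst (- (1 + e b))%C) <= exp (fst (- (1 + e a))%C)).
    { rewrite <- !Cmod_Cexp, Ea, Eb. replace b with ((b - a) + a) by ring.
      rewrite <- (ds_comp _ HP) by (try apply base_disc; lra).
      apply Cmod_Psi_le; [lra|]. apply (ds_self _ HP); [exact Ha|apply base_disc]. }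
    apply exp_le_inv in M. unfold X. clearbody X. simpl in *. lra. }
  assert (Near : forall r, 0 <= r <= T -> rhp (1 + e r)).
  { intros r Hr. destruct (He r Hr) as [_ B]. pose proof (Rabs_fst_le_Cmod (e r)) as A.
    apply Rle_trans with (2 := B) in A. apply Rabs_le_between in A. unfold rhp. simpl. lra. }
  assert (Base : forall s, 0 < s <= T / 2 ->
            Cmod (log_velocity s 1) <= 2 / T /\ X (T / 2) <= 12 * T * fst (log_velocity s 1)).
  { apply base_point_bounds; [apply herglotz_log_velocity|exact HT|exact HX|].
    intros s n Hs Hns. exists (fun k => 1 + e (INR k * s)%R)%C.
    assert (Hk : forall k, (k <= n)%nat -> 0 <= INR k * s <= T).
    { intros k Hk. apply le_INR in Hk. pose proof (pos_INR k). nra. }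
    split; [|split; [|split]].
    - simpl INR. rewrite Rmult_0_l, He0. ring.
    - intros k Hk'. destruct (He _ (Hk k Hk')) as [_ B].
      replace (1 + e (INR k * s)%R - 1)%C with (e (INR k * s)) by ring. lra.
    - intros k Hk'. destruct (He _ (Hk k ltac:(lia))) as [A1 B1].
      destruct (He _ (Hk (S k) ltac:(lia))) as [A2 B2].
      pose proof (Near _ (Hk k ltac:(lia))) as Hr.
      set (a := (1 + e (INR k * s)%R)%C) in *. set (b := (1 + e (INR (S k) * s)%R)%C) in *.
      rewrite (disc_semigroup_iter Psi base s k HP base_disc ltac:(lra)), <- A1, Psi_Cexp_opp in A2 by exact Hs.
      apply Cexp_opp_sub in A2.
      assert (Hsm : Cmod (b - a) <= 1 / 16).
      { replace (b - a)%C with (e (INR (S k) * s)%R - e (INR k * s)%R)%C by (unfold a, b; ring).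
        eapply Rle_trans; [apply Cmod_triangle_sub|]. lra. }
      assert (Pv : 0 <= fst (log_velocity s a)) by (apply herglotz_log_velocity; assumption).
      set (v := log_velocity s a) in *.
      assert (Fv : fst (s * v)%C = s * fst v) by (clearbody v; simpl; ring).
      destruct (log_step_near_1 (b - a) (s * v) A2 Hsm) as [L1 L2].
      { rewrite Fv. apply Rmult_le_pos; lra. }
      rewrite Cmod_mult, Cmod_real_nonneg in L1 by lra. rewrite Fv in L2.
      split; [exact L1|]. clearbody a b v. simpl in L2. lra.
    - reflexivity. }
  assert (X0 : 0 <= X (T / 2)).
  { pose proof (HX 0 (T / 2) ltac:(lra) ltac:(lra) ltac:(lra)) as A. unfold X at 1 in A.
    rewrite He0 in A. replace (fst (1 + 0)%C - 1) with 0 in A by (simpl; ring). exact A. }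
  set (C1 := 2 / T) in *. assert (HC1 : 0 < C1) by (apply Rdiv_lt_0_compat; lra).
  destruct X0 as [X0|X0].
  - (* the orbit of the base point gets closer to 0 *)
    set (c1 := X (T / 2) / (12 * T)). assert (Hc1 : 0 < c1) by (apply Rdiv_lt_0_compat; lra).
    set (c := c1 / (C1 * C1)). assert (Hc : 0 < c) by (apply Rdiv_lt_0_compat; nra).
    pose proof (sqrt_lt_R0 c Hc) as Psc. pose proof (Rinv_0_lt_compat _ Psc) as Pi.
    exists (c / 16), (20 * / sqrt c). split; [lra|]. split; [lra|].
    intros z t Hz Ht. pose proof (sqrt_pos t) as Pst.
    destruct (Ceq_dec z 0) as [->|Nz].
    { rewrite Hfix by lra. replace (0 - 0)%C with (RtoC 0) by ring. rewrite Cmod_0.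
      repeat apply Rmult_le_pos; lra. }
    destruct (exists_lift z Nz Hz) as [w0 [Ew [Hw0 Sw0]]].
    set (x0 := fst w0). assert (Hx0 : 0 < x0) by exact Hw0.
    set (A := 25 * C1 * ((1 + x0) / x0)).
    set (B := A * ((1 + x0) * exp (2 * A * t))).
    assert (HA : 0 < A).
    { unfold A. assert (0 < (1 + x0) / x0) by (apply Rdiv_lt_0_compat; lra).
      apply Rmult_lt_0_compat; lra. }
    assert (HB : 0 < B).
    { unfold B. pose proof (exp_pos (2 * A * t)). apply Rmult_lt_0_compat; [exact HA|]. apply Rmult_lt_0_compat; lra. }
    destruct (fine_chain_displacement (fun w => Cexp (- w) = Psi t z) c1 C1 t
                (Rmin (T / 2) (/ (2 * B))) B w0) as [w' [Hw' [Hmono Hbound]]]; try assumption; try lra.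
    { apply Rmin_glb_lt; [lra|]. apply Rinv_0_lt_compat. lra. }
    { fold c. lra. }
    { intros n Hn Hs. set (s := t / INR n) in *.
      assert (Pn : 0 < INR n) by (apply lt_0_INR, Hn).
      assert (Ps : 0 < s) by (apply Rdiv_lt_0_compat; lra).
      assert (Ens : INR n * s = t) by (unfold s; field; lra).
      assert (S1 : s <= T / 2) by (eapply Rle_trans; [exact Hs|apply Rmin_l]).
      assert (S2 : s <= / (2 * B)) by (eapply Rle_trans; [exact Hs|apply Rmin_r]).
      assert (S3 : s * B <= 1 / 2).
      { apply Rle_trans with (/ (2 * B) * B); [apply Rmult_le_compat_r; lra|]. right. field. lra. }
      assert (Hk : forall k, (k <= n)%nat -> INR k * s <= t).
      { intros k Hk. apply le_INR in Hk. rewrite <- Ens. apply Rmult_le_compat_r; lra. }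
      destruct (Base s (conj Ps S1)) as [B1 B2].
      destruct (exists_log_chain s C1 x0 t w0 Ps HC1 B1 eq_refl Hx0 S3) as [zeta [Z0 Z]].
      exists (log_velocity s), zeta.
      split; [apply herglotz_log_velocity, Ps|]. split; [|split; [exact B1|split; [exact Z0|split; [|split]]]].
      - unfold c1. apply Rle_div_l; lra.
      - intros k Hk'. apply Z, Hk, Hk'.
      - intros k Hk'. apply Z, Hk. lia.
      - destruct (Z n (Hk n (Nat.le_refl n))) as [E _]. rewrite E, Ens, Ew. reflexivity. }
    rewrite <- Hw', <- Ew. eapply Rle_trans; [apply Cmod_Cexp_opp_sub; assumption|].
    fold x0 c in Hbound |- *. rewrite sqrt_div_alt in Hbound by exact Hc. unfold Rdiv in Hbound.
    assert (Q : 0 <= sqrt t * / sqrt c) by (apply Rmult_le_pos; lra).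
    assert (Hw1 : exp (- x0) * (Cmod w0 + 1) <= 5).
    { pose proof (Cmod_le_abs_fst_snd w0) as F. fold x0 in F. rewrite (Rabs_pos_eq x0) in F by lra.
      pose proof PI_4. pose proof (exp_ineq1_le x0) as I. pose proof (exp_pos x0) as Pe.
      rewrite exp_Ropp. rewrite Rmult_comm. apply Rle_div_l; [exact Pe|]. lra. }
    apply Rle_trans with (exp (- x0) * (4 * (sqrt t * / sqrt c) * (Cmod w0 + 1))).
    { apply Rmult_le_compat_l; [left; apply exp_pos|exact Hbound]. }
    replace (exp (- x0) * (4 * (sqrt t * / sqrt c) * (Cmod w0 + 1)))
      with (4 * (sqrt t * / sqrt c) * (exp (- x0) * (Cmod w0 + 1))) by ring.
    apply Rle_trans with (4 * (sqrt t * / sqrt c) * 5); [apply Rmult_le_compat_l; lra|]. lra.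
  - (* the orbit of the base point stays on a circle: each map is a rotation about 0 *)
    exists (Rmin (T / 2) 1), C1.
    split; [apply Rmin_glb_lt; lra|]. split; [lra|]. intros z t Hz Ht.
    pose proof (Rmin_l (T / 2) 1). pose proof (Rmin_r (T / 2) 1).
    assert (Ht' : 0 < t <= T / 2) by lra. destruct (Base t Ht') as [B1 _].
    apply sqrt_bound_of_linear; [lra|lra|].
    destruct (Ceq_dec z 0) as [->|Nz].
    { rewrite Hfix by lra. replace (0 - 0)%C with (RtoC 0) by ring. rewrite Cmod_0.
      apply Rmult_le_pos; lra. }
    assert (Q1 : Cmod (quotient t 1) = 1).
    { apply Rle_antisym; [apply Cmod_quotient_le; [lra|apply rhp_1]|].
      destruct (He t ltac:(lra)) as [Et _].
      pose proof (HX t (T / 2) ltac:(lra) ltac:(lra) ltac:(lra)) as A. rewrite <- X0 in A. unfold X in A.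
      unfold quotient. fold base. rewrite Cmod_mult, <- Et, !Cmod_Cexp, <- exp_plus, <- exp_0.
      set (y := e t) in *. clearbody y. simpl in *.
      match goal with |- _ <= exp ?x => assert (Hx : 0 <= x) by lra end.
      destruct Hx as [Hx|Hx]; [left; apply exp_increasing, Hx|rewrite <- Hx; lra]. }
    destruct (exists_lift z Nz Hz) as [w0 [Ew [Hw0 _]]].
    rewrite <- Ew, Psi_Cexp_opp by lra.
    assert (EV : log_velocity t w0 = log_velocity t 1).
    { unfold log_velocity. rewrite (quotient_const t w0 ltac:(lra) Hw0 Q1). reflexivity. }
    rewrite EV, Ew.
    replace (z * (1 - t * log_velocity t 1) - z)%C with (- (z * (t * log_velocity t 1)))%C by ring.
    rewrite Cmod_opp, !Cmod_mult, Cmod_real_nonneg by lra.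
    unfold unit_disc in Hz. pose proof (Cmod_ge_0 z). pose proof (Cmod_ge_0 (log_velocity t 1)).
    assert (t * Cmod (log_velocity t 1) <= t * C1) by (apply Rmult_le_compat_l; lra).
    assert (0 <= t * Cmod (log_velocity t 1)) by (apply Rmult_le_pos; lra). nra.
Qed.

End FixedPointAtZero.

(** * The general case *)

Definition disc_involution (a z : C) : C := ((a - z) / (1 - Cconj a * z))%C.

Section Involution.

Variable a : C.
Hypothesis Ha : unit_disc a.

Lemma involution_denom (z : C) : unit_disc z -> (1 - Cconj a * z)%C <> 0.
Proof. intro Hz. apply one_minus_neq_0, Cmod_conj_mult_lt_1; [left; exact Ha|exact Hz]. Qed.

Lemma unit_disc_involution (z : C) : unit_disc z -> unit_disc (disc_involution a z).
Proof.
  intro Hz. pose proof (involution_denom z Hz) as N. pose proof (proj1 (Cmod_gt_0 _) N) as P.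
  unfold unit_disc, disc_involution in *. rewrite Cmod_div by exact N.
  apply (Rlt_div_l (Cmod (a - z))); [exact P|].
  pose proof (Pick_identity_disc a z) as I. rewrite (Cmod_sub_sym z a) in I.
  pose proof (Cmod_ge_0 a). pose proof (Cmod_ge_0 z).
  assert (0 < (1 - Cmod a * Cmod a) * (1 - Cmod z * Cmod z)) by (apply Rmult_lt_0_compat; nra).
  apply Rnot_le_lt. intro. nra.
Qed.

Lemma involution_involution (z : C) : unit_disc z -> disc_involution a (disc_involution a z) = z.
Proof.
  intro Hz. pose proof (involution_denom z Hz) as N. pose proof (involution_denom a Ha) as Na.
  unfold disc_involution. field. split; [exact N|].
  replace (1 - Cconj a * z - Cconj a * (a - z))%C with (1 - Cconj a * a)%C by ring. exact Na.
Qed.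

Lemma cdiff_involution (z : C) : unit_disc z -> cdiff (disc_involution a) z.
Proof.
  intro Hz. unfold disc_involution. apply cdiff_div; [| |apply involution_denom, Hz].
  - apply cdiff_minus; [apply cdiff_const|apply cdiff_id].
  - apply cdiff_minus; [apply cdiff_const|apply cdiff_mult; [apply cdiff_const|apply cdiff_id]].
Qed.

Definition involution_lipschitz : R := / ((1 - Cmod a) * (1 - Cmod a)).

Lemma Cmod_involution_sub (z w : C) : unit_disc z -> unit_disc w ->
  Cmod (disc_involution a z - disc_involution a w) <= involution_lipschitz * Cmod (z - w).
Proof.
  intros Hz Hw. pose proof (involution_denom z Hz) as Nz. pose proof (involution_denom w Hw) as Nw.
  unfold disc_involution, involution_lipschitz. unfold unit_disc in *. pose proof (Cmod_ge_0 a) as Pa.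
  assert (L : forall v, Cmod v < 1 -> 1 - Cmod a <= Cmod (1 - Cconj a * v)).
  { intros v Hv. pose proof (Cmod_triangle_inv 1 (Cconj a * v)) as T.
    rewrite Cmod_1, Cmod_mult, Cmod_conj in T. pose proof (Cmod_ge_0 v). nra. }
  replace ((a - z) / (1 - Cconj a * z) - (a - w) / (1 - Cconj a * w))%C
    with ((1 - Cconj a * a) * (- (z - w)) / ((1 - Cconj a * z) * (1 - Cconj a * w)))%C
    by (field; split; assumption).
  rewrite Cmod_div by (apply Cmult_neq_0; assumption). rewrite !Cmod_mult, Cmod_opp.
  pose proof (L z Hz). pose proof (L w Hw). pose proof (Cmod_ge_0 (z - w)).
  assert (K : Cmod (1 - Cconj a * a) <= 1).
  { replace (Cconj a * a)%C with (RtoC (Cmod a * Cmod a)).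
    - rewrite <- RtoC_minus, Cmod_real_nonneg; nra.
    - replace (Cconj a * a)%C with (a * Cconj a)%C by ring. rewrite <- Cmod2_conj. f_equal. ring. }
  rewrite (Rmult_comm (/ _)). unfold Rdiv.
  apply Rmult_le_compat.
  - apply Rmult_le_pos; apply Cmod_ge_0.
  - left. apply Rinv_0_lt_compat, Rmult_lt_0_compat; lra.
  - pose proof (Cmod_ge_0 (1 - Cconj a * a)). nra.
  - apply Rinv_le_contravar; [apply Rmult_lt_0_compat; lra|]. apply Rmult_le_compat; lra.
Qed.

Lemma involution_lipschitz_pos : 0 < involution_lipschitz.
Proof. unfold unit_disc in Ha. apply Rinv_0_lt_compat, Rmult_lt_0_compat; lra. Qed.

Lemma conjugate_disc_semigroup (Phi : R -> C -> C) : disc_semigroup Phi ->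
  disc_semigroup (fun t z => disc_involution a (Phi t (disc_involution a z))).
Proof.
  intro HP. split.
  - intros t z Ht Hz. pose proof (unit_disc_involution z Hz) as Hi.
    apply (cdiff_comp (disc_involution a) (fun z => Phi t (disc_involution a z))).
    + apply (cdiff_comp (Phi t) (disc_involution a)); [apply cdiff_involution, Hz|].
      apply (ds_diff _ HP); assumption.
    + apply cdiff_involution, (ds_self _ HP); assumption.
  - intros t z Ht Hz. apply unit_disc_involution, (ds_self _ HP); [exact Ht|].
    apply unit_disc_involution, Hz.
  - intros t u z Ht Hu Hz. pose proof (unit_disc_involution z Hz) as Hi.
    rewrite involution_involution by (apply (ds_self _ HP); assumption).
    rewrite (ds_comp _ HP) by assumption. reflexivity.
  - intros z eps Hz Heps. pose proof (unit_disc_involution z Hz) as Hi.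
    pose proof involution_lipschitz_pos as PL.
    destruct (ds_cont _ HP (disc_involution a z) (eps / involution_lipschitz) Hi) as [d [Hd Hw]].
    { apply Rdiv_lt_0_compat; assumption. }
    exists d. split; [exact Hd|]. intros t Ht. specialize (Hw t Ht).
    rewrite <- (involution_involution z Hz) at 2.
    eapply Rle_lt_trans; [apply Cmod_involution_sub; [apply (ds_self _ HP); [lra|exact Hi]|exact Hi]|].
    apply (Rmult_lt_compat_l involution_lipschitz) in Hw; [|exact PL].
    replace (involution_lipschitz * (eps / involution_lipschitz)) with eps in Hw by (field; lra).
    exact Hw.
Qed.

End Involution.

(** If [Cmod tau < 1], the maximum of [horo tau] is attained at [tau] only. *)
Lemma horo_max_fixed (Phi : R -> C -> C) (tau : C) (t : R) :
  disc_semigroup Phi -> unit_disc tau -> 0 <= t ->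
  horo tau tau <= horo tau (Phi t tau) -> Phi t tau = tau.
Proof.
  intros HP Ht0 Ht H. set (w := Phi t tau) in *.
  assert (Hw : unit_disc w) by (apply (ds_self _ HP); assumption).
  pose proof (pseudo_denom_pos tau w (Rlt_le _ _ Ht0) Hw) as P.
  pose proof (Pick_identity_disc tau w) as I. pose proof (Pick_identity_disc tau tau) as I0.
  replace (tau - tau)%C with (RtoC 0) in I0 by ring. rewrite Cmod_0 in I0.
  unfold horo in H. unfold unit_disc in Ht0. pose proof (Cmod_ge_0 tau).
  set (q := 1 - Cmod tau * Cmod tau) in *. assert (Pq : 0 < q) by (unfold q; nra).
  replace (Cmod (1 - Cconj tau * tau) * Cmod (1 - Cconj tau * tau)) with (q * q) in H by lra.
  replace (q / (q * q)) with (/ q) in H by (field; lra).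
  apply (proj2 (Rle_div_r _ _ (Cmod (1 - Cconj tau * w) * Cmod (1 - Cconj tau * w)) ltac:(nra))) in H.
  apply (Rmult_le_compat_l q) in H; [|lra].
  rewrite <- Rmult_assoc, Rinv_r, Rmult_1_l, I in H by lra.
  apply Ceq_minus, Cmod_eq_0. pose proof (Cmod_ge_0 (w - tau)). nra.
Qed.

Lemma interior_case (Phi : R -> C -> C) (tau : C) :
  disc_semigroup Phi -> unit_disc tau -> (forall t, 0 <= t -> Phi t tau = tau) ->
  exists t1 M, 0 < t1 /\ 0 <= M /\
    forall z t, unit_disc z -> 0 < t <= t1 -> Cmod (Phi t z - z) <= M * sqrt t.
Proof.
  intros HP Htau Hfix. pose proof (involution_lipschitz_pos tau Htau) as PL.
  destruct (interior_case_at_0 _ (conjugate_disc_semigroup tau Htau Phi HP)) as [t1 [M [Ht1 [HM H]]]].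
  { intros t Ht.
    assert (E : disc_involution tau 0 = tau).
    { unfold disc_involution. replace (1 - Cconj tau * 0)%C with (RtoC 1) by ring. field. }
    rewrite E, Hfix by exact Ht. unfold disc_involution.
    replace (tau - tau)%C with (RtoC 0) by ring. unfold Cdiv. ring. }
  exists t1, (involution_lipschitz tau * M). split; [exact Ht1|]. split; [apply Rmult_le_pos; lra|].
  intros z t Hz Ht. set (u := disc_involution tau z).
  assert (Hu : unit_disc u) by (apply unit_disc_involution; assumption).
  specialize (H u t Hu Ht). cbv beta in H. unfold u in H at 1.
  rewrite involution_involution in H by assumption.
  assert (HPz : unit_disc (Phi t z)) by (apply (ds_self _ HP); [lra|exact Hz]).
  assert (E : (Phi t z - z)%C = (disc_involution tau (disc_involution tau (Phi t z)) - disc_involution tau u)%C).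
  { unfold u. rewrite !involution_involution by assumption. reflexivity. }
  rewrite E. eapply Rle_trans.
  - apply Cmod_involution_sub; [exact Htau|apply unit_disc_involution; assumption|exact Hu].
  - rewrite Rmult_assoc. apply Rmult_le_compat_l; [lra|exact H].
Qed.

Theorem theorem1p1 :
  forall Phi : R -> C -> C,
    continuous_semigroup unit_disc Phi ->
    exists M : R, 0 < M /\
      forall (z : C) (t : R), unit_disc z -> 0 < t ->
        Cmod (Phi t z - z)%C <= M * sqrt t.
Proof.
  intros Phi H. pose proof (continuous_semigroup_disc Phi H) as HP.
  destruct (Denjoy_Wolff Phi HP) as [tau [Htau Hhoro]].
  assert (Short : exists t1 M, 0 < t1 /\ 0 <= M /\
    forall z t, unit_disc z -> 0 < t <= t1 -> Cmod (Phi t z - z) <= M * sqrt t).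
  { destruct Htau as [Hlt|Heq].
    - apply (interior_case Phi tau HP Hlt). intros t Ht.
      apply horo_max_fixed; try assumption. apply Hhoro; assumption.
    - exact (boundary_case tau Heq Phi HP Hhoro). }
  destruct Short as [t1 [M [Ht1 [HM Hshort]]]].
  pose proof (sqrt_lt_R0 t1 Ht1) as P1.
  assert (P2 : 0 < 2 / sqrt t1) by (apply Rdiv_lt_0_compat; lra).
  exists (M + 2 / sqrt t1). split; [lra|]. intros z t Hz Ht.
  pose proof (sqrt_lt_R0 t Ht) as Pt.
  destruct (Rle_dec t t1) as [L|L].
  - eapply Rle_trans; [apply Hshort; [exact Hz|lra]|]. apply Rmult_le_compat_r; lra.
  - assert (A : sqrt t1 <= sqrt t) by (apply sqrt_le_1; lra).
    pose proof (ds_self _ HP t z ltac:(lra) Hz) as Hw. unfold unit_disc in *.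
    apply Rle_trans with 2; [eapply Rle_trans; [apply Cmod_triangle_sub|]; lra|].
    apply Rle_trans with (2 / sqrt t1 * sqrt t).
    + replace 2 with (2 / sqrt t1 * sqrt t1) at 1 by (field; lra). apply Rmult_le_compat_l; lra.
    + apply Rmult_le_compat_r; lra.
Qed.
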